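(* For every $s\in\mathbb{C}$ with $\mathrm{Re}(s)>0$, the matrix $\frac{\partial}{\partial\boldsymbol\theta}\boldsymbol\Xi(s;\boldsymbol\theta)$ is the solution $\mathbf X$ of the equation $$\mathbf A\mathbf X+\mathbf X\mathbf B=-\mathbf D,$$ where $$\mathbf A=\mathbf J(s;\boldsymbol\theta)=\mathbf Q_{--}(s;\boldsymbol\theta)+\boldsymbol\Xi(s;\boldsymbol\theta)\mathbf Q_{+-}(s;\boldsymbol\theta),$$ $$\mathbf B=\mathbf I\otimes\mathbf U(s;\boldsymbol\theta),\qquad \mathbf U(s;\boldsymbol\theta)=\mathbf Q_{++}(s;\boldsymbol\theta)+\mathbf Q_{+-}(s;\boldsymbol\theta)\boldsymbol\Xi(s;\boldsymbol\theta),$$ $$\mathbf D=\frac{\partial\mathbf Q_{-+}(s;\boldsymbol\theta)}{\partial\boldsymbol\theta}+\frac{\partial\mathbf Q_{--}(s;\boldsymbol\theta)}{\partial\boldsymbol\theta}\big(\mathbf I\otimes\boldsymbol\Xi(s;\boldsymbol\theta)\big)+\boldsymbol\Xi(s;\boldsymbol\theta)\frac{\partial\mathbf Q_{++}(s;\boldsymbol\theta)}{\partial\boldsymbol\theta}+\boldsymbol\Xi(s;\boldsymbol\theta)\left\{\frac{\partial\mathbf Q_{+-}(s;\boldsymbol\theta)}{\partial\boldsymbol\theta}\big(\mathbf I\otimes\boldsymbol\Xi(s;\boldsymbol\theta)\big)\right\}.$$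
   Context: Model. $\{\varphi(t):t\ge0\}$ is a continuous-time Markov chain on $\mathcal S=\{1,\dots,m\}$ with (conservative) generator $\mathbf T=[T_{ij}]$, and $c_i\in\mathbb R$ are fluid rates. The level process without boundary, $\widetilde X(t)\in\mathbb R$, satisfies $\frac{d\widetilde X(t)}{dt}=c_{\varphi(t)}$. Put $\mathcal S_+=\{i:c_i>0\}$, $\mathcal S_-=\{i:c_i<0\}$, $\mathcal S_0=\{i:c_i=0\}$, with $\mathcal S_+,\mathcal S_-$ nonempty. $\mathbf T_{+-}=[T_{ij}]_{i\in\mathcal S_+,j\in\mathcal S_-}$, and similarly for the other blocks; $\mathbf C_+=\mathrm{diag}(c_i)_{i\in\mathcal S_+}$, $|\mathbf C_-|=\mathrm{diag}(|c_i|)_{i\in\mathcal S_-}$. Parameters. $\mathbf T=\mathbf T(\boldsymbol\theta)$ and $c_i=c_i(\boldsymbol\theta)$ depend differentiably on a real parameter vector $\boldsymbol\theta=(\theta_1,\dots,\theta_r)$ in an open set, with $\mathcal S_+,\mathcal S_-,\mathcal S_0$ not depending on $\boldsymbol\theta$. Derivative convention. For a $p\times q$ matrix function $\mathbf M(\boldsymbol\theta)$, $\frac{\partial\mathbf M}{\partial\boldsymbol\theta}=\big[\frac{\partial\mathbf M}{\partial\theta_1}\ \cdots\ \frac{\partial\mathbf M}{\partial\theta_r}\big]$, a $p\times qr$ matrix; in $\mathbf I\otimes\mathbf M$ (Kronecker product) $\mathbf I$ is the $r\times r$ identity. Thus $\frac{\partial(\mathbf M\mathbf N)}{\partial\boldsymbol\theta}=\frac{\partial\mathbf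 M}{\partial\boldsymbol\theta}(\mathbf I\otimes\mathbf N)+\mathbf M\frac{\partial\mathbf N}{\partial\boldsymbol\theta}$. Fluid generator blocks (omit the terms with index $0$ if $\mathcal S_0=\emptyset$): $\mathbf Q_{++}(s;\boldsymbol\theta)=\mathbf C_+^{-1}(\mathbf T_{++}-s\mathbf I-\mathbf T_{+0}(\mathbf T_{00}-s\mathbf I)^{-1}\mathbf T_{0+})$, $\mathbf Q_{+-}(s;\boldsymbol\theta)=\mathbf C_+^{-1}(\mathbf T_{+-}-\mathbf T_{+0}(\mathbf T_{00}-s\mathbf I)^{-1}\mathbf T_{0-})$, $\mathbf Q_{--}(s;\boldsymbol\theta)=|\mathbf C_-|^{-1}(\mathbf T_{--}-s\mathbf I-\mathbf T_{-0}(\mathbf T_{00}-s\mathbf I)^{-1}\mathbf T_{0-})$, $\mathbf Q_{-+}(s;\boldsymbol\theta)=|\mathbf C_-|^{-1}(\mathbf T_{-+}-\mathbf T_{-0}(\mathbf T_{00}-s\mathbf I)^{-1}\mathbf T_{0+})$. Key matrix. $\boldsymbol\Xi(s;\boldsymbol\theta)=[\Xi(s;\boldsymbol\theta)_{ij}]_{i\in\mathcal S_-,j\in\mathcal S_+}$, $\Xi(s;\boldsymbol\theta)_{ij}=\mathbb E\big(e^{-s\widetilde\delta(0)}I(\varphi(\widetilde\delta(0))=j)\mid \widetilde X(0)=0,\varphi(0)=i\big)$, where $\widetilde\delta(x)=\inf\{t>0:\widetilde X(t)=x\}$ (the integrand is $0$ when $\widetilde\delta(0)=\infty$). *)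

(* Defs.v *)
From HB Require Import structures.
From mathcomp Require Import all_boot all_order all_algebra.
From mathcomp Require Import all_classical all_reals all_analysis.
From mathcomp Require Import complex mxtens.

Set Implicit Arguments.
Unset Strict Implicit.
Unset Printing Implicit Defensive.

Import Order.TTheory GRing.Theory Num.Theory.
Import numFieldNormedType.Exports.

Local Open Scope classical_set_scope.
Local Open Scope ring_scope.
Local Open Scope complex_scope.

Section MarkovChain.
Context (R : realType) (m : nat).

Definition conservative_generator (T : 'M[R]_m) : Prop :=
  (forall i j, i != j -> 0 <= T i j) /\ (forall i, \sum_j T i j = 0).

(* Standard transition function with infinitesimal generator T; it is only
   constrained at nonnegative times, where these conditions force
   p t = exp (t T). *)
Record transition_function (T : 'M[R]_m) (p : R -> 'M[R]_m) : Prop := {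
  tf_ge0 : forall t i j, 0 <= t -> 0 <= p t i j ;
  tf_sum1 : forall t i, 0 <= t -> \sum_j p t i j = 1 ;
  tf_0 : p 0 = 1%:M ;
  tf_add : forall t u, 0 <= t -> 0 <= u -> p (t + u) = p t *m p u ;
  tf_generator : forall i j,
    h^-1 * (p h i j - (i == j)%:R) @[h --> 0^'+] --> T i j }.

Definition past d (Omega : measurableType d) (phi : R -> Omega -> 'I_m) (t : R) :
    set (set Omega) :=
  <<s [set B | exists u i, [/\ 0 <= u, u <= t & B = [set w | phi u w = i]]] >>.

(* A chain on [0, +oo[ (negative times are ignored).  A path in a discrete
   space with right limits attained and left limits is a step function with
   finitely many jumps in every bounded interval. *)
Record continuous_time_Markov_chain d (Omega : measurableType d)
    (P : probability Omega R) (T : 'M[R]_m) (phi : R -> Omega -> 'I_m) : Prop := {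
  ctmc_measurable : forall t i, 0 <= t -> measurable [set w | phi t w = i] ;
  ctmc_right_continuous : forall w t, 0 <= t ->
    \forall u \near t^'+, phi u w = phi t w ;
  ctmc_left_limit : forall w t, 0 < t ->
    exists i, \forall u \near t^'-, phi u w = i ;
  ctmc_Markov : exists2 p, transition_function T p &
    forall t h (A : set Omega) i j, 0 <= t -> 0 <= h -> past phi t A ->
      P (A `&` [set w | phi t w = i] `&` [set w | phi (t + h) w = j]) =
      (P (A `&` [set w | phi t w = i]) * (p h i j)%:E)%E }.

End MarkovChain.

Section LevelProcess.
Context (R : realType) (m : nat) (d : measure_display) (Omega : measurableType d).
Variables (c : 'I_m -> R) (phi : R -> Omega -> 'I_m).

(* Level at time t, started from x0: the integrated form of dX/dt = c_phi. *)
Definition level (x0 t : R) (w : Omega) : R :=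
  x0 + \int[lebesgue_measure]_(u in `[0, t]) c (phi u w).

(* First time t > 0 at which the level started from x0 equals x; +oo if none. *)
Definition passage_time (x0 x : R) (w : Omega) : \bar R :=
  ereal_inf [set t%:E | t in [set t | 0 < t /\ level x0 t w = x]].

Definition cexp (z : R[i]) : R[i] :=
  (expR (complex.Re z) * cos (complex.Im z)) +i*
  (expR (complex.Re z) * sin (complex.Im z)).

Definition passage_weight (s : R[i]) (x0 x : R) (j : 'I_m) (w : Omega) : R[i] :=
  if passage_time x0 x w is t%:E
  then cexp (- s * t%:C) * (phi t w == j)%:R else 0.

Definition cond_expectation (P : probability Omega R) (A : set Omega)
    (f : Omega -> R[i]) : R[i] :=
  ((\int[P]_(w in A) complex.Re (f w)) +i* (\int[P]_(w in A) complex.Im (f w)))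
  / (fine (P A))%:C.

(* The conditioning on level 0 at time 0 is built in by starting at x0 = 0. *)
Definition Xi (P : probability Omega R) (Sm Sp : {set 'I_m}) (s : R[i]) :
    'M[R[i]]_(#|Sm|, #|Sp|) :=
  \matrix_(i, j) cond_expectation P [set w | phi 0 w = enum_val i]
    (passage_weight s 0 0 (enum_val j)).

End LevelProcess.

Section FluidGenerator.
Context (R : realType) (m : nat).
Variables (T : 'M[R]_m) (c : 'I_m -> R) (Sp Sm S0 : {set 'I_m}) (s : R[i]).

Definition block (A B : {set 'I_m}) : 'M[R[i]]_(#|A|, #|B|) :=
  \matrix_(i, j) (T (enum_val i) (enum_val j))%:C.

Definition rate_mx (A : {set 'I_m}) : 'M[R[i]]_(#|A|) :=
  diag_mx (\row_i (c (enum_val i))%:C).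

Definition abs_rate_mx (A : {set 'I_m}) : 'M[R[i]]_(#|A|) :=
  diag_mx (\row_i `|c (enum_val i)|%:C).

(* When S0 is empty the products below run over an empty index, so the terms
   through S0 vanish. *)
Let inv00 := invmx (block S0 S0 - s%:M).

Definition Qpp : 'M[R[i]]_(#|Sp|) :=
  invmx (rate_mx Sp) *m
  (block Sp Sp - s%:M - block Sp S0 *m inv00 *m block S0 Sp).

Definition Qpm : 'M[R[i]]_(#|Sp|, #|Sm|) :=
  invmx (rate_mx Sp) *m
  (block Sp Sm - block Sp S0 *m inv00 *m block S0 Sm).

Definition Qmm : 'M[R[i]]_(#|Sm|) :=
  invmx (abs_rate_mx Sm) *m
  (block Sm Sm - s%:M - block Sm S0 *m inv00 *m block S0 Sm).

Definition Qmp : 'M[R[i]]_(#|Sm|, #|Sp|) :=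
  invmx (abs_rate_mx Sm) *m
  (block Sm Sp - block Sm S0 *m inv00 *m block S0 Sp).

End FluidGenerator.

Section MatrixDerivative.
Context (R : realType) (r : nat).

(* Partial derivatives of a complex-valued function of real parameters are
   taken on the real and imaginary parts. *)
Definition cpartial (f : 'rV[R]_r -> R[i]) (l : 'I_r) (theta : 'rV[R]_r) : R[i] :=
  ('D_(delta_mx 0 l) (fun t => complex.Re (f t) : R^o) theta) +i*
  ('D_(delta_mx 0 l) (fun t => complex.Im (f t) : R^o) theta).

Definition cpartial_derivable (f : 'rV[R]_r -> R[i]) (l : 'I_r)
    (theta : 'rV[R]_r) : Prop :=
  derivable (fun t => complex.Re (f t) : R^o) theta (delta_mx 0 l) /\
  derivable (fun t => complex.Im (f t) : R^o) theta (delta_mx 0 l).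

Context (p q : nat).

(* The block row [dM/dtheta_1 ... dM/dtheta_r]: mxtens_unindex k is the pair
   (k %/ q, k %% q), i.e. (block, column in the block), the same indexing as in
   1%:M *t N. *)
Definition dmx (M : 'rV[R]_r -> 'M[R[i]]_(p, q)) (theta : 'rV[R]_r) :
    'M[R[i]]_(p, r * q) :=
  \matrix_(i, k) cpartial (fun t => M t i (mxtens_unindex k).2)
    (mxtens_unindex k).1 theta.

Definition dmx_exists (M : 'rV[R]_r -> 'M[R[i]]_(p, q)) (theta : 'rV[R]_r) : Prop :=
  forall i j l, cpartial_derivable (fun t => M t i j) l theta.

End MatrixDerivative.

(* Main.v *)
(** Let P = I + eps Q be the blocks Q of the fluid generator uniformized with a small eps: their
rows have norm at most 1 - delta.  Then the Riccati equation Q-+ + Q-- K + K Q++ + K Q+- K = 0 has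
a solution K with rows of norm at most 1, and every D with
(Q-- + K Q+-) D + D (Q++ + Q+- K') = - G, for K, K' of norm at most 1 and K a solution, satisfies
|D| <= kappa |G| with kappa independent of K and K'.  The case G = 0 makes the Sylvester equation
uniquely solvable; applied to increments in theta, and then to difference quotients, the bound
gives the continuity and the differentiability of K.

To identify K with Xi, extend K to a bounded function f(x, i) = (Phi e^{-Ux})_{ij} of the level
x and the state i such that e^{-st} f(X_t, phi_t) is a martingale until the passage to level 0,
where f is the indicator of j.  The chain is sampled with step h = b^2 and stopped at the first
time at which the Euler approximation of the level exceeds -b.  The level error being O(b^2),
this happens shortly before the passage, at a level O(b), and the expectations telescope with an
error that vanishes as b tends to 0.  The state at the passage time itself is obtained by looking
at the chain a lag delta later, where delta tends to 0 after b. *)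

Require Import Defs.
From HB Require Import structures.
From mathcomp Require Import all_boot all_order all_algebra.
From mathcomp Require Import all_classical all_reals all_analysis.
From mathcomp Require Import measurable_realfun complex mxtens.
From mathcomp Require Import ring lra.

Set Implicit Arguments.
Unset Strict Implicit.
Unset Printing Implicit Defensive.

Import Order.TTheory GRing.Theory Num.Theory.
Import numFieldNormedType.Exports.
Import ComplexField.Normc.
Local Open Scope classical_set_scope.
Local Open Scope ring_scope.
Local Open Scope complex_scope.
Local Notation Re := complex.Re.
Local Notation Im := complex.Im.

(** [Xi] is given only as an expectation, so neither differentiability nor even continuity in theta
    is known beforehand; hence the detour through a stability estimate that treats the Riccati
    equation at two parameters at once. The gap delta is the effect of Re s > 0, which acts like
    killing at rate Re s.

    The Sylvester operator resists a direct norm estimate: after uniformization the left factor is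
    P-- + K P+-, whose rows may have norm above 1. The bound therefore runs through auxiliary
    sequences whose recursions involve only the blocks of P. For complex s the Riccati iteration is
    not monotone, but the iteration with the moduli of the blocks is, and it dominates the
    increments.

    Sampling reduces every expectation to finitely many states, so that the Markov property for
    events suffices. Sampled times approach the passage from below and see only the left limit of
    the state, whereas [Xi] records the state at the passage time; a jump exactly there is not
    excluded path by path, which is what the lag is for. *)

Ltac mxring :=
  repeat match goal with |- context [?A *m ?B] => move: (A *m B) => ? end;
  apply/matrixP => ? ?; rewrite !mxE; ring.

Lemma eq_lew (R : realType) (x y : R) : x = y -> x <= y.
Proof. by move->. Qed.

(** * Row norms and stability of the Sylvester equation *)

Section RowNorm.
Context {R : realType}.
Local Notation C := R[i].

Lemma normcD (x y : C) : normc (x + y) <= normc x + normc y.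
Proof. exact: le_normcD. Qed.

Lemma normcN (x : C) : normc (- x) = normc x.
Proof. exact: complex.normcN. Qed.

Lemma normc_double (x : C) : normc (x + x) = 2 * normc x.
Proof. by rewrite -mulr2n mulr_natl; exact: complex.normcMn. Qed.

Definition rsum {p q} (M : 'M[C]_(p, q)) i := \sum_j normc (M i j).
Definition rbound {p q} (M : 'M[C]_(p, q)) (b : R) := forall i, rsum M i <= b.

Lemma normc_ge0 (z : C) : 0 <= normc z.
Proof. by case: z => a b /=; exact: sqrtr_ge0. Qed.

Lemma normc_sum (I : Type) (r : seq I) (Q : pred I) (F : I -> C) :
  normc (\sum_(i <- r | Q i) F i) <= \sum_(i <- r | Q i) normc (F i).
Proof.
elim/big_rec2: _ => [|i y x _ h]; first by rewrite normc0.
by apply: le_trans (normcD _ _) _; rewrite lerD2l.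
Qed.

Lemma normcR (x : R) : normc x%:C = `|x|.
Proof. by rewrite /= expr0n addr0 sqrtr_sqr. Qed.

Lemma rsum_ge0 p q (M : 'M[C]_(p, q)) i : 0 <= rsum M i.
Proof. by apply: sumr_ge0 => j _; exact: normc_ge0. Qed.

Lemma normc_le_rsum p q (M : 'M[C]_(p, q)) i j : normc (M i j) <= rsum M i.
Proof.
by rewrite /rsum (bigD1 j) //= lerDl; apply: sumr_ge0 => k _; exact: normc_ge0.
Qed.

Lemma rsumD p q (M N : 'M[C]_(p, q)) i : rsum (M + N) i <= rsum M i + rsum N i.
Proof.
by rewrite /rsum -big_split /=; apply: ler_sum => j _; rewrite mxE normcD.
Qed.

Lemma rsumZ p q (a : C) (M : 'M[C]_(p, q)) i : rsum (a *: M) i = normc a * rsum M i.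
Proof. by rewrite /rsum mulr_sumr; apply: eq_bigr => j _; rewrite mxE normcM. Qed.

Lemma rsum0 p q i : rsum (0 : 'M[C]_(p, q)) i = 0.
Proof. by apply: big1 => j _; rewrite mxE normc0. Qed.

Lemma rsum_mulmx {p q r} (M : 'M[C]_(p, q)) (N : 'M[C]_(q, r)) i :
  rsum (M *m N) i <= \sum_k normc (M i k) * rsum N k.
Proof.
rewrite /rsum.
apply: (@le_trans _ _ (\sum_j \sum_k normc (M i k) * normc (N k j))).
  apply: ler_sum => j _; rewrite mxE; apply: le_trans (normc_sum _ _ _) _.
  by apply: ler_sum => k _; rewrite normcM.
by rewrite exchange_big /=; apply: ler_sum => k _; rewrite -mulr_sumr.
Qed.

Lemma rsum_mul {p q r} (M : 'M[C]_(p, q)) (N : 'M[C]_(q, r)) b i :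
  rbound N b -> rsum (M *m N) i <= rsum M i * b.
Proof.
move=> hN; apply: le_trans (rsum_mulmx M N i) _; rewrite mulr_suml.
by apply: ler_sum => k _; rewrite ler_wpM2l ?normc_ge0 //; exact: hN.
Qed.

Lemma rbound_mul {p q r} {M : 'M[C]_(p, q)} {N : 'M[C]_(q, r)} {a b} : 0 <= b ->
  rbound M a -> rbound N b -> rbound (M *m N) (a * b).
Proof.
move=> b0 hM hN i; apply: le_trans (rsum_mul M i hN) _.
by rewrite ler_wpM2r.
Qed.

Lemma rsum_mul2 {p q1 q2 r} (A : 'M[C]_(p, q1)) (B : 'M[C]_(p, q2))
    (X : 'M[C]_(q1, r)) (Y : 'M[C]_(q2, r)) b i :
  rbound X b -> rbound Y b ->
  rsum (A *m X + B *m Y) i <= (rsum A i + rsum B i) * b.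
Proof.
move=> hX hY; apply: le_trans (rsumD _ _ _) _.
by rewrite mulrDl lerD ?rsum_mul.
Qed.

Lemma rboundW {p q} {M : 'M[C]_(p, q)} {a b} : a <= b -> rbound M a -> rbound M b.
Proof. by move=> ab h i; apply: le_trans (h i) ab. Qed.

Lemma rsum1 n i : rsum (1%:M : 'M[C]_n) i = 1.
Proof.
rewrite /rsum (bigD1 i) //= mxE eqxx normc1 big1 ?addr0 // => j ji.
by rewrite mxE eq_sym (negPf ji) normc0.
Qed.

(** Adjacent blocks are bounded jointly. For the fluid generator at real s > 0 and small eps, I +
    eps Q is nonnegative with row sums at most 1 - delta; for complex s the moduli of the entries
    take over. *)
Definition uniformizable {a b} (Qpp : 'M[C]_a) (Qpm : 'M[C]_(a, b)) (Qmm : 'M[C]_b)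
    (Qmp : 'M[C]_(b, a)) := exists eps delta : R,
  [/\ 0 < eps, 0 < delta, delta <= 1,
   forall i, rsum (1%:M + eps%:C *: Qpp) i + rsum (eps%:C *: Qpm) i <= 1 - delta &
   forall i, rsum (eps%:C *: Qmp) i + rsum (1%:M + eps%:C *: Qmm) i <= 1 - delta].

End RowNorm.

Section Stability.
Context {R : realType}.
Local Notation C := R[i].
Context {a b : nat}.
Variables (Ppp : 'M[C]_a) (Ppm : 'M[C]_(a, b)) (Pmm : 'M[C]_b) (Pmp : 'M[C]_(b, a)).
Variable delta : R.
Hypotheses (delta_gt0 : 0 < delta) (delta_le1 : delta <= 1).
Hypothesis hPp : forall i, rsum Ppp i + rsum Ppm i <= 1 - delta.
Hypothesis hPm : forall i, rsum Pmp i + rsum Pmm i <= 1 - delta.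

Let sub1_ge0 : 0 <= 1 - delta. Proof. by rewrite subr_ge0. Qed.

Lemma rbound_W (K : 'M[C]_(b, a)) : rbound K 1 -> rbound (Ppp + Ppm *m K) (1 - delta).
Proof.
move=> hK i; rewrite -[Ppp]mulmx1.
apply: le_trans (rsum_mul2 _ _ _ _ hK) _; first by move=> j; rewrite rsum1.
by rewrite mulr1.
Qed.

Lemma geometric_squeeze (x g M q : R) : 0 <= q -> q < 1 ->
  (forall n : nat, x <= g + q ^+ n * M) -> x <= g.
Proof.
move=> q0 q1 h.
have c : (fun n => g + q ^+ n * M) @ \oo --> g + 0 * M.
  apply: cvgD; first exact: cvg_cst.
  by apply: cvgMl; apply: cvg_expr; rewrite ger0_norm.
rewrite mul0r addr0 in c.
rewrite -(cvg_lim _ c) //; apply: limr_ge; first by apply/cvg_ex; exists g.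
by near=> n; exact: h.
Unshelve. all: by end_near. Qed.

Section Bound.
Variables (K1 K2 D G : 'M[C]_(b, a)) (g : R).
Hypotheses (hK1 : rbound K1 1) (hK2 : rbound K2 1) (hG : rbound G g) (g0 : 0 <= g).
Hypothesis ric : Pmp + Pmm *m K1 + K1 *m Ppp + K1 *m Ppm *m K1 = K1 *+ 2.
Let W1 := Ppp + Ppm *m K1.
Let W2 := Ppp + Ppm *m K2.
Hypothesis syl : (Pmm + K1 *m Ppm) *m D + D *m W2 = D *+ 2 - G.

(* D solves z = D W2^n + K1 y at n = 0: y_n and z_n = D W2^n + K1 y_n satisfy recursions whose
   coefficients are the blocks themselves, so that the gap delta bounds both of them. *)
Fixpoint W2n n : 'M[C]_a := if n is k.+1 then W2n k *m W2 else 1%:M.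
Fixpoint yseq n : 'M[C]_a :=
  if n is k.+1 then W1 *m yseq k + Ppm *m D *m W2n k else 0.
Let zseq n := D *m W2n n + K1 *m yseq n.

Lemma W2nS n : W2n n.+1 = W2 *m W2n n.
Proof.
elim: n => [|n ih]; first by rewrite /= mul1mx mulmx1.
by rewrite -[LHS]/(W2n n.+1 *m W2) {1}ih -mulmxA.
Qed.

Let yE n : yseq n.+1 = Ppp *m yseq n + Ppm *m zseq n.
Proof. by rewrite /= /zseq /W1 mulmxDl mulmxDr !mulmxA -!addrA [X in _ + X]addrC. Qed.

Let zE n : zseq n *+ 2 = zseq n.+1 + Pmp *m yseq n + Pmm *m zseq n + G *m W2n n.
Proof.
have zS : zseq n.+1 = D *m W2 *m W2n n + K1 *m W1 *m yseq n + K1 *m Ppm *m D *m W2n n.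
  by rewrite /zseq W2nS /= mulmxDr !mulmxA addrA.
have syl' : D *m W2 = D *+ 2 - G - Pmm *m D - K1 *m Ppm *m D.
  by rewrite -syl mulmxDl; mxring.
have ric' : K1 *m W1 = K1 *+ 2 - Pmp - Pmm *m K1.
  by rewrite -ric mulmxDr !mulmxA; mxring.
rewrite zS syl' ric' /zseq !mulr2n !mulmxDr !mulmxBl !mulmxDl !mulmxA; mxring.
Qed.

Let W2n_bound n : rbound (W2n n) 1.
Proof.
elim: n => [|n ih] /= i; first by rewrite rsum1.
rewrite -[1]mulr1; apply: rbound_mul => // {}i.
by apply: le_trans (rbound_W hK2 i) _; rewrite gerBl ltW.
Qed.

(** Rows of [Pmm + K1 *m Ppm] may have norm above 1, so the equation is not estimated directly.
    Instead, any bound common to all [yseq n] and [zseq n] improves itself through [yE] and [zE],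
    and [zseq 0] is [D]. *)
Lemma sylvester_bound : rbound D (g / delta).
Proof.
have [dd hD] : exists dd, 0 <= dd /\ rbound D dd.
  exists (\sum_i rsum D i); split; first by apply: sumr_ge0 => i _; apply: rsum_ge0.
  by move=> i; rewrite (bigD1 i) //= lerDl sumr_ge0 // => j _; apply: rsum_ge0.
have dd0 : 0 <= dd by case: hD.
have {}hD : rbound D dd by case: hD.
have hPpm i : rsum Ppm i <= 1.
  move: (hPp i) (rsum_ge0 Ppp i) delta_gt0 => h1 h2 h3; lra.
have ddelta0 : 0 <= dd / delta by rewrite divr_ge0 // ltW.
have hy n : rbound (yseq n) (dd / delta).
  elim: n => [|n ih] i; first by rewrite rsum0.
  apply: le_trans (rsumD _ _ _) _.
  have -> : dd / delta = (1 - delta) * (dd / delta) + 1 * dd * 1.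
    by rewrite mulr1 mul1r mulrBl mul1r mulrCA divff ?gt_eqF // mulr1 subrK.
  apply: lerD.
    exact: (rbound_mul ddelta0 (rbound_W hK1) ih).
  by apply: rbound_mul => //; apply: rbound_mul.
(* A crude bound that depends on [D]; the factor [q ^+ k] removes it in the limit. *)
pose M0 := dd + dd / delta.
have hz n : rbound (zseq n) M0.
  move=> i; apply: le_trans (rsumD _ _ _) _; apply: lerD.
    by rewrite -[dd]mulr1; apply: rbound_mul.
  by rewrite -[_ / _]mul1r; apply: rbound_mul.
(* By [zE] a common bound M gives 2 |z| <= M + (1 - delta) M + g, so M is replaced by
   [q * M + g / 2], whose fixed point is g / delta. As [zE] involves [zseq n.+1], the bound has to
   hold for all indices at once. *)
pose q := 1 - delta / 2.
have q0 : 0 <= q by move: delta_gt0 delta_le1; rewrite /q; lra.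
have q1 : q < 1 by move: delta_gt0 delta_le1; rewrite /q; lra.
have M00 : 0 <= M0 by rewrite addr_ge0.
have gd0 : 0 <= g / delta by rewrite divr_ge0 // ltW.
have key k n : rbound (yseq n) (g / delta + q ^+ k * M0) /\
               rbound (zseq n) (g / delta + q ^+ k * M0).
  elim: k n => [|k ih] n.
    rewrite expr0 mul1r; split.
      by apply: (rboundW _ (hy n)); rewrite /M0; lra.
    by apply: (rboundW _ (hz n)); rewrite lerDr.
  set M := g / delta + q ^+ k * M0.
  have qk0 : 0 <= q ^+ k * M0 by rewrite mulr_ge0 ?exprn_ge0.
  have M_ge0 : 0 <= M by rewrite addr_ge0.
  have -> : g / delta + q ^+ k.+1 * M0 = q * M + g / 2.
    by rewrite /M exprS /q; field; rewrite gt_eqF.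
  have b2 : (1 - delta) * M <= q * M + g / 2.
    by have := mulr_ge0 (ltW delta_gt0) M_ge0; rewrite /q; move: g0; lra.
  split => i.
    case: n => [|n]; first by rewrite rsum0; apply: le_trans b2; rewrite mulr_ge0.
    rewrite yE; apply: le_trans b2.
    apply: le_trans (rsum_mul2 _ _ _ (ih n).1 (ih n).2) _.
    by rewrite ler_wpM2r.
  have h2 : rsum (zseq n *+ 2) i = 2 * rsum (zseq n) i.
    by rewrite /rsum mulr_sumr; apply: eq_bigr => j _; rewrite mulr2n mxE normc_double.
  have : rsum (zseq n *+ 2) i <= M + (1 - delta) * M + g * 1.
    rewrite zE; apply: le_trans (rsumD _ _ _) _; apply: lerD; last exact: rbound_mul.
    rewrite -addrA; apply: le_trans (rsumD _ _ _) _; apply: lerD; first exact: (ih n.+1).2.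
    apply: le_trans (rsum_mul2 _ _ _ (ih n).1 (ih n).2) _.
    by rewrite ler_wpM2r.
  by move: delta_gt0 delta_le1; rewrite h2 /q; lra.
move=> i; apply: (@geometric_squeeze _ _ M0 q) => // k.
have := (key k 0).2 i.
by rewrite /zseq /= mulmx1 mulmx0 addr0.
Qed.

End Bound.
End Stability.

(** * Limits of complex-valued functions *)

Section ComplexLimits.
Context {R : realType} {T : Type} {F : set_system T} {FF : ProperFilter F}.
Local Notation C := R[i].

(** Taken on real and imaginary parts, in accordance with [cpartial]. *)
Definition ccvg (u : T -> C) (l : C) : Prop :=
  (Re (u t) @[t --> F] --> Re l) /\
  (Im (u t) @[t --> F] --> Im l).

Lemma ReD (x y : C) : Re (x + y) = Re x + Re y.
Proof. by case: x => a b; case: y. Qed.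
Lemma ImD (x y : C) : Im (x + y) = Im x + Im y.
Proof. by case: x => a b; case: y. Qed.
Lemma ReN (x : C) : Re (- x) = - Re x.
Proof. by case: x. Qed.
Lemma ImN (x : C) : Im (- x) = - Im x.
Proof. by case: x. Qed.
Lemma ReM (x y : C) : Re (x * y) =
  Re x * Re y - Im x * Im y.
Proof. by case: x => a b; case: y. Qed.
Lemma ImM (x y : C) : Im (x * y) =
  Re x * Im y + Im x * Re y.
Proof. by case: x => a b; case: y. Qed.

Lemma ccvg_cst (l : C) : ccvg (fun=> l) l.
Proof. by split; exact: cvg_cst. Qed.

Lemma ccvg_near u v l : (\forall t \near F, u t = v t) -> ccvg u l -> ccvg v l.
Proof.
move=> h [a b]; split.
  by apply: cvg_trans a; apply: near_eq_cvg; near=> t; rewrite (near h t).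
by apply: cvg_trans b; apply: near_eq_cvg; near=> t; rewrite (near h t).
Unshelve. all: by end_near. Qed.

Lemma ccvgD u v l m : ccvg u l -> ccvg v m -> ccvg (fun t => u t + v t) (l + m).
Proof.
move=> [ur ui] [vr vi]; split.
  by under eq_fun do rewrite ReD; rewrite ReD; exact: cvgD.
by under eq_fun do rewrite ImD; rewrite ImD; exact: cvgD.
Qed.

Lemma ccvgN u l : ccvg u l -> ccvg (fun t => - u t) (- l).
Proof.
move=> [ur ui]; split.
  by under eq_fun do rewrite ReN; rewrite ReN; exact: cvgN.
by under eq_fun do rewrite ImN; rewrite ImN; exact: cvgN.
Qed.

Lemma ccvgB u v l m : ccvg u l -> ccvg v m -> ccvg (fun t => u t - v t) (l - m).
Proof. by move=> hu hv; apply: ccvgD => //; exact: ccvgN. Qed.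

Lemma ccvgM u v l m : ccvg u l -> ccvg v m -> ccvg (fun t => u t * v t) (l * m).
Proof.
move=> [ur ui] [vr vi]; split.
  by under eq_fun do rewrite ReM; rewrite ReM; apply: cvgB; exact: cvgM.
by under eq_fun do rewrite ImM; rewrite ImM; apply: cvgD; exact: cvgM.
Qed.

Lemma cvg_sumr (I : Type) (r : seq I) (P : pred I) (u : I -> T -> R) (l : I -> R) :
  (forall i, P i -> u i t @[t --> F] --> l i) ->
  (\sum_(i <- r | P i) u i t) @[t --> F] --> \sum_(i <- r | P i) l i.
Proof.
move=> h; elim: r => [|i r ih].
  by under eq_fun do rewrite big_nil; rewrite big_nil; exact: cvg_cst.
under eq_fun do rewrite big_cons; rewrite big_cons.
case: ifP => // Pi; apply: cvgD => //; exact: h.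
Qed.

Lemma ccvg_sum (I : Type) (r : seq I) (P : pred I) (u : I -> T -> C) (l : I -> C) :
  (forall i, P i -> ccvg (u i) (l i)) ->
  ccvg (fun t => \sum_(i <- r | P i) u i t) (\sum_(i <- r | P i) l i).
Proof.
move=> h; elim: r => [|i r ih].
  by under eq_fun do rewrite big_nil; rewrite big_nil; exact: ccvg_cst.
under eq_fun do rewrite big_cons; rewrite big_cons.
case: ifP => // Pi; apply: ccvgD => //; exact: h.
Qed.

Lemma ccvg_unique u l m : ccvg u l -> ccvg u m -> l = m.
Proof.
move=> [a b] [c d]; apply/eqP; rewrite eq_complex; apply/andP; split; apply/eqP.
  exact: (cvg_unique _ a c).
exact: (cvg_unique _ b d).
Qed.

Lemma ccvg_normc u l : ccvg u l -> normc (u t) @[t --> F] --> normc l.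
Proof.
move=> [a b].
have nE (z : C) : normc z = Num.sqrt (Re z ^+ 2 + Im z ^+ 2) by case: z.
under eq_fun do rewrite nE; rewrite nE.
apply: (continuous_cvg _ (@sqrt_continuous _ _)).
by apply: cvgD; rewrite expr2; under eq_fun do rewrite expr2; exact: cvgM.
Qed.

Lemma normc_Re (z : C) : `|Re z| <= normc z.
Proof. by case: z => a b /=; rewrite -sqrtr_sqr ler_wsqrtr // lerDl sqr_ge0. Qed.
Lemma normc_Im (z : C) : `|Im z| <= normc z.
Proof. by case: z => a b /=; rewrite -sqrtr_sqr ler_wsqrtr // lerDr sqr_ge0. Qed.
Lemma normc_ReIm (z : C) : normc z <= `|Re z| + `|Im z|.
Proof.
case: z => a b /=; rewrite -[leRHS]ger0_norm ?addr_ge0 // -sqrtr_sqr ler_wsqrtr //.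
rewrite -[a ^+ 2]real_normK ?num_real // -[b ^+ 2]real_normK ?num_real //.
by rewrite sqrrD lerD2r lerDl mulrn_wge0 // mulr_ge0.
Qed.

Lemma ccvgV u l : l != 0 -> ccvg u l -> ccvg (fun t => (u t)^-1) l^-1.
Proof.
move=> l0 [a b].
have RV (z : C) : Re z^-1 = Re z / (Re z ^+ 2 + Im z ^+ 2).
  by case: z.
have IV (z : C) : Im z^-1 = - (Im z / (Re z ^+ 2 + Im z ^+ 2)).
  by case: z.
have n0 : Re l ^+ 2 + Im l ^+ 2 != 0.
  apply: contraNneq l0; case: l {a b} => x y /= /eqP.
  by rewrite paddr_eq0 ?sqr_ge0 // !sqrf_eq0 eq_complex.
have n : (Re (u t) ^+ 2 + Im (u t) ^+ 2)^-1 @[t --> F]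
     --> (Re l ^+ 2 + Im l ^+ 2)^-1.
  apply: cvgV => //.
  by apply: cvgD; rewrite expr2; under eq_fun do rewrite expr2; exact: cvgM.
split.
  by under eq_fun do rewrite RV; rewrite RV; exact: cvgM.
by under eq_fun do rewrite IV; rewrite IV; apply: cvgN; exact: cvgM.
Qed.

End ComplexLimits.
Arguments ccvg {R T} F u l.

(** * The Riccati equation *)

Section Dominated.
Context {R : realType}.
Local Notation C := R[i].

(** Both [v] and [u \+ v] are nondecreasing and bounded, so [u] is a difference of convergent
    monotone sequences. *)
Lemma cvgn_dominated (u v : nat -> R) (M : R) :
  (forall n, `|u n.+1 - u n| <= v n.+1 - v n) -> (forall n, v n <= M) -> cvgn u /\ cvgn v.
Proof.
move=> h hM.
have vnd : nondecreasing_seq v.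
  apply/nondecreasing_seqP => n; rewrite -subr_ge0.
  by apply: le_trans (h n); exact: normr_ge0.
have cv : cvgn v.
  by apply: nondecreasing_is_cvgn => //; exists M => _ [n _ <-].
have unv n : u n <= u 0%N + (v n - v 0%N).
  elim: n => [|n ih]; first by rewrite subrr addr0.
  by have := h n; rewrite ler_norml => /andP[_]; move: ih; lra.
have cuv : cvgn (u \+ v).
  apply: nondecreasing_is_cvgn.
    apply/nondecreasing_seqP => n /=.
    by have := h n; rewrite ler_norml => /andP[+ _]; lra.
  exists (u 0%N + (M - v 0%N) + M) => _ [n _ <-] /=.
  by move: (unv n) (hM n); lra.
split=> //.
have -> : u = (u \+ v) \- v by apply/funext => n /=; rewrite addrK.
exact: is_cvgB.
Qed.

(** The order is that of [R[i]], so the inequality also makes the entries of [N] real and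
    nonnegative. *)
Definition mdom {p q} (M N : 'M[C]_(p, q)) := forall i j, `|M i j| <= N i j.

Lemma mdomD p q (M N M' N' : 'M[C]_(p, q)) : mdom M N -> mdom M' N' -> mdom (M + M') (N + N').
Proof.
by move=> h h' i j; rewrite !mxE (le_trans (ler_normD _ _)) // lerD.
Qed.

Lemma mdomM p q r (M N : 'M[C]_(p, q)) (M' N' : 'M[C]_(q, r)) :
  mdom M N -> mdom M' N' -> mdom (M *m M') (N *m N').
Proof.
move=> h h' i j; rewrite !mxE (le_trans (ler_norm_sum _ _ _)) //.
by apply: ler_sum => k _; rewrite normrM ler_pM.
Qed.

Lemma mdomZ p q (a : C) (M N : 'M[C]_(p, q)) : 0 <= a -> mdom M N -> mdom (a *: M) (a *: N).
Proof.
by move=> a0 h i j; rewrite !mxE normrM ger0_norm // ler_wpM2l.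
Qed.

Definition mxabs {p q} (M : 'M[C]_(p, q)) : 'M[C]_(p, q) := map_mx (fun z => (normc z)%:C) M.

Lemma mdom_abs p q (M : 'M[C]_(p, q)) : mdom M (mxabs M).
Proof. by move=> i j; rewrite mxE. Qed.

Lemma rsum_abs p q (M : 'M[C]_(p, q)) i : rsum (mxabs M) i = rsum M i.
Proof. by apply: eq_bigr => j _; rewrite mxE normcR ger0_norm // normc_ge0. Qed.

End Dominated.

Section Iteration.
Context {R : realType} {a b : nat}.
Local Notation C := R[i].

(** With P = I + eps Q the Riccati equation for Q becomes the fixed-point equation of this map: the
    identities in P-- and P++ contribute 2 K, whence the factor 1/2. *)
Definition riccati_map (Ppp : 'M[C]_a) (Ppm : 'M[C]_(a, b)) (Pmm : 'M[C]_b)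
  (Pmp : 'M[C]_(b, a)) (K : 'M[C]_(b, a)) :=
  2^-1 *: (Pmp + Pmm *m K + K *m Ppp + K *m Ppm *m K).

Variables (Ppp : 'M[C]_a) (Ppm : 'M[C]_(a, b)) (Pmm : 'M[C]_b) (Pmp : 'M[C]_(b, a)).
Hypothesis hPp : forall i, rsum Ppp i + rsum Ppm i <= 1.
Hypothesis hPm : forall i, rsum Pmp i + rsum Pmm i <= 1.

Let step := riccati_map Ppp Ppm Pmm Pmp.
Let hstep := riccati_map (mxabs Ppp) (mxabs Ppm) (mxabs Pmm) (mxabs Pmp).

(** All terms carry a plus sign, so an increment computed with the moduli of the blocks dominates
    the one computed with the blocks. *)
Lemma riccati_mapB (App : 'M[C]_a) Apm Amm Amp K L :
  riccati_map App Apm Amm Amp K - riccati_map App Apm Amm Amp L =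
  2^-1 *: (Amm *m (K - L) + (K - L) *m App + K *m Apm *m (K - L) + (K - L) *m Apm *m L).
Proof.
rewrite /riccati_map -scalerBr; congr (_ *: _).
by rewrite !mulmxBr !mulmxBl; mxring.
Qed.

Lemma normc_half : normc (2^-1 : C) = 2^-1.
Proof. by rewrite (_ : 2^-1 = (2^-1 : R)%:C) ?normcR ?ger0_norm // fmorphV rmorph_nat. Qed.

Lemma riccati_map_bound (App : 'M[C]_a) Apm Amm Amp K :
  (forall i, rsum App i + rsum Apm i <= 1) -> (forall i, rsum Amp i + rsum Amm i <= 1) ->
  rbound K 1 -> rbound (riccati_map App Apm Amm Amp K) 1.
Proof.
move=> hp hm hK i; rewrite rsumZ normc_half.
have -> : Amp + Amm *m K + K *m App + K *m Apm *m K =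
    (Amp *m 1%:M + Amm *m K) + K *m (App *m 1%:M + Apm *m K).
  by rewrite !mulmx1 mulmxDr -!mulmxA !addrA.
have b1 n : rbound (1%:M : 'M[C]_n) 1 by move=> j; rewrite rsum1.
rewrite ler_pdivrMl // mulr1 (le_trans (rsumD _ _ _)) //.
apply: lerD.
  by rewrite (le_trans (rsum_mul2 _ _ _ (b1 _) hK)) // mulr1.
rewrite -[leRHS]mulr1; apply: rbound_mul => // j.
by rewrite (le_trans (rsum_mul2 _ _ _ (b1 _) hK)) // mulr1.
Qed.

Let step_dominated K0 K1 H0 H1 : mdom K0 H0 -> mdom K1 H1 -> mdom (K1 - K0) (H1 - H0) ->
  mdom (step K1 - step K0) (hstep H1 - hstep H0).
Proof.
move=> h0 h1 h; rewrite !riccati_mapB; apply: mdomZ; first by rewrite invr_ge0.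
have da p q (M : 'M[C]_(p, q)) : mdom M (mxabs M) := @mdom_abs _ _ _ M.
apply: mdomD; [apply: mdomD; [apply: mdomD|]|]; apply: mdomM => //; exact: mdomM.
Qed.

Section Limit.
Variables (Kn Hn : nat -> 'M[C]_(b, a)).
Hypotheses (Kn0 : Kn 0 = 0) (Hn0 : Hn 0 = 0).
Hypotheses (KnS : forall n, Kn n.+1 = step (Kn n)) (HnS : forall n, Hn n.+1 = hstep (Hn n)).

Let Kn_bound n : rbound (Kn n) 1.
Proof.
elim: n => [|n ih]; first by move=> i; rewrite Kn0 rsum0.
by rewrite KnS; exact: riccati_map_bound.
Qed.

Let Hn_bound n : rbound (Hn n) 1.
Proof.
elim: n => [|n ih]; first by move=> i; rewrite Hn0 rsum0.
by rewrite HnS; apply: riccati_map_bound => // i; rewrite !rsum_abs.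
Qed.

Let dominated n : mdom (Kn n) (Hn n) /\ mdom (Kn n.+1 - Kn n) (Hn n.+1 - Hn n).
Proof.
have z0 p q : mdom (0 : 'M[C]_(p, q)) 0 by move=> i j; rewrite mxE normr0.
elim: n => [|n [ih1 ih2]].
  rewrite KnS HnS Kn0 Hn0; split=> //; rewrite !subr0 /step /hstep /riccati_map.
  rewrite !mulmx0 !mul0mx !addr0; apply: mdomZ; first by rewrite invr_ge0.
  exact: mdom_abs.
have d1 : mdom (Kn n.+1) (Hn n.+1).
  by rewrite -(subrK (Kn n) (Kn n.+1)) -(subrK (Hn n) (Hn n.+1)); exact: mdomD.
split; first exact: d1.
rewrite (KnS n.+1) (HnS n.+1) [X in mdom (_ - X) _](KnS n) [X in mdom _ (_ - X)](HnS n).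
exact: step_dominated.
Qed.

(** Row sums are only assumed to be at most 1 here, so the map need not contract. Convergence comes
    from [Hn], which increases from 0, stays bounded and dominates the increments of [Kn]. *)
Lemma limit_fixpoint : exists2 K : 'M[C]_(b, a), rbound K 1 & K = step K.
Proof.
have cv i j : exists l, ccvg \oo (fun n => Kn n i j) l.
  pose v n := Re (Hn n i j).
  have vM n : v n <= 1.
    apply: le_trans (ler_norm _) _; apply: le_trans (normc_Re _) _.
    by apply: le_trans (normc_le_rsum _ _ _) _; exact: Hn_bound.
  have dv n : normc (Kn n.+1 i j - Kn n i j) <= v n.+1 - v n.
    have [_ /(_ i j)] := dominated n; rewrite !mxE.
    have -> : v n.+1 - v n = Re (Hn n.+1 i j - Hn n i j).
      by rewrite ReD ReN.
    by rewrite lecE => /andP[_].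
  have [cr _] : cvgn (fun n => Re (Kn n i j)) /\ cvgn v.
    apply: (cvgn_dominated _ vM) => n; apply: le_trans (dv n).
    by rewrite -ReN -ReD; exact: normc_Re.
  have [ci _] : cvgn (fun n => Im (Kn n i j)) /\ cvgn v.
    apply: (cvgn_dominated _ vM) => n; apply: le_trans (dv n).
    by rewrite -ImN -ImD; exact: normc_Im.
  exists (lim (Re (Kn n i j) @[n --> \oo]) +i* lim (Im (Kn n i j) @[n --> \oo])).
  by split.
have [L hL] : exists L : 'M[C]_(b, a), forall i j, ccvg \oo (fun n => Kn n i j) (L i j).
  have /choice[f hf] : forall x : 'I_b * 'I_a, exists l, ccvg \oo (fun n => Kn n x.1 x.2) l.
    by move=> x; exact: cv.
  by exists (\matrix_(i, j) f (i, j)) => i j; rewrite mxE; exact: (hf (i, j)).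
exists L.
  move=> i.
  have c : (fun n => rsum (Kn n) i) @ \oo --> rsum L i.
    by apply: cvg_sumr => j _; apply: ccvg_normc.
  rewrite -(cvg_lim _ c) //; apply: limr_le; first by apply/cvg_ex; eexists; exact: c.
  by near=> n; exact: Kn_bound.
have cM p q r (M : nat -> 'M[C]_(p, q)) (N : nat -> 'M[C]_(q, r))
    (M' : 'M[C]_(p, q)) (N' : 'M[C]_(q, r)) :
    (forall i j, ccvg \oo (fun n => M n i j) (M' i j)) ->
    (forall i j, ccvg \oo (fun n => N n i j) (N' i j)) ->
    (forall i j, ccvg \oo (fun n => (M n *m N n) i j) ((M' *m N') i j)).
  move=> h h' i j; under eq_fun do rewrite mxE; rewrite mxE.
  by apply: ccvg_sum => k _; exact: ccvgM.
have cc p q (M : 'M[C]_(p, q)) i j : ccvg \oo (fun n : nat => M i j) (M i j).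
  exact: ccvg_cst.
apply/matrixP => i j.
have c1 : ccvg \oo (fun n => Kn n.+1 i j) (L i j).
  have [c d] := hL i j; split.
    by rewrite (cvg_shiftS (fun n => Re (Kn n i j))).
  by rewrite (cvg_shiftS (fun n => Im (Kn n i j))).
have c2 : ccvg \oo (fun n => Kn n.+1 i j) (step L i j).
  under eq_fun do rewrite KnS; rewrite /step /riccati_map.
  under eq_fun do rewrite mxE; rewrite mxE; apply: ccvgM; first exact: ccvg_cst.
  under eq_fun do rewrite !mxE; rewrite !mxE.
  apply: ccvgD; [apply: ccvgD; [apply: ccvgD|]|].
  - exact: ccvg_cst.
  - by apply: ccvg_sum => k _; apply: ccvgM => //; exact: cc.
  - by apply: ccvg_sum => k _; apply: ccvgM => //; exact: cc.
  - by apply: ccvg_sum => k _; apply: ccvgM => //; apply: cM => // ? ?; exact: cc.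
exact: ccvg_unique c1 c2.
Unshelve. all: by end_near. Qed.

End Limit.

Lemma riccati_fixpoint : exists2 K : 'M[C]_(b, a), rbound K 1 &
  Pmp + Pmm *m K + K *m Ppp + K *m Ppm *m K = K *+ 2.
Proof.
have [] := @limit_fixpoint (fun n => iter n step 0) (fun n => iter n hstep 0) => // K hK eK.
exists K => //; rewrite [in RHS]eK -scaler_nat scalerA mulfV ?scale1r //.
Qed.

End Iteration.

(** * Uniformization of the fluid generator *)

Lemma ex_argmax (R : realType) (n : nat) (F : 'I_n -> R) (i0 : 'I_n) :
  exists i, forall j, F j <= F i.
Proof.
by case: (@arg_maxP _ _ _ i0 xpredT F isT) => i _ h; exists i => j; exact: h.
Qed.

(** Counting memberships turns the exchange of [A] and [B] into commutativity of addition; the rows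
    of both signs can thus share the same lemmas. *)
Definition tripartition {m} (A B Z : {set 'I_m}) :=
  forall j, ((j \in A) + (j \in B) + (j \in Z) = 1)%N.

Lemma sum_tripartition m (A B Z : {set 'I_m}) (V : zmodType) (F : 'I_m -> V) :
  tripartition A B Z ->
  \sum_j F j = \sum_(j < #|A|) F (enum_val j) + \sum_(j < #|B|) F (enum_val j)
             + \sum_(j < #|Z|) F (enum_val j).
Proof.
move=> h; rewrite -!big_enum_val /= [in RHS]big_mkcond [X in _ + X + _]big_mkcond.
rewrite [X in _ + X]big_mkcond -!big_split /=; apply: eq_bigr => j _.
have := h j.
by case: (j \in A); case: (j \in B); case: (j \in Z) => //= _; rewrite ?addr0 ?add0r.
Qed.

Lemma enum_val_neq m (D E : {set 'I_m}) (k : 'I_#|D|) (j : 'I_#|E|) :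
  [disjoint D & E]%B -> enum_val k != enum_val j.
Proof.
move=> /pred0P/(_ (enum_val k)) /=; rewrite enum_valP => /negbT h.
by apply: contra h => /eqP ->; rewrite enum_valP.
Qed.

Section Rows.
Context {R : realType} {m : nat}.
Local Notation C := R[i].
Variables (T : 'M[R]_m) (A B Z : {set 'I_m}) (s : C).
Hypothesis genT : conservative_generator T.
Hypothesis part : tripartition A B Z.
Let sigma := Re s.
Hypothesis sigma_gt0 : 0 < sigma.

Local Notation Tv k l := (T (enum_val k) (enum_val l)).

Let T_ge0 i j : i != j -> 0 <= T i j.
Proof. by case: genT => h _; exact: h. Qed.

Let T00 := block T Z Z - s%:M.
Let T00E k l : T00 k l = (Tv k l)%:C - (if k == l then s else 0).
Proof. by rewrite !mxE -mulrb. Qed.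

Let normc_diag i : sigma - T i i <= normc (s - (T i i)%:C).
Proof.
apply: le_trans (normc_Re _); rewrite ReD ReN /=.
by apply: le_trans (ler_norm _).
Qed.

Let disj_part : [/\ [disjoint A & Z]%B, [disjoint B & Z]%B & [disjoint A & B]%B].
Proof.
by split; apply/pred0P => x /=; have := part x;
  case: (x \in A); case: (x \in Z); case: (x \in B).
Qed.
Let disjAZ : [disjoint A & Z]%B. Proof. by case: disj_part. Qed.
Let disjBZ : [disjoint B & Z]%B. Proof. by case: disj_part. Qed.
Let disjAB : [disjoint A & B]%B. Proof. by case: disj_part. Qed.

Let exit_ge0 (k : 'I_#|Z|) : 0 <= \sum_(j < #|A|) Tv k j +
                      \sum_(j < #|B|) Tv k j :> R.
Proof.
by apply: addr_ge0; apply: sumr_ge0 => j _; apply: T_ge0; apply: enum_val_neq; rewrite disjoint_sym.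
Qed.

(** At a state k where [nu] is largest, the zero row sum of [T] turns the inequality into (sigma +
    t) nu k <= t, where t is the exit rate from [Z] at k; and sigma > 0. *)
Lemma max_principle (nu beta : 'I_#|Z| -> R) :
  (forall k, 0 <= nu k) ->
  (forall k : 'I_#|Z|, (sigma - Tv k k) * nu k <=
     beta k + \sum_(l < #|Z| | l != k) Tv k l * nu l) ->
  (forall k : 'I_#|Z|, beta k <= \sum_(j < #|A|) Tv k j +
                       \sum_(j < #|B|) Tv k j) ->
  forall k, nu k <= 1.
Proof.
move=> nu0 h hb k0; have [k hk] := ex_argmax nu k0.
apply: le_trans (hk k0) _.
have [_ rows] := genT.
have := rows (enum_val k); rewrite (sum_tripartition _ part).
rewrite [X in _ + X](bigD1 k) //=.
set t := (X in X + (_ + _) = _); set tkk := T _ _; set o := \sum_(_ < _ | _) _ => e.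
have t0 : 0 <= t.
  exact: exit_ge0.
have ho : \sum_(l < #|Z| | l != k) Tv k l * nu l <= o * nu k.
  rewrite /o mulr_suml; apply: ler_sum => l lk; apply: ler_wpM2l (hk l).
  by apply: T_ge0; apply: contra lk => /eqP/enum_val_inj ->.
have := h k; have := hb k; rewrite -/t -/tkk => h1 h2.
have {}e : tkk = - t - o by move: e; lra.
have h3 : (sigma + t) * nu k <= t.
  by move: (le_trans h2 (lerD h1 ho)); rewrite e; lra.
rewrite -(ler_pM2l (_ : 0 < sigma + t)); last by rewrite ltr_wpDr.
by rewrite mulr1 (le_trans h3) // lerDr ltW.
Qed.

(** The maximum principle with [beta] = 0 bounds every multiple x |v| of a kernel vector v by 1,
    which forces v = 0. *)
Lemma T00_unit : T00 \in unitmx.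
Proof.
rewrite -unitmx_tr -row_free_unit; apply: inj_row_free => v hv.
have {}hv : T00 *m v^T = 0 by rewrite -[T00]trmxK -trmx_mul hv trmx0.
have eqn k : (s - (Tv k k)%:C) * v 0 k =
    \sum_(l < #|Z| | l != k) (Tv k l)%:C * v 0 l.
  have := congr1 (fun M : 'cV_ _ => M k 0) hv; rewrite !mxE (bigD1 k) //= => /eqP.
  rewrite T00E eqxx mxE addrC addr_eq0 -mulNr opprB => /eqP <-.
  by apply: eq_bigr => l lk; rewrite T00E eq_sym (negPf lk) subr0 mxE.
have bnd x : 0 <= x -> forall k, x * normc (v 0 k) <= 1.
  move=> x0; apply: (max_principle (beta := fun=> 0)) => k.
  - by rewrite mulr_ge0 // normc_ge0.
  - rewrite add0r mulrCA.
    under eq_bigr do rewrite mulrCA.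
    rewrite -mulr_sumr ler_wpM2l //.
    apply: le_trans (_ : normc ((s - (Tv k k)%:C) * v 0 k) <= _).
      by rewrite normcM ler_wpM2r ?normc_ge0.
    rewrite eqn; apply: le_trans (normc_sum _ _ _) _; apply: ler_sum => l lk.
    rewrite normcM normcR ger0_norm // T_ge0 //.
    by apply: contra lk => /eqP/enum_val_inj ->.
  - exact: exit_ge0.
apply/rowP => k; rewrite mxE; apply: eq0_normc; apply/eqP; rewrite eq_le normc_ge0 andbT.
rewrite leNgt; apply/negP => vk.
have := bnd (2 / normc (v 0 k)) (divr_ge0 (ler0n _ _) (ltW vk)) k.
by rewrite divfK ?gt_eqF // lern1.
Qed.

Lemma hitting_eqn (D : {set 'I_m}) (X : 'M[C]_(#|Z|, #|D|)) l j :
  T00 *m X = - block T Z D ->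
  (s - (Tv l l)%:C) * X l j =
   (Tv l j)%:C +
    \sum_(i < #|Z| | i != l) (Tv l i)%:C * X i j.
Proof.
move=> e; have := congr1 (fun M : 'M[C]_(#|Z|, #|D|) => M l j) e.
rewrite mxE (bigD1 l) //= T00E eqxx.
under eq_bigr => i il do rewrite T00E eq_sym (negPf il) subr0.
rewrite [RHS]mxE [X in _ = - X]mxE; set t := \sum_(_ < _ | _) _ => e'.
have -> : t = - (Tv l j)%:C -
   ((Tv l l)%:C - s) * X l j by rewrite -e' addrAC subrr add0r.
ring.
Qed.

(** [X] and [Y] hold the Laplace transforms at s of the exit from [Z] into each state of [A] and
    [B]. The moduli in a row, summed, satisfy the hypothesis of the maximum principle with [beta]
    the exit rate. *)
Lemma hitting_rsum (X : 'M[C]_(#|Z|, #|A|)) (Y : 'M[C]_(#|Z|, #|B|)) :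
  T00 *m X = - block T Z A -> T00 *m Y = - block T Z B ->
  forall k, rsum X k + rsum Y k <= 1.
Proof.
move=> hX hY.
have est (D : {set 'I_m}) (M : 'M[C]_(#|Z|, #|D|)) : [disjoint Z & D]%B ->
    T00 *m M = - block T Z D -> forall k,
    (sigma - Tv k k) * rsum M k <=
    \sum_(j < #|D|) Tv k j +
    \sum_(l < #|Z| | l != k) Tv k l * rsum M l.
  move=> hD hM k.
  apply: le_trans (_ : normc (s - (Tv k k)%:C) * rsum M k <= _).
    by rewrite ler_wpM2r ?rsum_ge0.
  rewrite /rsum mulr_sumr.
  have -> : \sum_(l < #|Z| | l != k) Tv k l * (\sum_j normc (M l j)) =
      \sum_j \sum_(l < #|Z| | l != k) Tv k l * normc (M l j).
    by rewrite exchange_big; apply: eq_bigr => l _; rewrite mulr_sumr.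
  rewrite -big_split /=; apply: ler_sum => j _.
  rewrite -normcM (hitting_eqn _ _ hM); apply: le_trans (normcD _ _) _.
  apply: lerD.
    by rewrite normcR ger0_norm // T_ge0 // enum_val_neq.
  apply: le_trans (normc_sum _ _ _) _; apply: ler_sum => l lk.
  rewrite normcM normcR ger0_norm // T_ge0 //.
  by apply: contra lk => /eqP/enum_val_inj ->.
apply: (max_principle (beta := fun k => \sum_(j < #|A|) Tv k j +
                                 \sum_(j < #|B|) Tv k j)) => //.
  by move=> k; rewrite addr_ge0 // rsum_ge0.
move=> k /=; rewrite mulrDr; under [X in _ <= _ + X]eq_bigr do rewrite mulrDr; rewrite big_split /=.
have := lerD (est A X _ hX k) (est B Y _ hY k).
by rewrite addrACA => /(_ _ _)/le_trans; apply; rewrite // disjoint_sym.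
Qed.

(** Killing leaves a gap a sigma in the row. The diagonal entry 1 + a (t - s) is complex; the two
    smallness conditions on [a] keep its modulus within a sigma / 2 of its real part, so half of the
    gap survives. *)
Lemma uniform_row (X : 'M[C]_(#|Z|, #|A|)) (Y : 'M[C]_(#|Z|, #|B|)) (a : R) (i : 'I_#|A|) :
  (forall k, rsum X k + rsum Y k <= 1) ->
  0 < a -> a * (sigma - Tv i i) <= 2^-1 ->
  a * Im s ^+ 2 <= sigma / 2 ->
  rsum (1%:M + a%:C *: (block T A A - s%:M + block T A Z *m X)) i +
  rsum (a%:C *: (block T A B + block T A Z *m Y)) i <= 1 - a * sigma / 2.
Proof.
move=> hXY a0 h1 h2.
set tii := T _ _ in h1 *.
have diag : normc (1 + a%:C * (tii%:C - s)) <= 1 - a * (sigma - tii) + a * sigma / 2.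
  have p0 : 0 <= 1 - a * (sigma - tii) + a * sigma / 2.
    have := mulr_gt0 a0 sigma_gt0; move: h1; lra.
  rewrite -[leRHS]ger0_norm // -sqrtr_sqr; move: h1 h2 p0 sigma_gt0.
  rewrite /sigma; case: (s) => u v /= h1 h2 p0 u0; rewrite ler_wsqrtr //.
  have -> : (1 + (a * (tii - u) - 0 * (0 - v))) ^+ 2 + (0 + (a * (0 - v) + 0 * (tii - u))) ^+ 2
    = (1 - a * (u - tii)) ^+ 2 + a * (a * v ^+ 2) by ring.
  have e1 : a * (a * v ^+ 2) <= a * u / 2 by rewrite -mulrA ler_wpM2l // ltW.
  have e2 : 0 <= (2^-1 - a * (u - tii)) * (a * u).
    by rewrite mulr_ge0 ?subr_ge0 // mulr_ge0 ?ltW.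
  have e3 := sqr_ge0 (a * u).
  move: e1 e2 e3; set x := a * (u - tii); set y := a * u; set z := a * (a * _) => e1 e2 e3.
  nra.
have offdiag : forall j : 'I_#|A|, j != i -> 0 <= Tv i j.
  by move=> j ji; apply: T_ge0; apply: contra ji => /eqP/enum_val_inj ->.
have toB (j : 'I_#|B|) : 0 <= Tv i j.
  by apply: T_ge0; apply: enum_val_neq.
have toZ (j : 'I_#|Z|) : 0 <= Tv i j.
  by apply: T_ge0; apply: enum_val_neq.
have b1 : rsum (1%:M + a%:C *: (block T A A - s%:M + block T A Z *m X)) i <=
    normc (1 + a%:C * (tii%:C - s)) + a * \sum_(j < #|A| | j != i) Tv i j
    + a * \sum_(k < #|Z|) Tv i k * rsum X k.
  rewrite scalerDr addrA; apply: le_trans (rsumD _ _ _) _; apply: lerD.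
    rewrite /rsum (bigD1 i) //=; apply: lerD; first by rewrite !mxE eqxx !mulr1n.
    rewrite mulr_sumr; apply: ler_sum => j ji.
    rewrite !mxE eq_sym (negPf ji) !mulr0n subr0 add0r normcM !normcR !ger0_norm ?offdiag //.
    exact: ltW.
  rewrite rsumZ normcR gtr0_norm // (ler_wpM2l (ltW a0)) //.
  apply: le_trans (rsum_mulmx (block T A Z) X i) _; apply: ler_sum => k _.
  by rewrite mxE normcR ger0_norm.
have b2 : rsum (a%:C *: (block T A B + block T A Z *m Y)) i <=
    a * \sum_(j < #|B|) Tv i j
    + a * \sum_(k < #|Z|) Tv i k * rsum Y k.
  rewrite rsumZ normcR gtr0_norm // -mulrDr (ler_wpM2l (ltW a0)) //.
  apply: le_trans (rsumD _ _ _) _; apply: lerD.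
    by apply: ler_sum => j _; rewrite mxE normcR ger0_norm.
  apply: le_trans (rsum_mulmx _ _ _) _; apply: ler_sum => k _.
  by rewrite mxE normcR ger0_norm.
have [_ rows] := genT.
have := rows (enum_val i); rewrite (sum_tripartition _ part) (bigD1 i) //= -/tii => rs.
have hZ : \sum_(k < #|Z|) Tv i k * rsum X k +
   \sum_(k < #|Z|) Tv i k * rsum Y k <=
   \sum_(k < #|Z|) Tv i k.
  rewrite -big_split /=; apply: ler_sum => k _.
  by rewrite -mulrDr -[leRHS]mulr1 ler_wpM2l.
have := ler_wpM2l (ltW a0) hZ; have := congr1 (fun x => a * x) rs.
rewrite mulr0 !mulrDr => e1 e2.
apply: le_trans (lerD b1 b2) _; move: diag e1 e2; rewrite mulrBr; lra.
Qed.

End Rows.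

Section FluidRows.
Context {R : realType} {m : nat}.
Local Notation C := R[i].

Lemma rsum_eq_row p q (M N : 'M[C]_(p, q)) i : (forall j, M i j = N i j) -> rsum M i = rsum N i.
Proof. by move=> h; apply: eq_bigr => j _; rewrite h. Qed.

Lemma invmx_diag_mul n q (v : 'rV[C]_n) (M : 'M[C]_(n, q)) i j :
  (forall k, v 0 k != 0) -> (invmx (diag_mx v) *m M) i j = (v 0 i)^-1 * M i j.
Proof.
move=> h; pose X := \matrix_(k, l) ((v 0 k)^-1 * M k l).
have u : diag_mx v \in unitmx.
  by rewrite unitmxE det_diag unitfE; apply/prodf_neq0 => k _.
have -> : M = diag_mx v *m X.
  by apply/matrixP => k l; rewrite mul_diag_mx !mxE mulrA divff // mul1r.
by rewrite mulKmx // mul_diag_mx !mxE mulKf // mulVKf.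
Qed.

Lemma rate_mx_abs (c : 'I_m -> R) (A : {set 'I_m}) :
  (forall i, i \in A -> 0 <= c i) -> rate_mx c A = abs_rate_mx c A.
Proof.
move=> h; congr diag_mx; apply/rowP => i; rewrite !mxE ger0_norm // h //.
exact: enum_valP.
Qed.

(** Dividing row i by |c i| amounts to taking the step [a] = eps / |c i| in [uniform_row]. The form
    with [abs_rate_mx] covers both signs, thanks to [rate_mx_abs]. *)
Lemma fluid_rows (T : 'M[R]_m) (c : 'I_m -> R) (A B Z : {set 'I_m}) (s : C) (eps : R)
    (i : 'I_#|A|) (inv00 := invmx (block T Z Z - s%:M)) (a := eps / `|c (enum_val i)|) :
  conservative_generator T -> tripartition A B Z -> 0 < Re s -> 0 < eps ->
  (forall i, i \in A -> c i != 0) ->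
  a * (Re s - T (enum_val i) (enum_val i)) <= 2^-1 ->
  a * Im s ^+ 2 <= Re s / 2 ->
  rsum (1%:M + eps%:C *: (invmx (abs_rate_mx c A) *m
     (block T A A - s%:M - block T A Z *m inv00 *m block T Z A))) i +
  rsum (eps%:C *: (invmx (abs_rate_mx c A) *m
     (block T A B - block T A Z *m inv00 *m block T Z B))) i
  <= 1 - a * Re s / 2.
Proof.
move=> gT part s0 eps0 hc h1 h2.
have hv (k : 'I_#|A|) : (\row_k (`|c (enum_val k)|%:C : C)) 0 k != 0 :> C.
  by rewrite mxE eq_complex /= eqxx andbT normr_eq0 hc ?enum_valP.
have aE : a%:C = eps%:C * (`|c (enum_val i)|%:C)^-1 :> C by rewrite /a rmorphM fmorphV.
have a0 : 0 < a by rewrite divr_gt0 // normr_gt0 hc ?enum_valP.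
pose X := - (inv00 *m block T Z A); pose Y := - (inv00 *m block T Z B).
have u : block T Z Z - s%:M \in unitmx by exact: T00_unit part _.
have hX : (block T Z Z - s%:M) *m X = - block T Z A by rewrite mulmxN mulKVmx.
have hY : (block T Z Z - s%:M) *m Y = - block T Z B by rewrite mulmxN mulKVmx.
have hXY := hitting_rsum gT part s0 hX hY.
rewrite (@rsum_eq_row _ _ _ (1%:M + a%:C *: (block T A A - s%:M + block T A Z *m X))); last first.
  move=> j; rewrite mxE [X in _ + X]mxE [RHS]mxE [X in _ = _ + X]mxE /abs_rate_mx invmx_diag_mul //.
  by rewrite aE -mulmxA -mulmxN -/X [_ 0 i]mxE mulrA.
rewrite (@rsum_eq_row _ _ (_ *: (_ *m (block T A B - _))) (a%:C *: (block T A B + block T A Z *m Y))); last first.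
  move=> j; rewrite mxE [RHS]mxE /abs_rate_mx invmx_diag_mul //.
  by rewrite aE -mulmxA -mulmxN -/Y [_ 0 i]mxE mulrA.
have h := uniform_row gT part s0 hXY a0 h1 h2; exact: h.
Qed.

Section Generator.
Variables (T : 'M[R]_m) (c : 'I_m -> R) (Sp Sm S0 : {set 'I_m}) (s : C).
Hypotheses (gT : conservative_generator T) (s0 : 0 < Re s).
Hypotheses (hp : forall i, (i \in Sp) = (0 < c i)) (hm : forall i, (i \in Sm) = (c i < 0))
  (h0 : forall i, (i \in S0) = (c i == 0)).

Lemma tripartition_sign : tripartition Sp Sm S0.
Proof. by move=> j; rewrite hp hm h0; case: (ltrgt0P (c j)). Qed.

Lemma tripartition_signC : tripartition Sm Sp S0.
Proof. by move=> j; rewrite [(_ + (j \in Sp))%N]addnC; exact: tripartition_sign. Qed.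

Lemma fluid_uniformization : uniformizable (Qpp T c Sp S0 s) (Qpm T c Sp Sm S0 s)
  (Qmm T c Sm S0 s) (Qmp T c Sp Sm S0 s).
Proof.
(* The two summands are chosen so that N^-1 * w i <= 1 yields both smallness conditions of
   [uniform_row] for a = N^-1 / |c i|. Where c i = 0 the inverse is 0 and so is [w i]. *)
pose w i := `|c i|^-1 * (2 * (Re s + `|T i i|) + 2 * Im s ^+ 2 / Re s).
have w0 i : 0 <= w i.
  apply: mulr_ge0; first by rewrite invr_ge0.
  apply: addr_ge0; first by rewrite mulr_ge0 // addr_ge0 // ltW.
  by rewrite divr_ge0 ?(ltW s0) // mulr_ge0 // sqr_ge0.
(* The summand Re s keeps the resulting delta at most 1; [cM] bounds every |c i|, so that one delta
   serves all rows. *)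
pose N := 1 + Re s + \sum_i w i.
pose cM := 1 + \sum_i `|c i|.
have sw0 : 0 <= \sum_i w i by exact: sumr_ge0.
have sc0 : 0 <= \sum_i `|c i| by exact: sumr_ge0.
have N0 : 0 < N by rewrite /N; move: s0 sw0; lra.
have cM0 : 0 < cM by rewrite /cM; move: sc0; lra.
have ws i : w i <= N.
  rewrite /N (bigD1 i) //= addrCA lerDl.
  by apply: addr_ge0; [apply: addr_ge0 => //; exact: ltW|exact: sumr_ge0].
have cs i : `|c i| <= cM.
  by rewrite /cM (bigD1 i) //= addrCA lerDl; apply: addr_ge0 => //; exact: sumr_ge0.
have eps0 : 0 < N^-1 by rewrite invr_gt0.
have d0 : 0 < N^-1 / cM * Re s / 2 by rewrite !divr_gt0 // mulr_gt0 // divr_gt0.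
have small i : c i != 0 ->
  [/\ N^-1 / `|c i| * (Re s - T i i) <= 2^-1,
      N^-1 / `|c i| * Im s ^+ 2 <= Re s / 2 &
      N^-1 / cM * Re s / 2 <= N^-1 / `|c i| * Re s / 2].
  move=> ci0; have ci : 0 < `|c i| by rewrite normr_gt0.
  have h : N^-1 * w i <= 1 by rewrite mulrC ler_pdivrMr // mul1r.
  have nn1 : 0 <= N^-1 / `|c i| * (Re s + `|T i i|).
    by apply: mulr_ge0; [apply: divr_ge0|apply: addr_ge0] => //; exact: ltW.
  have nn2 : 0 <= N^-1 / `|c i| * (Im s ^+ 2 / Re s).
    by apply: mulr_ge0; apply: divr_ge0 => //; rewrite ?sqr_ge0 // ltW.
  have {}h : 2 * (N^-1 / `|c i| * (Re s + `|T i i|)) +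
      2 * (N^-1 / `|c i| * (Im s ^+ 2 / Re s)) <= 1.
    by apply: le_trans h; apply/eq_lew; rewrite /w; ring.
  split.
  - apply: le_trans (_ : N^-1 / `|c i| * (Re s + `|T i i|) <= _); last by move: nn2 h; lra.
    by apply: ler_wpM2l; [rewrite divr_ge0 // ltW|rewrite lerD2l lerNl; have := ler_norm (- T i i); rewrite normrN; lra].
  - have -> : N^-1 / `|c i| * Im s ^+ 2 =
        N^-1 / `|c i| * (Im s ^+ 2 / Re s) * Re s.
      by rewrite -[RHS]mulrA divfK // gt_eqF.
    by rewrite [leRHS]mulrC ler_pM2r //; move: nn1 h; lra.
  - rewrite ler_wpM2r // ler_wpM2r ?(ltW s0) // ler_wpM2l ?(ltW eps0) //.
    by rewrite lef_pV2 ?posrE.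
exists N^-1, (N^-1 / cM * Re s / 2); split => //.
- have p1 : N^-1 * Re s <= 1.
    by rewrite mulrC ler_pdivrMr // mul1r /N; move: sw0; lra.
  have p2 : cM^-1 <= 1 by rewrite invf_le1 // /cM; move: sc0; lra.
  have := mulr_ile1 (ltW (mulr_gt0 eps0 s0)) (ltW (_ : 0 < cM^-1)) p1 p2.
  rewrite invr_gt0 => /(_ cM0).
  rewrite mulrAC; move: d0; rewrite [N^-1 / cM * _]mulrAC; lra.
- move=> i; have ci : c (enum_val i) != 0.
    by rewrite gt_eqF // -hp enum_valP.
  have [a1 a2 a3] := small _ ci.
  apply: le_trans (_ : 1 - N^-1 / `|c (enum_val i)| * Re s / 2 <= _).
    rewrite /Qpp /Qpm rate_mx_abs; last by move=> j; rewrite hp => /ltW.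
    apply: fluid_rows => //; first exact: tripartition_sign.
    by move=> j; rewrite hp => /gt_eqF ->.
  by rewrite lerD2l lerN2.
- move=> i; have ci : c (enum_val i) != 0.
    by rewrite lt_eqF // -hm enum_valP.
  have [a1 a2 a3] := small _ ci; rewrite addrC.
  apply: le_trans (_ : 1 - N^-1 / `|c (enum_val i)| * Re s / 2 <= _).
    apply: fluid_rows => //; first exact: tripartition_signC.
    by move=> j; rewrite hm => /lt_eqF ->.
  by rewrite lerD2l lerN2.
Qed.

End Generator.
End FluidRows.

(** * Differentiability of Riccati solutions *)

Section MatrixLimits.
Context {R : realType} {T : Type} {F : set_system T} {FF : ProperFilter F}.
Local Notation C := R[i].

Definition mccvg {p q} (M : T -> 'M[C]_(p, q)) (L : 'M[C]_(p, q)) :=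
  forall i j, ccvg F (fun t => M t i j) (L i j).

Lemma mccvg_cst p q (L : 'M[C]_(p, q)) : mccvg (fun=> L) L.
Proof. by move=> i j; exact: ccvg_cst. Qed.

Lemma mccvgD p q (M N : T -> 'M[C]_(p, q)) K L :
  mccvg M K -> mccvg N L -> mccvg (fun t => M t + N t) (K + L).
Proof. by move=> h h' i j; under eq_fun do rewrite mxE; rewrite mxE; exact: ccvgD. Qed.

Lemma mccvgB p q (M N : T -> 'M[C]_(p, q)) K L :
  mccvg M K -> mccvg N L -> mccvg (fun t => M t - N t) (K - L).
Proof. by move=> h h' i j; under eq_fun do rewrite !mxE; rewrite !mxE; exact: ccvgB. Qed.

Lemma mccvgM p q r (M : T -> 'M[C]_(p, q)) (N : T -> 'M[C]_(q, r)) K L :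
  mccvg M K -> mccvg N L -> mccvg (fun t => M t *m N t) (K *m L).
Proof.
move=> h h' i j; under eq_fun do rewrite mxE; rewrite mxE.
by apply: ccvg_sum => k _; exact: ccvgM.
Qed.

Lemma mccvgZ p q (f : T -> C) (M : T -> 'M[C]_(p, q)) a L :
  ccvg F f a -> mccvg M L -> mccvg (fun t => f t *: M t) (a *: L).
Proof. by move=> h h' i j; under eq_fun do rewrite mxE; rewrite mxE; exact: ccvgM. Qed.

Lemma mccvg_near p q (M N : T -> 'M[C]_(p, q)) L :
  (\forall t \near F, M t = N t) -> mccvg M L -> mccvg N L.
Proof.
by move=> h hM i j; apply: ccvg_near (hM i j); apply: filterS h => t ->.
Qed.

Definition tnorm {p q} (M : 'M[C]_(p, q)) : R := \sum_i rsum M i.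

Lemma tnorm_ge0 p q (M : 'M[C]_(p, q)) : 0 <= tnorm M.
Proof. by apply: sumr_ge0 => i _; exact: rsum_ge0. Qed.

Lemma rbound_tnorm p q (M : 'M[C]_(p, q)) : rbound M (tnorm M).
Proof.
by move=> i; rewrite /tnorm (bigD1 i) //= lerDl sumr_ge0 // => j _; exact: rsum_ge0.
Qed.

Lemma mccvg_tnorm p q (M : T -> 'M[C]_(p, q)) L : mccvg M L -> tnorm (M t) @[t --> F] --> tnorm L.
Proof.
move=> h; apply: cvg_sumr => i _; apply: cvg_sumr => j _; exact: ccvg_normc.
Qed.

Lemma tnorm0 p q : tnorm (0 : 'M[C]_(p, q)) = 0.
Proof. by apply: big1 => i _; exact: rsum0. Qed.

Lemma mccvg_squeeze p q (M : T -> 'M[C]_(p, q)) L (v : T -> R) :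
  (\forall t \near F, rbound (M t - L) (v t)) -> v t @[t --> F] --> (0 : R) -> mccvg M L.
Proof.
move=> hb hv i j.
have sq (f : C -> R) : (forall x y, f (x - y) = f x - f y) -> (forall z, `|f z| <= normc z) ->
    f (M t i j) @[t --> F] --> f (L i j).
  move=> fB fn.
  have bd : \forall t \near F, f (L i j) - v t <= f (M t i j) <= f (L i j) + v t.
    near=> t; have h : rbound (M t - L) (v t) by near: t.
    rewrite -ler_distl -fB; apply: le_trans (fn _) _.
    by apply: le_trans (h i); have := normc_le_rsum (M t - L) i j; rewrite !mxE.
  apply: (squeeze_cvgr bd).
    by rewrite -[X in _ --> X]subr0; apply: cvgB => //; exact: cvg_cst.
  by rewrite -[X in _ --> X]addr0; apply: cvgD => //; exact: cvg_cst.
split.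
  by apply: sq; [move=> x y; rewrite ReD ReN|exact: normc_Re].
by apply: sq; [move=> x y; rewrite ImD ImN|exact: normc_Im].
Unshelve. all: by end_near. Qed.

End MatrixLimits.
Arguments mccvg {R T} F {p q} M L.

Section Riccati.
Context {R : realType} {a b : nat}.
Local Notation C := R[i].
Implicit Types (Qpp : 'M[C]_a) (Qpm : 'M[C]_(a, b)) (Qmm : 'M[C]_b) (Qmp K : 'M[C]_(b, a)).

Definition riccati Qpp Qpm Qmm Qmp K := Qmp + Qmm *m K + K *m Qpp + K *m Qpm *m K.

(** Taking the left factor at [K] and the right factor at [K'] leaves no quadratic remainder. This
    is why the stability bound involves two matrices. *)
Lemma riccati_sub Qpp Qpm Qmm Qmp K K' :
  (Qmm + K *m Qpm) *m (K' - K) + (K' - K) *m (Qpp + Qpm *m K') =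
  riccati Qpp Qpm Qmm Qmp K' - riccati Qpp Qpm Qmm Qmp K.
Proof. by rewrite /riccati !(mulmxBl, mulmxBr, mulmxDl, mulmxDr) !mulmxA; mxring. Qed.

Lemma riccati_subQ Qpp Qpm Qmm Qmp Qpp' Qpm' Qmm' Qmp' K :
  riccati (Qpp - Qpp') (Qpm - Qpm') (Qmm - Qmm') (Qmp - Qmp') K =
  riccati Qpp Qpm Qmm Qmp K - riccati Qpp' Qpm' Qmm' Qmp' K.
Proof. by rewrite /riccati !(mulmxBl, mulmxBr, mulmxDl, mulmxDr); mxring. Qed.

Lemma riccatiZ c Qpp Qpm Qmm Qmp K :
  riccati (c *: Qpp) (c *: Qpm) (c *: Qmm) (c *: Qmp) K = c *: riccati Qpp Qpm Qmm Qmp K.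
Proof. by rewrite /riccati !scalerDr -!(scalemxAl, scalemxAr). Qed.

Lemma riccati_uniformized (eps : C) Qpp Qpm Qmm Qmp K :
  eps *: Qmp + (1%:M + eps *: Qmm) *m K + K *m (1%:M + eps *: Qpp) + K *m (eps *: Qpm) *m K =
  K *+ 2 + eps *: riccati Qpp Qpm Qmm Qmp K.
Proof.
rewrite /riccati !(mulmxDl, mulmxDr) mul1mx mulmx1 !scalerDr -!(scalemxAl, scalemxAr).
by rewrite mulr2n; mxring.
Qed.

Lemma riccati_solution Qpp Qpm Qmm Qmp : uniformizable Qpp Qpm Qmm Qmp ->
  exists2 K, rbound K 1 & riccati Qpp Qpm Qmm Qmp K = 0.
Proof.
move=> [eps [delta [eps0 delta0 delta1 hp hm]]].
have le1 : 1 - delta <= 1 by rewrite gerBl ltW.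
have [] := @riccati_fixpoint _ _ _ (1%:M + eps%:C *: Qpp) (eps%:C *: Qpm)
    (1%:M + eps%:C *: Qmm) (eps%:C *: Qmp).
- by move=> i; exact: le_trans (hp i) le1.
- by move=> i; exact: le_trans (hm i) le1.
move=> K hK; rewrite riccati_uniformized => /eqP; rewrite -subr_eq0 addrAC subrr add0r.
rewrite scaler_eq0 => /orP[/eqP[e0]|/eqP e]; last by exists K.
by rewrite e0 ltxx in eps0.
Qed.

(** [kappa] depends on the blocks alone. [K2] ranges over all matrices of row norm at most 1 because
    it will be the solution at a nearby parameter, which solves a different equation. *)
Lemma riccati_stable Qpp Qpm Qmm Qmp : uniformizable Qpp Qpm Qmm Qmp ->
  exists2 kappa : R, 0 < kappa & forall K1 K2 D G : 'M[C]_(b, a), forall g : R,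
    rbound K1 1 -> riccati Qpp Qpm Qmm Qmp K1 = 0 -> rbound K2 1 -> 0 <= g -> rbound G g ->
    (Qmm + K1 *m Qpm) *m D + D *m (Qpp + Qpm *m K2) = - G -> rbound D (kappa * g).
Proof.
move=> [eps [delta [eps0 delta0 delta1 hp hm]]].
exists (eps / delta); first exact: divr_gt0.
move=> K1 K2 D G g hK1 ric hK2 g0 hG syl.
have := @sylvester_bound _ _ _ (1%:M + eps%:C *: Qpp) (eps%:C *: Qpm)
    (1%:M + eps%:C *: Qmm) (eps%:C *: Qmp) delta delta0 delta1 hp hm K1 K2 D (eps%:C *: G)
    (eps * g) hK1 hK2.
rewrite mulrAC; apply.
- by move=> i; rewrite rsumZ normcR gtr0_norm // ler_wpM2l // ltW.
- by rewrite mulr_ge0 // ltW.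
- by rewrite riccati_uniformized ric scaler0 addr0.
have -> : D *+ 2 - eps%:C *: G = D *+ 2 + eps%:C *: ((Qmm + K1 *m Qpm) *m D + D *m (Qpp + Qpm *m K2)).
  by rewrite syl scalerN.
rewrite !(mulmxDl, mulmxDr) mul1mx mulmx1 !scalerDr -!(scalemxAl, scalemxAr).
by rewrite mulr2n; mxring.
Qed.

End Riccati.

Section Derivative.
Context {R : realType} {a b : nat}.
Local Notation C := R[i].
Local Notation F := (0 : R)^'.
Variables (Qpp : R -> 'M[C]_a) (Qpm : R -> 'M[C]_(a, b)) (Qmm : R -> 'M[C]_b).
Variables (Qmp K : R -> 'M[C]_(b, a)).
Variables (dQpp : 'M[C]_a) (dQpm : 'M[C]_(a, b)) (dQmm : 'M[C]_b) (dQmp : 'M[C]_(b, a)).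
Let quot {p q} (M : R -> 'M[C]_(p, q)) (h : R) := (h^-1)%:C *: (M h - M 0).
Hypotheses (hpp : mccvg F (quot Qpp) dQpp) (hpm : mccvg F (quot Qpm) dQpm)
  (hmm : mccvg F (quot Qmm) dQmm) (hmp : mccvg F (quot Qmp) dQmp).
Hypothesis unif : uniformizable (Qpp 0) (Qpm 0) (Qmm 0) (Qmp 0).
Hypothesis hK : \forall h \near (0 : R),
  rbound (K h) 1 /\ riccati (Qpp h) (Qpm h) (Qmm h) (Qmp h) (K h) = 0.
Variable X : 'M[C]_(b, a).
Hypothesis hX : (Qmm 0 + K 0 *m Qpm 0) *m X + X *m (Qpp 0 + Qpm 0 *m K 0) =
  - (dQmp + dQmm *m K 0 + K 0 *m dQpp + K 0 *m (dQpm *m K 0)).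

Let K00 : rbound (K 0) 1 /\ riccati (Qpp 0) (Qpm 0) (Qmm 0) (Qmp 0) (K 0) = 0.
Proof. exact: nbhs_singleton hK. Qed.

Let hK' : \forall h \near F,
  rbound (K h) 1 /\ riccati (Qpp h) (Qpm h) (Qmm h) (Qmp h) (K h) = 0.
Proof. exact: cvg_within hK. Qed.

Let h_neq0 : \forall h \near F, h != 0 :> R.
Proof. exact: nbhs_dnbhs_neq. Qed.

Let id0 : ccvg F (fun h => h%:C) 0.
Proof. by split; [exact: cvg_within|exact: cvg_cst]. Qed.

Let quot_cvg0 p q (M : R -> 'M[C]_(p, q)) L : mccvg F (quot M) L ->
  mccvg F (fun h => M h - M 0) 0.
Proof.
move=> hM; apply: (@mccvg_near _ _ _ _ _ _ (fun h => h%:C *: quot M h)).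
  near=> h; rewrite /quot scalerA -rmorphM mulfV ?scale1r //.
  by near: h.
by rewrite -(scale0r L); exact: mccvgZ.
Unshelve. all: by end_near. Qed.

Let residual h := riccati (Qpp h - Qpp 0) (Qpm h - Qpm 0) (Qmm h - Qmm 0) (Qmp h - Qmp 0) (K h).

(** [riccati] is linear in the blocks: evaluated at [K h] with the blocks at 0, it differs from its
    value 0 with the blocks at h exactly by [residual h]. *)
Let increment_eqn : \forall h \near F,
  (Qmm 0 + K 0 *m Qpm 0) *m (K h - K 0) + (K h - K 0) *m (Qpp 0 + Qpm 0 *m K h) = - residual h.
Proof.
near=> h; have [_ r] : rbound (K h) 1 /\ riccati (Qpp h) (Qpm h) (Qmm h) (Qmp h) (K h) = 0.
  by near: h.
have [_ r0] := K00.
by rewrite /residual riccati_subQ (riccati_sub _ _ _ (Qmp 0)) r0 r subr0 add0r opprK.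
Unshelve. all: by end_near. Qed.

Let mccvg_riccati (A : R -> 'M[C]_a) (B : R -> 'M[C]_(a, b)) (D : R -> 'M[C]_b)
    (E L : R -> 'M[C]_(b, a)) A' B' D' E' L' :
  mccvg F A A' -> mccvg F B B' -> mccvg F D D' -> mccvg F E E' -> mccvg F L L' ->
  mccvg F (fun h => riccati (A h) (B h) (D h) (E h) (L h)) (riccati A' B' D' E' L').
Proof.
move=> hA hB hD hE hL; apply: mccvgD; [apply: mccvgD; [apply: mccvgD|]|] => //.
- exact: mccvgM.
- exact: mccvgM.
- by apply: mccvgM => //; exact: mccvgM.
Qed.

(** Since [K h] has row norm at most 1, the residual is bounded by the increments of the blocks
    alone, and stability carries this bound over to K h - K 0. *)
Lemma riccati_continuous : mccvg F K (K 0).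
Proof.
have [kappa kappa0 stable] := riccati_stable unif.
have [bK r0] := K00.
pose v h := kappa * (tnorm (Qmp h - Qmp 0) + tnorm (Qmm h - Qmm 0) + tnorm (Qpp h - Qpp 0)
   + tnorm (Qpm h - Qpm 0)).
apply: (@mccvg_squeeze _ _ _ _ _ _ _ _ v).
  near=> h.
  have [bKh r] : rbound (K h) 1 /\ riccati (Qpp h) (Qpm h) (Qmm h) (Qmp h) (K h) = 0.
    by near: h.
  apply: (stable (K 0) (K h) _ (residual h)) => //; last by near: h; exact: increment_eqn.
    by rewrite !addr_ge0 // tnorm_ge0.
  have mulK p (M : 'M[C]_(p, b)) j : rsum (M *m K h) j <= tnorm M.
    by apply: le_trans (rsum_mul _ _ bKh) _; rewrite mulr1; exact: rbound_tnorm.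
  have Kmul p (M : 'M[C]_(a, p)) j : rsum (K h *m M) j <= tnorm M.
    apply: le_trans (rsum_mul _ _ (rbound_tnorm M)) _.
    by rewrite -[leRHS]mul1r ler_wpM2r ?tnorm_ge0.
  move=> i; rewrite /residual /riccati.
  apply: le_trans (rsumD _ _ _) (lerD (le_trans (rsumD _ _ _) (lerD _ _)) _).
  - apply: le_trans (rsumD _ _ _) (lerD _ _); [exact: rbound_tnorm|exact: mulK].
  - exact: Kmul.
  - by rewrite -[leRHS]mulr1; apply: rbound_mul => // j; exact: Kmul.
have c0 p q (M : R -> 'M[C]_(p, q)) L : mccvg F (quot M) L -> tnorm (M h - M 0) @[h --> F] --> (0 : R).
  by move=> /quot_cvg0/mccvg_tnorm; rewrite tnorm0.
suff : v h @[h --> F] --> kappa * (0 + 0 + 0 + 0) by rewrite !addr0 mulr0.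
have c1 := c0 _ _ _ _ hmp; have c2 := c0 _ _ _ _ hmm.
have c3 := c0 _ _ _ _ hpp; have c4 := c0 _ _ _ _ hpm.
by apply: (cvgM (cvg_cst _)); exact: (cvgD (cvgD (cvgD c1 c2) c3) c4).
Unshelve. all: by end_near. Qed.

Lemma riccati_derivative : mccvg F (quot K) X.
Proof.
have [kappa kappa0 stable] := riccati_stable unif.
have [bK r0] := K00.
(* [quot K h - X] solves the Sylvester equation whose right factor is taken at [K h], with
   right-hand side - G h. The last term of [G] comes from the equation for [X] having its right
   factor at [K 0]. *)
pose G h := riccati (quot Qpp h) (quot Qpm h) (quot Qmm h) (quot Qmp h) (K h)
   - (dQmp + dQmm *m K 0 + K 0 *m dQpp + K 0 *m (dQpm *m K 0)) + X *m (Qpm 0 *m (K h - K 0)).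
have G0 : mccvg F G 0.
  have -> : 0 = riccati dQpp dQpm dQmm dQmp (K 0)
   - (dQmp + dQmm *m K 0 + K 0 *m dQpp + K 0 *m (dQpm *m K 0)) + X *m (Qpm 0 *m (K 0 - K 0)).
    by rewrite subrr !mulmx0 addr0 /riccati mulmxA subrr.
  have cK := riccati_continuous.
  apply: mccvgD; first apply: mccvgB; first exact: mccvg_riccati.
    exact: mccvg_cst.
  apply: mccvgM; first exact: mccvg_cst.
  apply: mccvgM; first exact: mccvg_cst.
  by apply: mccvgB => //; exact: mccvg_cst.
apply: (@mccvg_squeeze _ _ _ _ _ _ _ _ (fun h => kappa * tnorm (G h))).
  near=> h.
  have [bKh r] : rbound (K h) 1 /\ riccati (Qpp h) (Qpm h) (Qmm h) (Qmp h) (K h) = 0.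
    by near: h.
  apply: (stable (K 0) (K h) _ (G h)) => //; [exact: tnorm_ge0|exact: rbound_tnorm|].
  have e : (Qmm 0 + K 0 *m Qpm 0) *m (K h - K 0) + (K h - K 0) *m (Qpp 0 + Qpm 0 *m K h) = - residual h.
    by near: h; exact: increment_eqn.
  rewrite /G {1}/quot riccatiZ -/(residual h).
  rewrite -[residual h]opprK -e.
  rewrite -[dQmp + _ + _ + _]opprK -hX.
  rewrite /quot !(mulmxBl, mulmxBr, mulmxDl, mulmxDr) -!(scalemxAl, scalemxAr) !(mulmxBl, mulmxBr, mulmxDl, mulmxDr) !mulmxA.
  mxring.
have c := mccvg_tnorm G0; rewrite tnorm0 in c.
by rewrite -[X in _ --> X](mulr0 kappa); apply: (cvgM (cvg_cst _)); exact: c.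
Unshelve. all: by end_near. Qed.
End Derivative.

Section SylvesterSolvable.
Context {K : fieldType} {a b : nat}.

(** An injective endomorphism of a finite-dimensional space is onto. This provides the candidate for
    the derivative before differentiability is known. *)
Lemma sylvester_solvable (J : 'M[K]_b) (U : 'M[K]_a) :
  (forall X : 'M[K]_(b, a), J *m X + X *m U = 0 -> X = 0) ->
  forall D, exists X, J *m X + X *m U = D.
Proof.
move=> inj D; pose L := lin_mx (mulmx J \+ mulmxr U) : 'M[K]_(b * a).
have LE X : mxvec X *m L = mxvec (J *m X + X *m U) by rewrite mul_vec_lin.
have uL : L \in unitmx.
  rewrite -row_free_unit; apply: inj_row_free => v; rewrite -[v]vec_mxK LE.
  by move=> /(congr1 vec_mx); rewrite mxvecK linear0 => /inj ->; rewrite linear0.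
exists (vec_mx (mxvec D *m invmx L)); apply: (can_inj mxvecK).
by rewrite -LE vec_mxK mulmxKV.
Qed.

End SylvesterSolvable.

(** * Block columns and multiplication by I (x) N *)

Section Blocks.
Context {K : comNzRingType}.

Definition block_col {p q} r (X : 'M[K]_(p, r * q)) (l : 'I_r) : 'M[K]_(p, q) :=
  \matrix_(i, j) X i (mxtens_index (l, j)).

Lemma block_col_inj p q r (X Y : 'M[K]_(p, r * q)) : block_col X =1 block_col Y -> X = Y.
Proof.
move=> h; apply/matrixP => i k; case: (mxtens_indexP k) => l j.
by have := congr1 (fun M : 'M[K]_(p, q) => M i j) (h l); rewrite !mxE.
Qed.

Lemma block_colD p q r (X Y : 'M[K]_(p, r * q)) l :
  block_col (X + Y) l = block_col X l + block_col Y l.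
Proof. by apply/matrixP => i j; rewrite !mxE. Qed.

Lemma block_colN p q r (X : 'M[K]_(p, r * q)) l : block_col (- X) l = - block_col X l.
Proof. by apply/matrixP => i j; rewrite !mxE. Qed.

Lemma block_col_mull p p' q r (M : 'M[K]_(p', p)) (X : 'M[K]_(p, r * q)) l :
  block_col (M *m X) l = M *m block_col X l.
Proof.
by apply/matrixP => i j; rewrite !mxE; apply: eq_bigr => k _; rewrite mxE.
Qed.

Lemma block_col_mulr p q q' r (X : 'M[K]_(p, r * q)) (N : 'M[K]_(q, q')) l :
  block_col (X *m tensmx (1%:M : 'M[K]_r) N) l = block_col X l *m N.
Proof.
apply/matrixP => i j; rewrite !mxE.
rewrite (reindex (@mxtens_index r q)) /=; last first.
  by exists (@mxtens_unindex r q) => k _; rewrite (mxtens_indexK, mxtens_unindexK).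
transitivity (\sum_l' \sum_k X i (mxtens_index (l', k)) *
   tensmx (1%:M : 'M[K]_r) N (mxtens_index (l', k)) (mxtens_index (l, j))).
  by rewrite pair_bigA; apply: eq_bigr => -[].
rewrite (bigD1 l) //= [X in _ + X]big1 ?addr0.
  by apply: eq_bigr => k _; rewrite !mxE !mxtens_indexK /= eqxx mul1r.
move=> l' ll'; apply: big1 => k _.
by rewrite !mxE !mxtens_indexK /= (negPf ll') mul0r mulr0.
Qed.

End Blocks.

(** * Derivatives at 0 of complex-valued functions of a real variable *)

Section ComplexDerivative.
Context {R : realType}.
Local Notation C := R[i].
Local Notation F0 := (0 : R)^'.

Definition cquot (f : R -> C) (h : R) := (h^-1)%:C * (f h - f 0).
Definition cdiff (f : R -> C) := exists L, ccvg F0 (cquot f) L.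

Lemma cdiff_cst (x : C) : cdiff (fun=> x).
Proof.
exists 0; rewrite /cquot; under eq_fun do rewrite subrr mulr0; exact: ccvg_cst.
Qed.

Lemma cdiffD f g : cdiff f -> cdiff g -> cdiff (fun h => f h + g h).
Proof.
move=> [L hL] [M hM]; exists (L + M).
rewrite (_ : cquot _ = fun h => cquot f h + cquot g h); first exact: ccvgD.
by apply/funext => h; rewrite /cquot; ring.
Qed.

Lemma cdiffN f : cdiff f -> cdiff (fun h => - f h).
Proof.
move=> [L hL]; exists (- L).
rewrite (_ : cquot _ = fun h => - cquot f h); first exact: ccvgN.
by apply/funext => h; rewrite /cquot; ring.
Qed.

Lemma cdiff_continuous f : cdiff f -> ccvg F0 f (f 0).
Proof.
move=> [L hL]; apply: (@ccvg_near _ _ _ _ (fun h => h%:C * cquot f h + f 0)).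
  near=> h; have h0 : h != 0 by near: h; exact: nbhs_dnbhs_neq.
  by rewrite /cquot mulrA -rmorphM mulfV // mul1r subrK.
rewrite -[X in ccvg _ _ X]add0r -(mul0r L).
apply: ccvgD; last exact: ccvg_cst; apply: ccvgM => //.
by split; [exact: cvg_within|exact: cvg_cst].
Unshelve. all: by end_near. Qed.

Lemma cdiffM f g : cdiff f -> cdiff g -> cdiff (fun h => f h * g h).
Proof.
move=> df dg; have cg := cdiff_continuous dg; move: df dg => [L hL] [M hM].
exists (L * g 0 + f 0 * M).
rewrite (_ : cquot _ = fun h => cquot f h * g h + f 0 * cquot g h).
  by apply: ccvgD; apply: ccvgM => //; exact: ccvg_cst.
by apply/funext => h; rewrite /cquot; ring.
Qed.

Lemma cdiff_near f g : (\forall h \near (0 : R), f h = g h) -> cdiff f -> cdiff g.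
Proof.
move=> fg [L hL]; exists L; apply: ccvg_near hL.
have e0 : f 0 = g 0 by exact: nbhs_singleton fg.
have : \forall h \near F0, f h = g h by exact: cvg_within fg.
by apply: filterS => h e; rewrite /cquot e e0.
Qed.

Lemma cdiffV (f : R -> C) : f 0 != 0 -> cdiff f -> cdiff (fun h => (f h)^-1).
Proof.
move=> f0 df; have cf := cdiff_continuous df; move: df => [L hL].
exists (- (L * (f 0)^-1 * (f 0)^-1)).
have f1 : \forall h \near F0, f h != 0.
  have c : normc (f t) @[t --> F0] --> normc (f 0) by exact: ccvg_normc.
  have n0 : 0 < normc (f 0).
    by rewrite lt_neqAle normc_ge0 andbT eq_sym; apply: contra f0 => /eqP/eq0_normc ->.
  have p : \forall h \near F0, 0 < normc (f h) by exact: (cvgr_gt (normc (f 0))).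
  apply: filterS p => h; apply: contraTneq => ->.
  by rewrite normc0 ltxx.
apply: (@ccvg_near _ _ _ _ (fun h => - (cquot f h * (f h)^-1 * (f 0)^-1))).
  near=> h; have h0 : f h != 0 by near: h.
  by rewrite /cquot; move: (h^-1)%:C => k; field; rewrite h0 f0.
have cV : ccvg F0 (fun h => (f h)^-1) (f 0)^-1 by exact: ccvgV.
have c2 : ccvg F0 (fun h => cquot f h * (f h)^-1 * (f 0)^-1) (L * (f 0)^-1 * (f 0)^-1).
  by apply: ccvgM; [exact: ccvgM|exact: ccvg_cst].
exact: ccvgN.
Unshelve. all: by end_near. Qed.

Lemma cdiff_sum (I : Type) (r : seq I) (P : pred I) (f : I -> R -> C) :
  (forall i, P i -> cdiff (f i)) -> cdiff (fun h => \sum_(i <- r | P i) f i h).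
Proof.
move=> df; elim: r => [|i r ih].
  by under eq_fun do rewrite big_nil; exact: cdiff_cst.
under eq_fun do rewrite big_cons.
by case Pi: (P i) => //; apply: cdiffD => //; exact: df.
Qed.

Lemma cdiff_prod (I : Type) (r : seq I) (P : pred I) (f : I -> R -> C) :
  (forall i, P i -> cdiff (f i)) -> cdiff (fun h => \prod_(i <- r | P i) f i h).
Proof.
move=> df; elim: r => [|i r ih].
  by under eq_fun do rewrite big_nil; exact: cdiff_cst.
under eq_fun do rewrite big_cons.
by case Pi: (P i) => //; apply: cdiffM => //; exact: df.
Qed.

Definition mcdiff {p q} (M : R -> 'M[C]_(p, q)) := forall i j, cdiff (fun h => M h i j).

Lemma mcdiffD p q (M N : R -> 'M[C]_(p, q)) : mcdiff M -> mcdiff N -> mcdiff (fun h => M h + N h).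
Proof. by move=> hM hN i j; under eq_fun do rewrite mxE; exact: cdiffD. Qed.

Lemma mcdiffN p q (M : R -> 'M[C]_(p, q)) : mcdiff M -> mcdiff (fun h => - M h).
Proof. by move=> hM i j; under eq_fun do rewrite mxE; exact: cdiffN. Qed.

Lemma mcdiff_cst p q (M : 'M[C]_(p, q)) : mcdiff (fun=> M).
Proof. by move=> i j; exact: cdiff_cst. Qed.

Lemma mcdiffM p q r (M : R -> 'M[C]_(p, q)) (N : R -> 'M[C]_(q, r)) :
  mcdiff M -> mcdiff N -> mcdiff (fun h => M h *m N h).
Proof.
by move=> hM hN i j; under eq_fun do rewrite mxE; apply: cdiff_sum => k _; exact: cdiffM.
Qed.

Lemma mcdiff_near p q (M N : R -> 'M[C]_(p, q)) :
  (\forall h \near (0 : R), M h = N h) -> mcdiff M -> mcdiff N.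
Proof.
by move=> e hM i j; apply: cdiff_near (hM i j); apply: filterS e => h ->.
Qed.

Lemma cdiff_det n (M : R -> 'M[C]_n) : mcdiff M -> cdiff (fun h => \det (M h)).
Proof.
move=> hM; rewrite /determinant; apply: cdiff_sum => u _.
by apply: cdiffM; [exact: cdiff_cst|apply: cdiff_prod => i _; exact: hM].
Qed.

(** Cramer's rule; [invmx] agrees with it on invertible matrices, hence the hypothesis on a whole
    neighbourhood of 0. *)
Lemma mcdiff_inv n (M : R -> 'M[C]_n) :
  (\forall h \near (0 : R), M h \in unitmx) -> mcdiff M -> mcdiff (fun h => invmx (M h)).
Proof.
move=> u hM; apply: (@mcdiff_near _ _ (fun h => (\det (M h))^-1 *: \adj (M h))).
  by apply: filterS u => h uh; rewrite /invmx uh.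
move=> i j; under eq_fun do rewrite !mxE.
apply: cdiffM.
  apply: cdiffV; last exact: cdiff_det.
  have : M 0 \in unitmx by exact: nbhs_singleton u.
  by rewrite unitmxE unitfE.
rewrite /cofactor; apply: cdiffM; first exact: cdiff_cst.
by apply: cdiff_det => k l; under eq_fun do rewrite !mxE; exact: hM.
Qed.

End ComplexDerivative.

Section PartialDerivative.
Context {R : realType} {r : nat}.
Local Notation C := R[i].
Local Notation F0 := (0 : R)^'.

(** The order of the summands is that of the difference quotient in [derivable]. *)
Definition along (theta : 'rV[R]_r) (l : 'I_r) (h : R) : 'rV[R]_r := h *: delta_mx 0 l + theta.

Lemma along0 theta l : along theta l 0 = theta.
Proof. by rewrite /along scale0r add0r. Qed.

Lemma cpartialP (f : 'rV[R]_r -> C) l theta L :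
  ccvg F0 (cquot (f \o along theta l)) L ->
  cpartial_derivable f l theta /\ cpartial f l theta = L.
Proof.
move=> [hr hi].
have e1 : (fun h : R => h^-1 *: (((fun t => Re (f t) : R^o) \o shift theta) (h *: delta_mx 0 l)
     - (Re (f theta) : R^o))) = fun h => Re (cquot (f \o along theta l) h).
  by apply/funext => h; rewrite /cquot /= along0 ReM ReD ReN /= mul0r subr0.
have e2 : (fun h : R => h^-1 *: (((fun t => Im (f t) : R^o) \o shift theta) (h *: delta_mx 0 l)
     - (Im (f theta) : R^o))) = fun h => Im (cquot (f \o along theta l) h).
  by apply/funext => h; rewrite /cquot /= along0 ImM ImD ImN /= mul0r addr0.
split; first by split; rewrite /derivable ?e1 ?e2; apply/cvg_ex; eexists; eassumption.
rewrite /cpartial /derive e1 e2 (cvg_lim _ hr) // (cvg_lim _ hi) //.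
by case: (L).
Qed.

Lemma cdiff_cquot (f : 'rV[R]_r -> C) l theta :
  cdiff (f \o along theta l) -> ccvg F0 (cquot (f \o along theta l)) (cpartial f l theta).
Proof. by move=> [L hL]; have [_ ->] := cpartialP hL. Qed.

Lemma cdiff_real (f : 'rV[R]_r -> R) l theta :
  differentiable (f : _ -> R^o) theta -> cdiff (fun h => (f (along theta l h))%:C).
Proof.
move=> df; have := @diff_derivable _ _ _ (f : _ -> R^o) theta (delta_mx 0 l) df.
rewrite /derivable => /cvg_ex[L hL]; exists (L%:C); split; last first.
  rewrite /cquot; under eq_fun do rewrite ImM /= subr0 mulr0 mul0r addr0; exact: cvg_cst.
rewrite /cquot; under eq_fun do rewrite ReM /= mul0r subr0 along0; exact: hL.
Qed.

Lemma along_near (Theta : set 'rV[R]_r) theta l : open Theta -> Theta theta ->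
  \forall h \near (0 : R), Theta (along theta l h).
Proof.
move=> oT tT.
have c : along theta l h @[h --> (0 : R)] --> theta.
  rewrite -[X in _ --> X]add0r; apply: cvgD; last exact: cvg_cst.
  by rewrite -[X in _ --> X](scale0r (delta_mx 0 l : 'rV[R]_r)); apply: cvgZ; [exact: cvg_id|exact: cvg_cst].
by apply: c; exact: open_nbhs_nbhs.
Qed.

End PartialDerivative.

(** * Space-harmonic functions *)

Section Poisson.
Context {R : realType}.
Implicit Types u v : nat -> R.

Definition seq_bounded u (M : R) := forall n, `|u n| <= M.
Definition egf_coeff u n : R := u n / n`!%:R.
Definition egf u (y : R) : R := limn (pseries (egf_coeff u) y).
(** For y >= 0 this is the mean of u at a Poisson variable of parameter y. Its derivative is the
    same average of the forward difference [dseq u], which gives access to e^{-Ux} through powers of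
    I + eps U. *)
Definition pois u (y : R) : R := expR (- y) * egf u y.
Definition dseq u n : R := u n.+1 - u n.

Let term_le u M y n : seq_bounded u M ->
  `|egf_coeff u n * y ^+ n| <= M * exp_coeff `|y| n.
Proof.
move=> hu; rewrite /egf_coeff /exp_coeff /= !normrM normfV normr_nat normrX.
by rewrite -mulrA [_^-1 * _]mulrC ler_wpM2r.
Qed.

Let M_ge0 u M : seq_bounded u M -> 0 <= M.
Proof. by move=> /(_ 0%N); apply: le_trans. Qed.

Let cvg_bound M y : cvgn (series (fun n => M * exp_coeff y n : R)).
Proof. exact: (is_cvg_seriesZ (k := M) (is_cvg_series_exp_coeff y)). Qed.

Let ncvg_egf u M y : seq_bounded u M -> cvgn [normed pseries (egf_coeff u) y].
Proof.
move=> hu; apply: (@series_le_cvg _ _ (fun n => M * exp_coeff `|y| n)) ;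
  [by move=> n; exact: normr_ge0| | |].
- by move=> n; apply: mulr_ge0; [exact: M_ge0 hu|exact: exp_coeff_ge0].
- move=> n; exact: term_le.
- exact: cvg_bound.
Qed.

Lemma cvg_egf u M y : seq_bounded u M -> cvgn (pseries (egf_coeff u) y).
Proof. by move=> hu; apply: normed_cvg; exact: ncvg_egf hu. Qed.

Lemma egf_bound u M y : seq_bounded u M -> `|egf u y| <= M * expR `|y|.
Proof.
move=> hu; have h : `|egf u y| <= limn [normed pseries (egf_coeff u) y].
  exact: (@lim_series_norm R R^o _ (@ncvg_egf _ _ y hu)).
apply: (le_trans h).
have -> : M * expR `|y| = limn (series (fun n => M * exp_coeff `|y| n)).
  by rewrite /expR; apply/esym; exact: (lim_seriesZ M (is_cvg_series_exp_coeff `|y|)).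
apply: lim_series_le; [exact: ncvg_egf hu|exact: cvg_bound|].
by move=> n; exact: term_le.
Qed.

(** The factor e^{-y + |y|} is 1 for y >= 0 and at most e^2 on [-1, 0]. The negative range
    corresponds to levels slightly above 0. *)
Lemma pois_bound u M y : seq_bounded u M -> -1 <= y -> `|pois u y| <= M * expR 2.
Proof.
move=> hu y1; rewrite normrM gtr0_norm ?expR_gt0 //.
apply: le_trans (ler_wpM2l (expR_ge0 _) (egf_bound _ hu)) _.
rewrite mulrCA -expRD ler_wpM2l ?(M_ge0 hu) // ler_expR.
by case: (ler0P y) => y0; move: y1 y0; lra.
Qed.

Lemma pseries_diffs_egf u : pseries_diffs (egf_coeff u) = egf_coeff (fun n => u n.+1).
Proof.
apply/funext => n; rewrite /pseries_diffs /egf_coeff factS natrM invfM mulrCA mulVKf //.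
Qed.

Lemma is_derive_egf u M (y : R) : seq_bounded u M ->
  is_derive y (1 : R) (egf u) (egf (fun n => u n.+1) y).
Proof.
move=> hu; rewrite /egf -pseries_diffs_egf.
have h1 : seq_bounded (fun n => u n.+1) M by move=> n; exact: hu.
have h2 : seq_bounded (fun n => u n.+2) M by move=> n; exact: hu.
apply: (@pseries_snd_diffs _ _ (`|y| + 1)).
- exact: cvg_egf hu.
- by rewrite pseries_diffs_egf; exact: cvg_egf h1.
- by rewrite !pseries_diffs_egf; exact: cvg_egf h2.
- by rewrite [ltRHS]ger0_norm ?addr_ge0 // ltrDl.
Qed.

Lemma egfZD u v M N a b y : seq_bounded u M -> seq_bounded v N ->
  egf (fun n => a * u n + b * v n) y = a * egf u y + b * egf v y.
Proof.
move=> hu hv; rewrite /egf.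
have cu : cvgn (pseries (egf_coeff u) y) by exact: cvg_egf hu.
have cv : cvgn (pseries (egf_coeff v) y) by exact: cvg_egf hv.
have -> : pseries (egf_coeff (fun n => a * u n + b * v n)) y =
  series (a *: (fun n => egf_coeff u n * y ^+ n) + b *: (fun n => egf_coeff v n * y ^+ n)).
  by congr series; apply/funext => n; rewrite /egf_coeff /= !fctE; rewrite /GRing.scale /=; ring.
by rewrite (lim_seriesD (is_cvg_seriesZ (k := a) cu) (is_cvg_seriesZ (k := b) cv)) (lim_seriesZ a cu) (lim_seriesZ b cv).
Qed.

Lemma poisZD u v M N a b y : seq_bounded u M -> seq_bounded v N ->
  pois (fun n => a * u n + b * v n) y = a * pois u y + b * pois v y.
Proof. by move=> hu hv; rewrite /pois (egfZD _ _ _ hu hv); ring. Qed.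

Lemma dseq_bounded u M : seq_bounded u M -> seq_bounded (dseq u) (2 * M).
Proof.
by move=> hu n; apply: le_trans (ler_normB _ _) _; have := hu n; have := hu n.+1; lra.
Qed.

Lemma is_derive_pois u M (y : R) : seq_bounded u M -> is_derive y (1 : R) (pois u) (pois (dseq u) y).
Proof.
move=> hu; have h1 : seq_bounded (fun n => u n.+1) M by move=> n; exact: hu.
have d := is_derive_egf _ hu.
have -> : pois (dseq u) y = expR (- y) * egf (fun n => u n.+1) y - expR (- y) * egf u y.
  have -> : dseq u = fun n => 1 * u n.+1 + (-1) * u n.
    by apply/funext => n; rewrite /dseq mul1r mulN1r.
  by rewrite /pois (egfZD _ _ _ h1 hu); ring.
rewrite /pois.
apply: is_derive_eq.
by rewrite /GRing.scale /=; ring.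
Qed.

(** The mean value theorem applied twice; each forward difference doubles the bound [M], whence the
    factor 4. *)
Lemma pois_taylor u M y z : seq_bounded u M -> -1 <= y -> -1 <= y + z ->
  `|pois u (y + z) - pois u y - z * pois (dseq u) y| <= 4 * (M * expR 2) * z ^+ 2.
Proof.
move=> hu hy hz.
have h1 := dseq_bounded hu; have h2 := dseq_bounded h1.
have lip v N : seq_bounded v N -> forall p q : R, -1 <= p -> p <= q ->
    exists2 c, p <= c <= q & pois v q - pois v p = pois (dseq v) c * (q - p).
  move=> hv p q p1 pq.
  have [||c cpq e] := @MVT_segment _ (pois v) (pois (dseq v)) p q pq.
  - by move=> x _; exact: is_derive_pois hv.
  - apply: derivable_within_continuous => x _.
    by have D := is_derive_pois x hv; exact: ex_derive.
  by exists c.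
have B0 : 0 <= M * expR 2 by rewrite mulr_ge0 ?expR_ge0 // (M_ge0 hu).
have two (p q : R) : -1 <= p -> -1 <= q -> exists2 c, -1 <= c /\ `|c - p| <= `|q - p| &
    pois u q - pois u p = pois (dseq u) c * (q - p).
  move=> p1 q1; case: (leP p q) => [pq|/ltW qp].
    have [c /andP[pc cq] e] := lip _ _ hu p q p1 pq; exists c => //.
    by rewrite (le_trans p1) // !ger0_norm ?subr_ge0 // lerD2r.
  have [c /andP[qc cp] e] := lip _ _ hu q p q1 qp; exists c.
    rewrite (le_trans q1) //; split => //.
    by rewrite !ler0_norm ?subr_le0 // lerN2 lerD2r.
  by rewrite -(opprB p q) mulrN -e opprB.
have lip1 p q : -1 <= p -> -1 <= q ->
    `|pois (dseq u) q - pois (dseq u) p| <= 4 * (M * expR 2) * `|q - p|.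
  move=> p1 q1; wlog pq : p q p1 q1 / p <= q.
    move=> h; case: (leP p q) => [pq|/ltW qp]; first exact: h.
    by rewrite distrC [X in _ <= _ * X]distrC; exact: h.
  have [c /andP[pc cq] ->] := lip _ _ h1 p q p1 pq.
  rewrite normrM ler_wpM2r //; apply: le_trans (pois_bound h2 (le_trans p1 pc)) _.
  by rewrite !mulrA; move: B0; lra.
have [c [c1 cz] ->] := two y (y + z) hy hz.
rewrite addrAC subrr add0r mulrC -mulrBr normrM; rewrite addrAC subrr add0r in cz.
rewrite expr2 -[z * z]real_normK ?num_real // expr2.
apply: le_trans (ler_wpM2l (normr_ge0 _) (lip1 _ _ hy c1)) _.
have h3 : 0 <= 4 * (M * expR 2) * `|z| by apply: mulr_ge0 => //; apply: mulr_ge0.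
have := ler_wpM2l h3 cz; congr (_ <= _); ring.
Qed.

End Poisson.

Section ComplexPoisson.
Context {R : realType}.
Local Notation C := R[i].
Implicit Types u v : nat -> C.

Definition cseq_bounded u M := forall n, normc (u n) <= M.
Definition cpois u (y : R) : C :=
  pois (fun n => Re (u n)) y +i* pois (fun n => Im (u n)) y.
Definition cdseq u n : C := u n.+1 - u n.

Let Re_bounded u M : cseq_bounded u M -> seq_bounded (fun n => Re (u n)) M.
Proof. by move=> h n; exact: le_trans (normc_Re _) (h n). Qed.
Let Im_bounded u M : cseq_bounded u M -> seq_bounded (fun n => Im (u n)) M.
Proof. by move=> h n; exact: le_trans (normc_Im _) (h n). Qed.

Lemma cpois_bound u M y : cseq_bounded u M -> -1 <= y -> normc (cpois u y) <= 2 * (M * expR 2).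
Proof.
move=> h y1; apply: le_trans (normc_ReIm _) _; rewrite mulr_natl mulr2n.
by apply: lerD; [exact: pois_bound (Re_bounded h) y1|exact: pois_bound (Im_bounded h) y1].
Qed.

Lemma cpois_taylor u M y z : cseq_bounded u M -> -1 <= y -> -1 <= y + z ->
  normc (cpois u (y + z) - cpois u y - z%:C * cpois (cdseq u) y) <= 8 * (M * expR 2) * z ^+ 2.
Proof.
move=> h y1 z1; apply: le_trans (normc_ReIm _) _.
have := lerD (pois_taylor (Re_bounded h) y1 z1) (pois_taylor (Im_bounded h) y1 z1).
have eR : dseq (fun n => Re (u n)) = fun n => Re (cdseq u n).
  by apply/funext => n; rewrite /dseq /cdseq ReD ReN.
have eI : dseq (fun n => Im (u n)) = fun n => Im (cdseq u n).
  by apply/funext => n; rewrite /dseq /cdseq ImD ImN.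
rewrite eR eI !ReD !ReN !ImD !ImN ReM ImM /= !mul0r subr0 addr0 => e.
by apply: le_trans e _; apply/eq_lew; ring.
Qed.

Lemma cpoisZD u v M N (a b : C) y : cseq_bounded u M -> cseq_bounded v N ->
  cpois (fun n => a * u n + b * v n) y = a * cpois u y + b * cpois v y.
Proof.
move=> hu hv.
have mul (w : nat -> C) L (z : C) : cseq_bounded w L ->
    (pois (fun n => Re (z * w n)) y = Re z * pois (fun n => Re (w n)) y +
      (- Im z) * pois (fun n => Im (w n)) y) *
    (pois (fun n => Im (z * w n)) y = Re z * pois (fun n => Im (w n)) y +
      Im z * pois (fun n => Re (w n)) y).
  move=> hw; split.
    rewrite -(poisZD _ _ _ (Re_bounded hw) (Im_bounded hw)); congr pois.
    by apply/funext => n; rewrite ReM mulNr.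
  rewrite -(poisZD _ _ _ (Im_bounded hw) (Re_bounded hw)); congr pois.
  by apply/funext => n; rewrite ImM.
have zb (w : nat -> C) L (z : C) : cseq_bounded w L -> cseq_bounded (fun n => z * w n) (normc z * L).
  by move=> hw n; rewrite normcM ler_wpM2l // normc_ge0.
have hau := zb _ _ a hu; have hbv := zb _ _ b hv.
have eR : (fun n => Re (a * u n + b * v n)) =
    fun n => 1 * Re (a * u n) + 1 * Re (b * v n).
  by apply/funext => n; rewrite ReD !mul1r.
have eI : (fun n => Im (a * u n + b * v n)) =
    fun n => 1 * Im (a * u n) + 1 * Im (b * v n).
  by apply/funext => n; rewrite ImD !mul1r.
rewrite /cpois eR eI (poisZD _ _ _ (Re_bounded hau) (Re_bounded hbv)).
rewrite (poisZD _ _ _ (Im_bounded hau) (Im_bounded hbv)).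
rewrite !(mul _ _ _ hu) !(mul _ _ _ hv); apply/eqP; rewrite eq_complex ReD ImD !ReM !ImM /=.
by apply/andP; split; apply/eqP; ring.
Qed.

Lemma cpois_sum (I : finType) (u : I -> nat -> C) M (a : I -> C) y :
  (forall i, cseq_bounded (u i) M) ->
  cpois (fun n => \sum_i a i * u i n) y = \sum_i a i * cpois (u i) y.
Proof.
move=> h; elim: (index_enum I) => [|i r ih].
  rewrite big_nil; under eq_fun do rewrite big_nil.
  have b0 : cseq_bounded (fun=> 0) 0 by move=> n; rewrite normc0.
  rewrite (_ : (fun=> 0) = fun n : nat => 0 * 0 + 0 * 0 :> C).
    by rewrite (cpoisZD _ _ _ b0 b0) !mul0r addr0.
  by apply/funext => n; rewrite !mul0r addr0.
rewrite big_cons -ih; under eq_fun do rewrite big_cons.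
have bs : cseq_bounded (fun n => \sum_(j <- r) a j * u j n) (\sum_(j <- r) normc (a j) * M).
  move=> n; apply: le_trans (normc_sum _ _ _) _; apply: ler_sum => j _.
  by rewrite normcM ler_wpM2l ?normc_ge0 // h.
rewrite -[X in _ = _ + X]mul1r -(cpoisZD _ _ _ (h i) bs); congr cpois.
by apply/funext => n; rewrite mul1r.
Qed.

Lemma cpois0 u : cpois u 0 = u 0%N.
Proof.
have p0 (w : nat -> R) : pois w 0 = w 0%N.
  rewrite /pois oppr0 expR0 mul1r; apply: cvg_lim => //.
  rewrite -cvg_shiftS (_ : (fun n => _) = fun=> w 0%N); first exact: cvg_cst.
  apply/funext => n; rewrite /pseries /series /= big_nat_recl // big1 ?addr0.
    by rewrite /egf_coeff expr0 mulr1 divr1.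
  by move=> i _; rewrite exprS mul0r mulr0.
by rewrite /cpois !p0; case: (u 0%N).
Qed.

End ComplexPoisson.

(** [f'] is the derivative of [f] in the level, and the last clause says that the generator of the
    pair (level, state) maps f to s f. The other clauses are uniform over the unbounded range x <=
    eps, as the level may fall arbitrarily low, while eps > 0 leaves room for overshooting 0. *)
Definition level_harmonic {R : realType} {m : nat} (T : 'M[R]_m) (c : 'I_m -> R) (s : R[i])
    (eps B : R) (f f' : R -> 'I_m -> R[i]) :=
  [/\ 0 <= B /\ 0 < eps, forall x i, x <= eps -> normc (f x i) <= B,
      forall x i, x <= eps -> normc (f' x i) <= B,
      forall x k i, x <= eps -> x + k <= eps ->
        normc (f (x + k) i - f x i - k%:C * f' x i) <= B * k ^+ 2 &
      forall x i, x <= eps -> (c i)%:C * f' x i + \sum_l (T i l)%:C * f x l = s * f x i].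

Section TestFunction.
Context {R : realType} {m a : nat}.
Local Notation C := R[i].
Variables (T : 'M[R]_m) (c : 'I_m -> R) (s : C) (eps : R) (Phi : 'M[C]_(m, a)) (W : 'M[C]_a).
Hypotheses (eps0 : 0 < eps) (W1 : rbound W 1).
Hypothesis harmonic : forall i j, eps%:C * (\sum_k (T i k)%:C * Phi k j - s * Phi i j) =
  (c i)%:C * ((Phi *m W) i j - Phi i j).
Variable j : 'I_a.

Let Phin n := iter n (fun M => M *m W) Phi.

Let Phin_bounded i : cseq_bounded (fun n => Phin n i j) (tnorm Phi).
Proof.
have h n : rbound (Phin n) (tnorm Phi).
  elim: n => [|n ih]; first exact: rbound_tnorm.
  by rewrite -[tnorm _]mulr1 /=; exact: rbound_mul.
by move=> n; apply: le_trans (normc_le_rsum _ _ _) (h n i).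
Qed.

(** The hypothesis [harmonic] is a matrix identity in which [W] acts on the right, so it persists
    under right multiplication by powers of [W]. *)
Let Phin_harmonic n i k : eps%:C * (\sum_l (T i l)%:C * Phin n l k - s * Phin n i k) =
  (c i)%:C * (Phin n.+1 i k - Phin n i k).
Proof.
pose TC : 'M[C]_m := map_mx (fun x => x%:C) T.
pose D : 'M[C]_m := diag_mx (\row_l (c l)%:C).
have entry (M N : 'M[C]_(m, a)) p q : (eps%:C *: (TC *m M - s *: M) - D *m (N - M)) p q =
    eps%:C * (\sum_l (T p l)%:C * M l q - s * M p q) - (c p)%:C * (N p q - M p q).
  rewrite mul_diag_mx !mxE; congr (_ * (_ - _) - _).
  by apply: eq_bigr => l _; rewrite mxE.
have h : eps%:C *: (TC *m Phin n - s *: Phin n) - D *m (Phin n *m W - Phin n) = 0.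
  elim: n {i k} => [|n ih].
    by apply/matrixP => p q; rewrite entry [RHS]mxE; apply/eqP; rewrite subr_eq0; apply/eqP; exact: harmonic.
  rewrite [Phin n.+1]/=.
  have -> : eps%:C *: (TC *m (Phin n *m W) - s *: (Phin n *m W)) -
      D *m (Phin n *m W *m W - Phin n *m W) =
      (eps%:C *: (TC *m Phin n - s *: Phin n) - D *m (Phin n *m W - Phin n)) *m W.
    by rewrite !(mulmxBl, mulmxBr) -!scalemxAl !(mulmxBl, mulmxBr) -!scalemxAl !mulmxA.
  by rewrite ih mul0mx.
have := congr1 (fun M : 'M[C]_(m, a) => M i k) h.
by rewrite entry [RHS]mxE => /eqP; rewrite subr_eq0 => /eqP.
Qed.

(* With W = I + eps U this is the (i, j) entry of Phi e^{-Ux}: the Poisson average of Phi W^n with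
   parameter - x / eps, which also makes sense for negative parameters. *)
Definition testf (x : R) (i : 'I_m) : C := cpois (fun n => Phin n i j) (- x / eps).
Definition testf' (x : R) (i : 'I_m) : C :=
  - (eps^-1)%:C * cpois (cdseq (fun n => Phin n i j)) (- x / eps).

Lemma testf0 i : testf 0 i = Phi i j.
Proof. by rewrite /testf oppr0 mul0r cpois0. Qed.

Lemma testf_harmonic : exists B, level_harmonic T c s eps B testf testf'.
Proof.
have dom x : x <= eps -> -1 <= - x / eps.
  by move=> xe; rewrite mulNr lerN2 ler_pdivrMr // mul1r.
set M := tnorm Phi.
have M0 : 0 <= M by exact: tnorm_ge0.
have d i : cseq_bounded (cdseq (fun n => Phin n i j)) (2 * M).
  move=> n; apply: le_trans (normcD _ _) _; rewrite normcN mulr_natl mulr2n.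
  by apply: lerD; exact: Phin_bounded.
pose B0 := 8 * (M * expR 2).
have B00 : 0 <= B0 by rewrite /B0 !mulr_ge0 // expR_ge0.
have Me : 0 <= M * expR 2 by rewrite mulr_ge0 // expR_ge0.
(* The powers of 1 / eps come from the substitution y = - x / eps: the first for the derivative, the
   second for the Taylor remainder. *)
pose B := B0 + B0 / eps + B0 / eps ^+ 2.
have B1 : 0 <= B0 / eps by rewrite divr_ge0 // ltW.
have B2 : 0 <= B0 / eps ^+ 2 by rewrite divr_ge0 // sqr_ge0.
exists B; split; first by rewrite !addr_ge0.
- move=> x i /dom xe; apply: le_trans (cpois_bound (Phin_bounded i) xe) _.
  by move: B1 B2 Me; rewrite /B /B0 -/M; lra.
- move=> x i /dom xe; rewrite normcM normcN normcR gtr0_norm ?invr_gt0 //.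
  apply: le_trans (_ : eps^-1 * (2 * (2 * M * expR 2)) <= _).
    by rewrite ler_wpM2l ?invr_ge0 ?(ltW eps0) // (cpois_bound (d i)).
  apply: le_trans (_ : B0 / eps <= _); last by rewrite /B; move: B00 B2; lra.
  rewrite [leRHS]mulrC ler_wpM2l ?invr_ge0 ?(ltW eps0) // /B0.
  by move: Me; rewrite -[2 * M * _]mulrA; lra.
- move=> x k i /dom xe /dom xke.
  have e : - (x + k) / eps = - x / eps + - k / eps by rewrite -mulrDl opprD.
  rewrite e in xke; have := cpois_taylor (Phin_bounded i) xe xke.
  rewrite -e -/(testf _ _) -/(testf _ _).
  have -> : (- k / eps)%:C * cpois (cdseq (fun n => Phin n i j)) (- x / eps) = k%:C * testf' x i.
    by rewrite /testf' rmorphM rmorphN /=; ring.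
  move=> h; apply: le_trans h _; rewrite -/M -/B0.
  have -> : B0 * (- k / eps) ^+ 2 = B0 / eps ^+ 2 * k ^+ 2 by field; rewrite gt_eqF.
  rewrite ler_wpM2r ?sqr_ge0 // /B; move: B00 B1; lra.
- move=> x i /dom xe.
  have ee : eps%:C != 0 :> C by rewrite eq_complex /= eqxx andbT gt_eqF.
  have hs := cpois_sum (fun l => (T i l)%:C) (- x / eps) Phin_bounded.
  rewrite /testf /testf' -hs.
  have bs : cseq_bounded (fun n => \sum_l (T i l)%:C * Phin n l j) (\sum_l normc (T i l)%:C * M).
    move=> n; apply: le_trans (normc_sum _ _ _) _; apply: ler_sum => l _.
    by rewrite normcM ler_wpM2l ?normc_ge0 // Phin_bounded.
  have -> : (fun n => \sum_l (T i l)%:C * Phin n l j) =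
      fun n => ((c i)%:C / eps%:C) * cdseq (fun n => Phin n i j) n + s * Phin n i j.
    apply/funext => n; apply: (mulfI ee); rewrite mulrDr mulrA mulrCA divff // mulr1.
    by rewrite /cdseq -Phin_harmonic; ring.
  rewrite (cpoisZD _ _ _ (d i) (Phin_bounded i)) fmorphV; ring.
Qed.

End TestFunction.

(** * From a Riccati solution to a matrix Phi intertwining the generator with U *)

Section Harmonic.
Context {R : realType} {m : nat}.
Local Notation C := R[i].
Variables (T : 'M[R]_m) (c : 'I_m -> R) (Sp Sm S0 : {set 'I_m}) (s : C).
Hypotheses (gT : conservative_generator T) (s0 : 0 < Re s).
Hypotheses (hp : forall i, (i \in Sp) = (0 < c i)) (hm : forall i, (i \in Sm) = (c i < 0))
  (h0 : forall i, (i \in S0) = (c i == 0)).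
Variable K : 'M[C]_(#|Sm|, #|Sp|).
Hypothesis ricK : riccati (Qpp T c Sp S0 s) (Qpm T c Sp Sm S0 s) (Qmm T c Sm S0 s)
  (Qmp T c Sp Sm S0 s) K = 0.

Let part : tripartition Sp Sm S0.
Proof. exact: (tripartition_sign hp hm h0). Qed.

Let inv00 := invmx (block T S0 S0 - s%:M).
Let N := - (inv00 *m (block T S0 Sp + block T S0 Sm *m K)).
Let U := Qpp T c Sp S0 s + Qpm T c Sp Sm S0 s *m K.

Lemma glue_rows p (X : 'M[C]_(#|Sp|, p)) (Y : 'M[C]_(#|Sm|, p)) (Z : 'M[C]_(#|S0|, p)) :
  exists Phi : 'M[C]_(m, p), [/\ forall k j, Phi (enum_val k) j = X k j,
   forall k j, Phi (enum_val k) j = Y k j & forall k j, Phi (enum_val k) j = Z k j].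
Proof.
have pick (A : {set 'I_m}) (M : 'M[C]_(#|A|, p)) : exists F : 'I_m -> 'I_p -> C,
   (forall k j, F (enum_val k) j = M k j) /\ (forall i j, i \notin A -> F i j = 0).
  exists (fun i j => \sum_(k < #|A| | enum_val k == i) M k j); split.
    move=> k j; rewrite (bigD1 k) //= big1 ?addr0 // => l /andP[/eqP/enum_val_inj ->].
    by rewrite eqxx.
  move=> i j iA; apply: big1 => k /eqP e; move: iA; rewrite -e.
  by rewrite enum_valP.
have [F [F1 F2]] := pick _ X; have [G [G1 G2]] := pick _ Y; have [H [H1 H2]] := pick _ Z.
exists (\matrix_(i, j) (F i j + G i j + H i j)); split=> k j; rewrite mxE.
- have := part (enum_val k); rewrite enum_valP F1 => h.
  by rewrite G2 ?H2 ?addr0 //; move: h; case: (_ \in Sm); case: (_ \in S0).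
- have := part (enum_val k); rewrite enum_valP G1 => h.
  by rewrite F2 ?H2 ?addr0 ?add0r //; move: h; case: (_ \in Sp); case: (_ \in S0).
- have := part (enum_val k); rewrite enum_valP H1 => h.
  by rewrite F2 ?G2 ?addr0 ?add0r //; move: h; case: (_ \in Sp); case: (_ \in Sm).
Qed.

(** On S_+ the last relation is the definition of [U]. On S_- it is the Riccati equation read as K U
    = - (Q-+ + Q-- K), the sign matching |c| = - c. On S_0 the right-hand side vanishes and the
    relation determines [N]. *)
Lemma harmonic_extension : exists Phi : 'M[C]_(m, #|Sp|),
  [/\ forall k j, Phi (enum_val k) j = (k == j)%:R,
      forall k j, Phi (enum_val k) j = K k j &
      forall i j, \sum_k (T i k)%:C * Phi k j - s * Phi i j = (c i)%:C * (Phi *m U) i j].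
Proof.
have [Phi [P1 P2 P3]] := glue_rows 1%:M K N.
exists Phi; split => // [k j|i j]; first by rewrite P1 mxE.
have TPhi (A : {set 'I_m}) (k : 'I_#|A|) : \sum_l (T (enum_val k) l)%:C * Phi l j =
    (block T A Sp + block T A Sm *m K + block T A S0 *m N) k j.
  rewrite (sum_tripartition _ part) [RHS]mxE [X in _ = X + _]mxE.
  congr (_ + _ + _).
  - rewrite -[block T A Sp]mulmx1 [RHS]mxE; apply: eq_bigr => l _.
    by rewrite P1 [X in _ = X * _]mxE.
  - by rewrite [RHS]mxE; apply: eq_bigr => l _; rewrite P2 [X in _ = X * _]mxE.
  - by rewrite [RHS]mxE; apply: eq_bigr => l _; rewrite P3 [X in _ = X * _]mxE.
have rowPhi (A : {set 'I_m}) (M : 'M[C]_(#|A|, #|Sp|)) (k : 'I_#|A|) :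
    (forall l, Phi (enum_val k) l = M k l) -> (Phi *m U) (enum_val k) j = (M *m U) k j.
  by move=> h; rewrite !mxE; apply: eq_bigr => l _; rewrite h.
have viaN (A : {set 'I_m}) : block T A S0 *m N =
    - (block T A S0 *m inv00 *m block T S0 Sp) - block T A S0 *m inv00 *m block T S0 Sm *m K.
  by rewrite /N mulmxN !mulmxDr opprD !mulmxA.
have nz x : x != 0 -> x%:C != 0 :> C by move=> x0; rewrite eq_complex /= eqxx andbT.
have := part i; case ip: (i \in Sp); [move=> _|case im: (i \in Sm); [move=> _|move=> iz]].
- have [k ->] : exists k : 'I_#|Sp|, i = enum_val k.
    by exists (enum_rank_in ip i); rewrite enum_rankK_in.
  rewrite TPhi (rowPhi _ 1%:M) ?mul1mx // P1.
  have ci : c (enum_val k) != 0 by rewrite gt_eqF // -hp enum_valP.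
  have -> : U = invmx (diag_mx (\row_l (c (enum_val l))%:C)) *m
     (block T Sp Sp + block T Sp Sm *m K + block T Sp S0 *m N - s%:M).
    rewrite viaN /U /Qpp /Qpm -[X in _ + X]mulmxA -mulmxDr mulmxBl; congr (_ *m _).
    by mxring.
  rewrite invmx_diag_mul; last first.
    by move=> l; rewrite mxE nz // gt_eqF // -hp enum_valP.
  rewrite [in RHS](_ : (\row_l (c (enum_val l))%:C) 0 k = (c (enum_val k))%:C); last by rewrite mxE.
  rewrite mulVKf ?nz //.
  by rewrite [RHS]mxE [X in _ = _ + X]mxE !mxE mulr_natr.
- have [k ->] : exists k : 'I_#|Sm|, i = enum_val k.
    by exists (enum_rank_in im i); rewrite enum_rankK_in.
  rewrite TPhi (rowPhi _ K) // P2.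
  have ci : c (enum_val k) < 0 by rewrite -hm enum_valP.
  have -> : K *m U = - (invmx (diag_mx (\row_l `|c (enum_val l)|%:C)) *m
     (block T Sm Sp + block T Sm Sm *m K + block T Sm S0 *m N - s *: K)).
    move: ricK; rewrite /riccati -addrA => /eqP; rewrite -/U.
    rewrite (_ : K *m Qpp T c Sp S0 s + K *m Qpm T c Sp Sm S0 s *m K = K *m U); last first.
      by rewrite /U mulmxDr; congr (_ + _); rewrite -mulmxA.
    rewrite addrC addr_eq0 => /eqP ->; congr (- _).
    rewrite viaN /Qmp /Qmm -[X in _ + X]mulmxA -mulmxDr !mulmxBl mul_scalar_mx; congr (_ *m _).
    by mxring.
  rewrite [X in _ = _ * X]mxE invmx_diag_mul; last first.
    by move=> l; rewrite mxE nz // normr_eq0 lt_eqF // -hm enum_valP.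
  rewrite [in RHS](_ : (\row_l `|c (enum_val l)|%:C) 0 k = - (c (enum_val k))%:C); last first.
    by rewrite mxE ltr0_norm // rmorphN.
  rewrite invrN mulNr opprK mulVKf ?nz ?lt_eqF //.
  by rewrite [RHS]mxE [X in _ = _ + X]mxE [X in _ = _ - X]mxE.
- have iz' : i \in S0 by move: iz; case: (i \in S0).
  have [k ->] : exists k : 'I_#|S0|, i = enum_val k.
    by exists (enum_rank_in iz' i); rewrite enum_rankK_in.
  have ci : c (enum_val k) = 0 by apply/eqP; rewrite -h0 enum_valP.
  rewrite ci mul0r TPhi P3.
  have uz : block T S0 S0 - s%:M \in unitmx by exact: T00_unit part _.
  have e : block T S0 Sp + block T S0 Sm *m K + block T S0 S0 *m N - s *: N = 0.
    by rewrite -mul_scalar_mx -addrA -mulmxBl /N mulmxN mulKVmx // subrr.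
  have := congr1 (fun M : 'M[C]_(#|S0|, #|Sp|) => M k j) e.
  rewrite [RHS]mxE => <-.
  by rewrite [RHS]mxE [X in _ = _ + X]mxE [X in _ = _ - X]mxE.
Qed.

End Harmonic.

(** * Sample paths *)

Section Alive.
Context {R : realType}.

(* x has stayed below -b from index k0 on; the first k0 steps let the level, which starts at 0,
   get below -b.  The index is fresh when x has just left that region. *)
Fixpoint alive (x : nat -> R) (b : R) (k0 k : nat) : bool :=
  ((k0 <= k)%N ==> (x k <= - b)) && (if k is k'.+1 then alive x b k0 k' else true).

Definition fresh x b k0 k := ~~ alive x b k0 k && (if k is k'.+1 then alive x b k0 k' else true).

Lemma aliveP x b k0 k :
  reflect (forall l, (k0 <= l <= k)%N -> x l <= - b) (alive x b k0 k).
Proof.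
apply: (iffP idP).
  elim: k => [|k ih] /= /andP[h1 h2] l /andP[l1 l2].
    by move: l2 h1; rewrite leqn0 => /eqP <-; rewrite l1.
  by move: l2; rewrite leq_eqVlt => /orP[/eqP e|]; [move: h1; rewrite -e l1|rewrite ltnS => lk; apply: ih => //; rewrite l1].
elim: k => [|k ih] h /=.
  by rewrite andbT; apply/implyP => k00; apply: h; rewrite k00 leqnn.
rewrite ih ?andbT; last by move=> l /andP[l1 l2]; apply: h; rewrite l1 ltnW.
by apply/implyP => h0; apply: h; rewrite h0 leqnn.
Qed.

Lemma alive_le x b k0 k l : (l <= k)%N -> alive x b k0 k -> alive x b k0 l.
Proof.
move=> lk /aliveP h; apply/aliveP => p /andP[p1 p2]; apply: h.
by rewrite p1 (leq_trans p2).
Qed.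

Lemma fresh_uniq x b k0 r k : fresh x b k0 r -> fresh x b k0 k = (k == r).
Proof.
move=> fr; apply/idP/eqP => [fk|-> //].
apply/eqP; rewrite eqn_leq; apply/andP; split; rewrite leqNgt; apply/negP.
  case: k fk => [//|k] /andP[_ a1]; rewrite ltnS => rk.
  by move: fr => /andP[/negP]; rewrite (alive_le rk a1).
case: r fr => [//|r] /andP[_ a1]; rewrite ltnS => kr.
by move: fk => /andP[/negP]; rewrite (alive_le kr a1).
Qed.

Lemma fresh_exists x b k0 k : ~~ alive x b k0 k ->
  exists2 r, (r <= k)%N & fresh x b k0 r.
Proof.
elim: k => [|k ih] h; first by exists 0%N => //; rewrite /fresh h.
case a: (alive x b k0 k); first by exists k.+1 => //; rewrite /fresh h a.
by have [r rk fr] := ih (negbT a); exists r => //; rewrite (leq_trans rk).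
Qed.

Lemma freshP x b k0 r : fresh x b k0 r -> (k0 <= r)%N /\ - b < x r.
Proof.
move=> /andP[na a]; have : ~~ ((k0 <= r)%N ==> (x r <= - b)).
  by apply: contra na => h; case: r a h => [|r] a h /=; rewrite h // a.
by rewrite negb_imply -ltNge => /andP[].
Qed.

End Alive.

(** * The level along a single path, and its Euler approximation *)

Section StepPath.
Context {R : realType} {m : nat}.
Variables (psi : R -> 'I_m) (c : 'I_m -> R).
Hypothesis right_cont : forall t, 0 <= t -> \forall u \near t^'+, psi u = psi t.
Hypothesis left_lim : forall t, 0 < t -> exists i, \forall u \near t^'-, psi u = i.
Local Notation mu := (@lebesgue_measure R).

Let g u : R := c (psi u).
(** A Lipschitz constant of the level; the summand 1 makes it a legitimate divisor. *)
Definition speed : R := 1 + \sum_i `|c i|.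
Local Notation Cb := speed.

Lemma speed_gt0 : 0 < Cb.
Proof. by rewrite ltr_pwDl // sumr_ge0. Qed.

Lemma le_speed i : `|c i| <= Cb.
Proof.
rewrite /speed (bigD1 i) //= addrCA lerDl addr_ge0 //; exact: sumr_ge0.
Qed.

Lemma right_interval t : 0 <= t -> exists2 e, 0 < e & forall u, t <= u < t + e -> psi u = psi t.
Proof.
move=> t0; have /nbhs_ballP[e /= e0 he] := right_cont t0.
exists e => // u /andP[]; rewrite le_eqVlt => /orP[/eqP -> //|tu] ut.
by apply: he => //=; rewrite /ball /= ltr0_norm ?subr_lt0 // opprB ltrBlDl.
Qed.

Lemma left_interval t : 0 < t ->
  exists i, exists2 e, 0 < e & forall u, t - e < u < t -> psi u = i.
Proof.
move=> t0; have [i /nbhs_ballP[e /= e0 he]] := left_lim t0.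
exists i, e => // u /andP[tu ut].
by apply: he => //=; rewrite /ball /= gtr0_norm ?subr_gt0 // ltrBlDl -ltrBlDr.
Qed.

Definition lvl (t : R) : R := \int[mu]_(u in `[0, t]) g u.
(** Rates are read at the right end of each step, so that a jump of the sampled chain to j moves the
    level from x to x + h c_j. *)
Definition euler (h : R) (k : nat) : R := \sum_(l < k) h * g (l.+1%:R * h).

Lemma eulerS h k : euler h k.+1 = euler h k + h * g (k.+1%:R * h).
Proof. by rewrite /euler big_ord_recr. Qed.

Lemma lvl0 : lvl 0 = 0.
Proof. by rewrite /lvl set_itv1 Rintegral_set1. Qed.

Lemma integrable_g (b : R) : measurable_fun `[0, b] g -> mu.-integrable `[0, b] (EFin \o g).
Proof.
move=> mg; apply: measurable_bounded_integrable => //.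
  by rewrite /= lebesgue_measure_itv /=; case: ifP => // _; rewrite -EFinD ltry.
exists Cb; split; first by rewrite num_real.
by move=> x xC y /= _; apply: le_trans (le_speed _) (ltW xC).
Qed.

Let lvlB (a b : R) : measurable_fun `[0, b] g -> 0 <= a -> a <= b ->
  lvl b - lvl a = \int[mu]_(u in `]a, b]) g u.
Proof.
move=> mg a0 ab; rewrite /lvl; apply: Rintegral_itvB; first exact: integrable_g.
  by rewrite bnd_simp.
by rewrite bnd_simp.
Qed.

Lemma lvl_lip (b s t : R) : measurable_fun `[0, b] g -> 0 <= s -> s <= t -> t <= b ->
  `|lvl t - lvl s| <= Cb * (t - s).
Proof.
move=> mg s0 st tb.
have mt : measurable_fun `[0, t] g.
  by apply: measurable_funS mg => //; apply: subset_itvl; rewrite bnd_simp.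
rewrite (lvlB mt s0 st).
have ig : mu.-integrable `]s, t] (EFin \o g).
  apply: integrableS (integrable_g mt) => //.
  by apply: subset_itvr; rewrite bnd_simp.
apply: le_trans (le_normr_Rintegral _ ig) _ => //.
have ic : mu.-integrable `]s, t] (EFin \o (fun=> Cb : R)).
  apply: measurable_bounded_integrable => //.
    by rewrite /= lebesgue_measure_itv /=; case: ifP => // _; rewrite -EFinD ltry.
  exists Cb; split; first by rewrite num_real.
  by move=> x xC y /= _; rewrite gtr0_norm ?speed_gt0 // ltW.
apply: le_trans (le_Rintegral _ _ ic _) _ => //.
- by apply: integrable_norm ig.
- by move=> x _; exact: le_speed.
rewrite Rintegral_cst //= lebesgue_measure_itv /= lte_fin.
case: ifP => [_|]; first by rewrite -EFinD.
by move=> /negbT; rewrite -leNgt => ts; rewrite (_ : s = t) ?subrr //; apply/eqP; rewrite eq_le st.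
Qed.

Lemma lvl_const j (b s t : R) : measurable_fun `[0, b] g -> 0 <= s -> s <= t -> t <= b ->
  (forall u, s < u < t -> psi u = j) -> lvl t - lvl s = c j * (t - s).
Proof.
move=> mg s0 st tb hj.
have mt : measurable_fun `[0, t] g.
  by apply: measurable_funS mg => //; apply: subset_itvl; rewrite bnd_simp.
rewrite (lvlB mt s0 st).
have ig : mu.-integrable `]s, t[ (EFin \o g).
  apply: integrableS (integrable_g mt) => //.
  by apply: subset_itv; rewrite bnd_simp.
rewrite -(Rintegral_itv_bndo_bndc ig).
rewrite (@eq_Rintegral _ _ _ _ _ (fun=> c j)); last first.
  by move=> u; rewrite inE /= in_itv /= => /hj; rewrite /g => ->.
rewrite Rintegral_cst //= lebesgue_measure_itv /= lte_fin.
case: ifP => [_|]; first by rewrite -EFinD.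
move=> /negbT; rewrite -leNgt => ts; rewrite (_ : s = t) ?subrr ?mulr0 //.
by apply/eqP; rewrite eq_le st.
Qed.

Definition good (b : R) := measurable_fun `[0, b] g /\
  exists2 D, 0 <= D & forall h k, 0 < h -> k%:R * h <= b -> `|euler h k - lvl (k%:R * h)| <= D * h.

Lemma good0 : good 0.
Proof.
split; first by rewrite set_itv1; exact: measurable_fun_set1.
exists 0 => // h [|k] h0 kh.
  by rewrite mul0r lvl0 /euler big_ord0 subrr normr0.
by move: kh; rewrite leNgt mulr_gt0.
Qed.

(** A step starting at or after [a] and ending before [b] leaves the Euler error unchanged. Only the
    step across [a] and the step reaching [b], where the path may take another state, add to it, by
    at most 2 Cb h each. *)
Lemma good_extend j (a b : R) : 0 <= a -> a <= b -> (forall u, a < u < b -> psi u = j) -> good a -> good b.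
Proof.
move=> a0 ab hj [mg [D D0 hD]].
have mb : measurable_fun `[0, b] g.
  move: ab; rewrite le_eqVlt => /orP[/eqP <- //|ab].
  apply/(measurable_fun_itv_bndo_bndcP (BLeft 0)).
  have -> : [set` `[0, b[] = `[0, a] `|` `]a, b[ :> set R.
    by rewrite -itv_bndbnd_setU // bnd_simp.
  apply/measurable_funU => //; split=> //.
  apply: (@eq_measurable_fun _ _ _ _ _ (fun=> c j)).
    by move=> u; rewrite inE /= in_itv /= => /hj; rewrite /g => ->.
  exact: measurable_cst.
split=> //; exists (D + 4 * Cb); first by rewrite addr_ge0 // mulr_ge0 // ltW // speed_gt0.
move=> h k h0 kb.
pose e k := euler h k - lvl (k%:R * h).
have step l : l.+1%:R * h <= b -> `|e l.+1 - e l| <= 2 * Cb * h.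
  move=> lb; have -> : e l.+1 - e l = h * g (l.+1%:R * h) - (lvl (l.+1%:R * h) - lvl (l%:R * h)).
    by rewrite /e eulerS; ring.
  apply: le_trans (ler_normB _ _) _; rewrite (_ : 2 * Cb * h = Cb * h + Cb * h); last by ring.
  apply: lerD.
    by rewrite normrM gtr0_norm // mulrC (ler_wpM2r (ltW h0)) // le_speed.
  apply: le_trans (lvl_lip mb _ _ lb) _; first by rewrite mulr_ge0 // ltW.
    by rewrite (ler_wpM2r (ltW h0)) // ler_nat.
  by rewrite -mulrBl -natrB // subSnn mul1r.
have flat l : a <= l%:R * h -> l.+1%:R * h < b -> e l.+1 = e l.
  move=> al lb; apply/eqP; rewrite -subr_eq0; apply/eqP.
  have -> : e l.+1 - e l = h * g (l.+1%:R * h) - (lvl (l.+1%:R * h) - lvl (l%:R * h)).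
    by rewrite /e eulerS; ring.
  have lS : l%:R * h < l.+1%:R * h by rewrite ltr_pM2r // ltr_nat.
  rewrite (lvl_const (j := j) mb _ _ (ltW lb)) ?(ltW lS) ?(le_trans a0) //; last first.
    by move=> u /andP[u1 u2]; apply: hj; rewrite (le_lt_trans al u1) (lt_trans u2 lb).
  by rewrite /g hj ?(le_lt_trans al lS) // -mulrBl -natrB // subSnn mul1r mulrC subrr.
have Ch : 0 <= Cb * h by apply: mulr_ge0; [exact: ltW speed_gt0|exact: ltW].
have claim l : (l%:R * h < b -> `|e l| <= (D + 2 * Cb) * h) /\ (l%:R * h <= a -> `|e l| <= D * h).
  split; last by move=> la; exact: hD.
  elim: l => [|l ih] lb.
    by rewrite /e mul0r lvl0 /euler big_ord0 subrr normr0; apply: mulr_ge0 (ltW h0); move: D0 speed_gt0; lra.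
  case: (leP a (l%:R * h)) => al.
    rewrite flat // ih //; apply: lt_trans lb; rewrite ltr_pM2r // ltr_nat //.
  have e1 := step l (ltW lb); have e2 := hD h l h0 (ltW al).
  rewrite -(subrK (e l) (e l.+1)); apply: le_trans (ler_normD _ _) _.
  by move: e1 e2; rewrite -/(e l); lra.
case: (ltP (k%:R * h) b) => kb'.
  apply: le_trans ((claim k).1 kb') _; rewrite (ler_wpM2r (ltW h0)) //.
  by have := speed_gt0; lra.
case: k kb kb' => [|l] kb kb'.
  by rewrite mul0r lvl0 /euler big_ord0 subrr normr0; apply: mulr_ge0 (ltW h0); move: D0 speed_gt0; lra.
have lb : l%:R * h < b.
  by apply: lt_le_trans kb; rewrite ltr_pM2r // ltr_nat.
have e1 := step l kb; have e2 := (claim l).1 lb.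
rewrite -/(e l.+1) -(subrK (e l) (e l.+1)); apply: le_trans (ler_normD _ _) _.
by move: e1 e2; lra.
Qed.

Lemma good_all (N : R) : 0 <= N -> good N.
Proof.
move=> N0.
(* Real induction, which avoids counting jumps: the left limit at the supremum z shows that z itself
   is good, and right continuity leads beyond z. *)
pose S := [set t | 0 <= t <= N /\ good t].
have S0 : S 0 by split; [rewrite lexx|exact: good0].
have hS : has_sup S by split; [exists 0|exists N => t [/andP[]]].
set z := sup S.
have z0 : 0 <= z by apply: ub_le_sup S0; case: hS.
have zN : z <= N by apply: ge_sup; [exists 0|move=> t [/andP[]]].
have gz : good z.
  move: z0; rewrite le_eqVlt => /orP[/eqP <-|z0]; first exact: good0.
  have [i [e e0 he]] := left_interval z0.
  have [t [/andP[t0 tN] gt] zt] := sup_adherent e0 hS.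
  have tz : t <= z by apply: ub_le_sup; [case: hS|split => //; rewrite t0].
  apply: (good_extend (j := i) t0 tz) gt => u /andP[tu uz]; apply: he.
  by rewrite uz andbT; apply: lt_trans tu.
case: (ltP z N) => [zN'|Nz]; last by rewrite (_ : N = z) //; apply/eqP; rewrite eq_le zN Nz.
have [e e0 he] := right_interval z0.
pose b := Order.min (z + e) N.
have zb : z < b by rewrite lt_min zN' andbT ltrDl.
have gb : good b.
  apply: (good_extend (j := psi z) z0 (ltW zb)) gz => u /andP[zu ub]; apply: he.
  by rewrite ltW //=; apply: lt_le_trans ub _; rewrite ge_min lexx.
have Sb : S b.
  by split=> //; rewrite (le_trans z0 (ltW zb)) /b ge_min lexx orbT.
by have := ub_le_sup (proj2 hS) Sb; rewrite -/z leNgt zb.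
Qed.

Lemma level_lip s t : 0 <= s -> s <= t -> `|lvl t - lvl s| <= speed * (t - s).
Proof.
move=> s0 st; have [mg _] := good_all (le_trans s0 st).
exact: (lvl_lip mg s0 st (lexx t)).
Qed.

Lemma level_const j s t : 0 <= s -> s <= t ->
  (forall u, s < u < t -> psi u = j) -> lvl t - lvl s = c j * (t - s).
Proof.
move=> s0 st h; have [mg _] := good_all (le_trans s0 st).
exact: (lvl_const mg s0 st (lexx t)).
Qed.

Lemma euler_error N : 0 <= N -> exists2 D, 0 <= D &
  forall h k, 0 < h -> k%:R * h <= N -> `|euler h k - lvl (k%:R * h)| <= D * h.
Proof. by move=> N0; have [_] := good_all N0. Qed.

Variable i : 'I_m.
Hypotheses (psi0 : psi 0 = i) (ci : c i < 0).

Lemma level_start : exists2 e, 0 < e & forall t, 0 <= t <= e -> lvl t = c i * t.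
Proof.
have [e e0 he] := right_interval (lexx 0).
exists e => // t /andP[t0 te].
have := @level_const i 0 t (lexx 0) t0; rewrite lvl0 !subr0; apply.
move=> u /andP[u0 ut]; rewrite -psi0; apply: he.
by rewrite ltW //= add0r (lt_le_trans ut).
Qed.

Definition zero_set := [set t : R | 0 < t /\ lvl t = 0].
Definition hit := ereal_inf [set t%:E | t in zero_set].

(** The infimum is taken over the times of nonnegative level instead of the zeros: negativity before
    it is then immediate, [level_start] makes it positive, and the Lipschitz bound makes the level
    vanish there. *)
Lemma hit_cases : (hit = +oo%E /\ forall t, 0 < t -> lvl t < 0) \/
  exists z, [/\ 0 < z, hit = z%:E, lvl z = 0 & forall t, 0 < t < z -> lvl t < 0].
Proof.
pose S := [set t : R | 0 < t /\ 0 <= lvl t].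
have [S0|S0] := pselect (S !=set0); last first.
  have neg t : 0 < t -> lvl t < 0.
    by move=> t0; rewrite ltNge; apply/negP => lt0; apply: S0; exists t.
  left; split=> //; rewrite /hit (_ : zero_set = set0) ?image_set0 ?ereal_inf0 //.
  apply/seteqP; split=> // t [t0 lt0]; apply: S0; exists t; split=> //.
  by rewrite lt0.
right.
have [e e0 he] := level_start.
have lbS : lbound S e.
  move=> t [t0 lt0]; rewrite leNgt; apply/negP => te; move: lt0.
  by rewrite he ?(ltW t0) ?(ltW te) // leNgt nmulr_rlt0 // t0.
have hS : has_inf S by split => //; exists e.
pose z := inf S.
have ez : e <= z by exact: lb_le_inf.
have z0 : 0 < z by exact: lt_le_trans ez.
have below t : 0 < t < z -> lvl t < 0.
  move=> /andP[t0 tz]; rewrite ltNge; apply/negP => lt0.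
  by have := ge_inf (proj2 hS) (conj t0 lt0 : S t); rewrite -/z leNgt tz.
have lz0 : lvl z = 0.
  apply/eqP; rewrite eq_le; apply/andP; split; apply/ler_addgt0Pl => eta eta0.
    pose d := Order.min (z / 2) (eta / speed).
    have d0 : 0 < d by rewrite lt_min !divr_gt0 // speed_gt0.
    have dz : d < z by rewrite gt_min; apply/orP; left; rewrite ltr_pdivrMr // ltr_pMr // ltr1n.
    have zd0 : 0 < z - d by rewrite subr_gt0.
    have l1 := level_lip (ltW zd0) (_ : z - d <= z); rewrite gerBl in l1.
    have {}l1 := l1 (ltW d0).
    have l2 : lvl (z - d) < 0 by apply: below; rewrite zd0 gtrBl.
    have l3 : speed * d <= eta.
      by rewrite mulrC -ler_pdivlMr ?speed_gt0 // ge_min lexx orbT.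
    move: l1; rewrite ler_norml => /andP[_]; rewrite subKr; move: l2 l3; lra.
  have d0 : 0 < eta / speed by rewrite divr_gt0 // speed_gt0.
  have [t [t0 lt0] tz] := inf_adherent d0 hS.
  have zt : z <= t by apply: ge_inf; [exact: (proj2 hS)|split].
  have := level_lip (ltW z0) zt.
  have l3 : speed * (t - z) <= eta.
    by rewrite mulrC -ler_pdivlMr ?speed_gt0 // lerBlDl ltW.
  rewrite ler_norml => /andP[l1 l2]; move: l1 l2 l3 lt0; lra.
exists z; split=> //; apply/eqP; rewrite eq_le; apply/andP; split.
  by apply: ereal_inf_lbound; exists z.
apply: le_ereal_inf_tmp => _ [t [t0 lt0] <-]; rewrite lee_fin.
by apply: ge_inf; [exact: (proj2 hS)|split => //; rewrite lt0].
Qed.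

Lemma level_max (a M : R) : 0 <= a -> a <= M ->
  exists2 t, a <= t <= M & forall u, a <= u <= M -> lvl u <= lvl t.
Proof.
move=> a0 aM; have M0 := le_trans a0 aM.
have cont : {within `[0, M], continuous lvl}.
  apply: (@parameterized_integral_continuous _ 0 M (fun u => c (psi u)) M0).
  have [mg _] := good_all M0; exact: integrable_g.
have cont' : {within `[a, M], continuous lvl}.
  apply: continuous_subspaceW cont => u /=; rewrite !in_itv /= => /andP[au ->].
  by rewrite (le_trans a0 au).
have [t] := EVT_max aM cont'; rewrite in_itv /= => tI ht; exists t => // u uI.
Qed.

Variable L : nat.
Hypothesis hL : 2 <= L%:R * `|c i|.

(** After [k0] steps the elapsed time is L b, by which [hL] has brought the level down to -2 b or
    below. Later, on [a, M], the level stays below its negative maximum. Both margins exceed the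
    Euler error D b^2 for small b. *)
Lemma alive_until M : 0 < M -> (forall t, 0 < t <= M -> lvl t < 0) ->
  exists2 beta, 0 < beta & forall b k0, 0 < b < beta -> k0%:R * b ^+ 2 = L%:R * b ->
    forall k, k%:R * b ^+ 2 <= M -> alive (euler (b ^+ 2)) b k0 k.
Proof.
move=> M0 neg.
have [e e0 he] := level_start.
have [D D0 hD] := euler_error (ltW M0).
pose a := Order.min e M.
have a0 : 0 < a by rewrite lt_min e0.
have aM : a <= M by rewrite ge_min lexx orbT.
have [t tI ht] := level_max (ltW a0) aM.
pose eta := - lvl t.
have eta0 : 0 < eta.
  by case/andP: tI => t1 t2; rewrite oppr_gt0 neg // t2 (lt_le_trans a0 t1).
(* The bound by eta / (1 + D) yields b + D b^2 < eta for the times after [a]; the bound by 1 / (1 +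
   D) yields D b^2 <= b for the times before. *)
exists (Order.min 1 (Order.min (eta / (1 + D)) (1 + D)^-1)).
  by rewrite !lt_min ltr01 divr_gt0 ?invr_gt0 //; move: D0; lra.
move=> b k0 /andP[b0]; rewrite !lt_min => /and3P[b1 b2 b3] hk0 k kM.
have D1 : 0 < 1 + D by move: D0; lra.
have h0 : 0 < b ^+ 2 by rewrite exprn_gt0.
have {}b2 : (1 + D) * b < eta by rewrite mulrC -ltr_pdivlMr.
have {}b3 : (1 + D) * b < 1 by rewrite mulrC -ltr_pdivlMr // div1r.
have hb : b ^+ 2 <= b by rewrite expr2 -[leRHS]mulr1 ler_pM2l // ltW.
have Dh : D * b ^+ 2 <= D * b by rewrite ler_wpM2l.
apply/aliveP => l /andP[kl lk].
have lM : l%:R * b ^+ 2 <= M.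
  by apply: le_trans kM; rewrite ler_wpM2r ?(ltW h0) // ler_nat.
have := hD _ _ h0 lM; rewrite ler_norml => /andP[_ err].
have hl : L%:R * b <= l%:R * b ^+ 2.
  by rewrite -hk0 ler_wpM2r ?(ltW h0) // ler_nat.
have L0 : 0 < L%:R :> R.
  rewrite lt_neqAle ler0n andbT eq_sym; apply: contraTneq hL => ->.
  by rewrite mul0r -ltNge ltr0n.
have lh0 : 0 < l%:R * b ^+ 2 by apply: lt_le_trans hl; rewrite mulr_gt0.
case: (leP a (l%:R * b ^+ 2)) => al.
  have := ht _ (_ : a <= l%:R * b ^+ 2 <= M); rewrite al lM => /(_ isT) lt1.
  by move: err lt1 b2 Dh; rewrite /eta; lra.
have lv : lvl (l%:R * b ^+ 2) = c i * (l%:R * b ^+ 2).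
  by apply: he; rewrite ltW //= ltW // (lt_le_trans al) // ge_min lexx.
have : c i * (l%:R * b ^+ 2) <= - (2 * b).
  rewrite (_ : c i = - `|c i|) ?mulNr ?lerN2; last by rewrite ltr0_norm // opprK.
  apply: le_trans (ler_wpM2l (normr_ge0 _) hl).
  by rewrite mulrA ler_wpM2r ?(ltW b0) // mulrC.
have Db : D * b ^+ 2 <= b.
  rewrite expr2 mulrA -[leRHS]mul1r ler_wpM2r ?(ltW b0) //.
  by move: b3 b0; lra.
by move: err Db; rewrite lv; lra.
Qed.

Lemma fresh_before_hit z : 0 < z -> lvl z = 0 -> (forall t, 0 < t < z -> lvl t < 0) ->
  exists2 D, 0 <= D & forall eta, 0 < eta ->
  exists2 beta, 0 < beta & forall b k0, 0 < b < beta -> k0%:R * b ^+ 2 = L%:R * b ->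
    exists r, [/\ fresh (euler (b ^+ 2)) b k0 r, z - eta < r%:R * b ^+ 2, r%:R * b ^+ 2 < z &
      `|euler (b ^+ 2) r| <= (1 + D) * b].
Proof.
move=> z0 lz neg.
have [D D0 hD] := euler_error (ltW z0).
exists D => // eta eta0.
pose M := Order.max (z / 2) (z - eta).
have M0 : 0 < M by rewrite lt_max divr_gt0.
have Mz : M < z by rewrite gt_max ltr_pdivrMr // ltr_pMr // ltr1n /= gtrBl.
have [|beta beta0 hbeta] := alive_until M0.
  by move=> t /andP[t0 tM]; apply: neg; rewrite t0 (le_lt_trans tM).
pose S := 1 + speed + D.
have S0 : 0 < S by rewrite /S; have := speed_gt0; move: D0; lra.
(* [S^-1] gives (speed + D) b^2 < b, which ends survival; z / (L + 1) places the time L b and one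
   further step before z, so that k0 <= k. *)
exists (Order.min 1 (Order.min beta (Order.min S^-1 (z / (L%:R + 1))))).
  by rewrite !lt_min ltr01 beta0 invr_gt0 S0 divr_gt0 // ltr_wpDl.
move=> b k0 /andP[b0]; rewrite !lt_min => /and4P[b1 b2 b3 b4] hk0.
have h0 : 0 < b ^+ 2 by rewrite exprn_gt0.
have {}b3 : S * b < 1 by rewrite mulrC -ltr_pdivlMr // div1r.
have {}b4 : (L%:R + 1) * b < z by rewrite mulrC -ltr_pdivlMr // ltr_wpDl.
have hb : b ^+ 2 <= b by rewrite expr2 -[leRHS]mulr1 ler_pM2l // ltW.
have [k kz zk] : exists2 k : nat, k%:R * b ^+ 2 < z & z <= k.+1%:R * b ^+ 2.
  have ex : exists n : nat, z <= n%:R * b ^+ 2.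
    exists (Num.truncn (z / b ^+ 2)).+1; rewrite -ler_pdivrMr //.
    exact: ltW (truncnS_gt _).
  case: (ex_minnP ex) => -[|n] zn mn.
    by move: zn; rewrite mul0r leNgt z0.
  exists n => //; rewrite ltNge; apply/negP => /mn; by rewrite ltnn.
have k0k : (k0 <= k)%N.
  rewrite -(ler_nat R) -(ler_pM2r h0) hk0.
  have : z <= k%:R * b ^+ 2 + b ^+ 2 by rewrite -[X in _ + X]mul1r -mulrDl -natr1 in zk *.
  by move: b4 hb; lra.
have k1 : 0 <= k%:R * b ^+ 2 by rewrite mulr_ge0 // ltW.
have na : ~~ alive (euler (b ^+ 2)) b k0 k.
  apply/negP => /aliveP/(_ k); rewrite k0k leqnn => /(_ isT).
  have := hD _ k h0 (ltW kz); rewrite ler_norml => /andP[e1 _].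
  have := level_lip k1 (ltW kz); rewrite lz ler_norml => /andP[_ e2].
  have e3 : z - k%:R * b ^+ 2 <= b ^+ 2.
    by move: zk; rewrite -natr1 mulrDl mul1r; lra.
  have := ler_wpM2l (ltW speed_gt0) e3 => e4 e5.
  have e6 : (speed + D) * b ^+ 2 < b.
    rewrite expr2 mulrA -[ltRHS]mul1r ltr_pM2r //.
    by apply: le_lt_trans b3; rewrite ler_wpM2r ?(ltW b0) // /S; lra.
  by move: e1 e2 e4 e5 e6; lra.
have [r rk fr] := fresh_exists na.
have rz : r%:R * b ^+ 2 < z.
  by apply: le_lt_trans kz; rewrite ler_wpM2r ?(ltW h0) // ler_nat.
have Mr : M < r%:R * b ^+ 2.
  rewrite ltNge; apply/negP => rM; case/andP: fr => /negP + _; apply.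
  by apply: hbeta => //; rewrite b0.
exists r; split=> //.
  by apply: le_lt_trans Mr; rewrite le_max lexx orbT.
have [_ xr] := freshP fr.
have r0 : 0 < r%:R * b ^+ 2 by apply: lt_trans Mr.
have lr : lvl (r%:R * b ^+ 2) < 0 by apply: neg; rewrite r0.
have := hD _ r h0 (ltW rz); rewrite ler_norml => /andP[_ e1].
have e2 : D * b ^+ 2 <= D * b by rewrite ler_wpM2l.
have e3 : 0 <= D * b by rewrite mulr_ge0 // ltW.
rewrite ler_norml; apply/andP; split; first by move: xr e3; lra.
by move: e1 lr e2 b0; lra.
Qed.

(** The level reaches 0 from strictly negative values at the constant rate c j. Hence only the
    values of the test function at states of S_+ matter at the passage. *)
Lemma up_before_hit z j e : 0 < z -> lvl z = 0 -> (forall t, 0 < t < z -> lvl t < 0) ->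
  0 < e -> (forall u, z - e < u < z -> psi u = j) -> 0 < c j.
Proof.
move=> z0 lz neg e0 hj.
pose t := Order.max (z / 2) (z - e).
have t0 : 0 < t by rewrite lt_max divr_gt0.
have tz : t < z by rewrite gt_max ltr_pdivrMr // ltr_pMr // ltr1n /= gtrBl.
have : lvl z - lvl t = c j * (z - t).
  apply: level_const; [exact: ltW|exact: ltW|] => u /andP[tu uz]; apply: hj.
  by rewrite uz andbT; apply: le_lt_trans tu; rewrite le_max lexx orbT.
rewrite lz sub0r => e1.
have : 0 < c j * (z - t) by rewrite -e1 oppr_gt0 neg // t0.
by rewrite pmulr_lgt0 // subr_gt0.
Qed.

End StepPath.

(** * Expectations along the sampled chain *)

Section BoundedIntegral.
Context {R : realType} {d : measure_display} {Omega : measurableType d}.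
Variables (P : probability Omega R) (A : set Omega).
Hypothesis mA : measurable A.
Implicit Types Z W : Omega -> R.

Definition nice Z := measurable_fun A Z /\ exists M, forall w, A w -> `|Z w| <= M.
Definition expect Z : R := \int[P]_(w in A) Z w.

Lemma nice_integrable Z : nice Z -> P.-integrable A (EFin \o Z).
Proof.
move=> [mZ [M hM]]; apply: measurable_bounded_integrable => //.
  by apply: le_lt_trans (probability_le1 P mA) _; rewrite ltry.
exists M; split; first by rewrite num_real.
by move=> x Mx w /= Aw; apply: le_trans (hM w Aw) (ltW Mx).
Qed.

Lemma nice_cst (a : R) : nice (fun=> a).
Proof. by split; [exact: measurable_cst|exists `|a|]. Qed.

Lemma niceD Z W : nice Z -> nice W -> nice (fun w => Z w + W w).
Proof.
move=> [mZ [M hM]] [mW [N hN]]; split; first exact: measurable_funD.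
by exists (M + N) => w Aw; apply: le_trans (ler_normD _ _) _; rewrite lerD ?hM ?hN.
Qed.

Lemma niceM Z W : nice Z -> nice W -> nice (fun w => Z w * W w).
Proof.
move=> [mZ [M hM]] [mW [N hN]]; split; first exact: measurable_funM.
by exists (M * N) => w Aw; rewrite normrM ler_pM ?hM ?hN.
Qed.

Lemma niceZ a Z : nice Z -> nice (fun w => a * Z w).
Proof. by move=> hZ; apply: niceM => //; exact: nice_cst. Qed.

Lemma niceB Z W : nice Z -> nice W -> nice (fun w => Z w - W w).
Proof.
move=> hZ hW; have := niceD hZ (niceZ (-1) hW).
by rewrite (_ : (fun w => _ + _) = fun w => Z w - W w) //; apply/funext => w; rewrite mulN1r.
Qed.

Lemma nice_sum (I : Type) (r : seq I) (Q : pred I) (F : I -> Omega -> R) :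
  (forall i, nice (F i)) -> nice (fun w => \sum_(i <- r | Q i) F i w).
Proof.
move=> h; elim: r => [|i r ih]; first by under eq_fun do rewrite big_nil; exact: nice_cst.
by under eq_fun do rewrite big_cons; case: (Q i) => //; exact: niceD.
Qed.

Lemma nice_ind (B : set Omega) : measurable B -> nice (\1_B).
Proof.
move=> mB; split; first exact: measurable_indic.
by exists 1 => w _; rewrite indicE; case: (_ \in _); rewrite ?normr1 ?normr0.
Qed.

Lemma expect_cst0 : expect (fun=> 0) = 0.
Proof. by rewrite /expect Rintegral_cst // mul0r. Qed.

Lemma expectD Z W : nice Z -> nice W -> expect (fun w => Z w + W w) = expect Z + expect W.
Proof. by move=> hZ hW; rewrite /expect RintegralD //; exact: nice_integrable. Qed.

Lemma expectZ a Z : nice Z -> expect (fun w => a * Z w) = a * expect Z.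
Proof. by move=> hZ; rewrite /expect RintegralZl //; exact: nice_integrable. Qed.

Lemma expectB Z W : nice Z -> nice W -> expect (fun w => Z w - W w) = expect Z - expect W.
Proof. by move=> hZ hW; rewrite /expect RintegralB //; exact: nice_integrable. Qed.

Lemma expect_sum (I : Type) (r : seq I) (Q : pred I) (F : I -> Omega -> R) :
  (forall i, nice (F i)) ->
  expect (fun w => \sum_(i <- r | Q i) F i w) = \sum_(i <- r | Q i) expect (F i).
Proof.
move=> h; elim: r => [|i r ih].
  by under eq_fun do rewrite big_nil; rewrite big_nil expect_cst0.
under eq_fun do rewrite big_cons; rewrite big_cons.
by case: (Q i) => //; rewrite expectD ?ih //; exact: nice_sum.
Qed.

Lemma expect_le Z W : nice Z -> nice W -> (forall w, A w -> Z w <= W w) -> expect Z <= expect W.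
Proof. by move=> hZ hW h; apply: le_Rintegral => //; exact: nice_integrable. Qed.

Lemma expect_norm Z W : nice Z -> nice W -> (forall w, A w -> `|Z w| <= W w) ->
  `|expect Z| <= expect W.
Proof.
move=> hZ hW h; rewrite ler_norml -mulN1r -expectZ //; apply/andP; split.
  apply: expect_le => //; first exact: niceZ.
  by move=> w Aw; have := h w Aw; rewrite ler_norml mulN1r => /andP[].
by apply: expect_le => // w Aw; apply: le_trans (h w Aw); exact: ler_norm.
Qed.

Lemma expect_cst (a : R) : expect (fun=> a) = a * fine (P A).
Proof. by rewrite /expect Rintegral_cst. Qed.

Lemma fine_PA : 0 <= fine (P A) <= 1.
Proof.
rewrite fine_ge0 //=.
have := probability_le1 P mA; have := fin_num_measure P A mA.
by case: (P A) => [r| |] //= _; rewrite lee_fin.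
Qed.

Lemma expect_bound Z a : nice Z -> 0 <= a -> (forall w, A w -> `|Z w| <= a) -> `|expect Z| <= a.
Proof.
move=> hZ a0 h; apply: le_trans (expect_norm hZ (nice_cst a) h) _.
by rewrite expect_cst -[leRHS]mulr1 ler_wpM2l //; case/andP: fine_PA.
Qed.

Lemma eq_expect Z W : (forall w, A w -> Z w = W w) -> expect Z = expect W.
Proof. by move=> h; apply: eq_Rintegral => w; rewrite inE => /h. Qed.

Lemma expect_ind (B : set Omega) : measurable B -> expect \1_B = fine (P (A `&` B)).
Proof.
by move=> mB; rewrite /expect /Rintegral integral_indic // setIC.
Qed.

(** Measurability of the limit is part of the conclusion; it is applied below to limits defined path
    by path. *)
Lemma bounded_convergence (Zn : nat -> Omega -> R) Z M :
  (forall n, measurable_fun A (Zn n)) -> (forall n w, A w -> `|Zn n w| <= M) ->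
  (forall w, A w -> Zn n w @[n --> \oo] --> Z w) ->
  nice Z /\ expect (Zn n) @[n --> \oo] --> expect Z.
Proof.
move=> mZn bZn cZ.
have mZ : measurable_fun A Z by exact: measurable_fun_cvg cZ.
have bZ w : A w -> `|Z w| <= M.
  move=> Aw; have c : `|Zn n w| @[n --> \oo] --> `|Z w| by apply: cvg_norm; exact: cZ.
  rewrite -(cvg_lim _ c) //; apply: limr_le; first by apply/cvg_ex; eexists; exact: c.
  by near=> n; exact: bZn.
have nZ : nice Z by split => //; exists M.
split=> //.
have nZn n : nice (Zn n) by split => //; exists M => w; exact: bZn.
have mE (Y : Omega -> R) : nice Y -> measurable_fun A (EFin \o Y).
  by move=> nY; exact: (measurable_int P (nice_integrable nY)).
have [|||_ _ h] := @dominated_convergence _ _ _ P A mA (fun n => EFin \o Zn n) (EFin \o Z)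
  (fun=> M%:E) (fun n => mE _ (nZn n)) (mE _ nZ).
- by apply: aeW => w Aw; apply/cvg_EFin; [exact: nearW|exact: cZ].
- exact: (nice_integrable (nice_cst M)).
- by apply: aeW => w n Aw; rewrite /= lee_fin; exact: bZn.
apply: fine_cvg; rewrite fineK; first exact: h.
exact: (integrable_fin_num mA (nice_integrable nZ)).
Unshelve. all: by end_near. Qed.

End BoundedIntegral.

(** * The Markov property for functions of the sampled history *)

Section Markov.
Context {R : realType} {m : nat} {d : measure_display} {Omega : measurableType d}.
Variables (P : probability Omega R) (T : 'M[R]_m) (phi : R -> Omega -> 'I_m) (p : R -> 'M[R]_m).
Hypothesis phi_meas : forall t i, 0 <= t -> measurable [set w | phi t w = i].
Hypothesis markov : forall t h (A : set Omega) i j, 0 <= t -> 0 <= h -> past phi t A ->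
  P (A `&` [set w | phi t w = i] `&` [set w | phi (t + h) w = j]) =
  (P (A `&` [set w | phi t w = i]) * (p h i j)%:E)%E.
Variable h : R.
Hypothesis h0 : 0 < h.
Variable i0 : 'I_m.
Let A := [set w | phi 0 w = i0].

Definition hist (w : Omega) (l : nat) : 'I_m := phi (l%:R * h) w.
Definition adapted {V} (k : nat) (F : (nat -> 'I_m) -> V) :=
  forall x y, (forall l, (l <= k)%N -> x l = y l) -> F x = F y.

Let time_ge0 k : 0 <= k%:R * h. Proof. by rewrite mulr_ge0 // ltW. Qed.

Let mA : measurable A. Proof. exact: phi_meas. Qed.

Definition cyl (k : nat) (x : nat -> 'I_m) := [set w | forall l, (l <= k)%N -> hist w l = x l].

Let cyl0 x : cyl 0 x = [set w | phi 0 w = x 0%N].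
Proof.
apply/seteqP; split=> w /= hw.
  by have := hw 0%N (leqnn _); rewrite /hist mul0r.
by move=> l; rewrite leqn0 => /eqP ->; rewrite /hist mul0r.
Qed.

Let cylS k x : cyl k.+1 x = cyl k x `&` [set w | phi (k.+1%:R * h) w = x k.+1].
Proof.
apply/seteqP; split=> w /= hw.
  by split; [move=> l lk; apply: hw; exact: leqW|exact: (hw k.+1)].
by case: hw => h1 h2 l; rewrite leq_eqVlt => /orP[/eqP -> //|]; rewrite ltnS; exact: h1.
Qed.

Lemma measurable_cyl k x : measurable (cyl k x).
Proof.
elim: k => [|k ih]; first by rewrite cyl0; exact: phi_meas.
by rewrite cylS; apply: measurableI => //; exact: phi_meas.
Qed.

Lemma past_cyl k x : past phi (k%:R * h) (A `&` cyl k x).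
Proof.
pose G := [set B : set Omega | exists u i, [/\ 0 <= u, u <= k%:R * h & B = [set w | phi u w = i]]].
have gen u i : 0 <= u -> u <= k%:R * h -> past phi (k%:R * h) [set w | phi u w = i].
  by move=> u0 uk; apply: sub_sigma_algebra; exists u, i.
have pI B B' : past phi (k%:R * h) B -> past phi (k%:R * h) B' -> past phi (k%:R * h) (B `&` B').
  exact: (@measurableI _ (g_sigma_algebraType G)).
have pc l : (l <= k)%N -> past phi (k%:R * h) (cyl l x).
  elim: l => [|l ih] lk; first by rewrite cyl0; exact: gen.
  rewrite cylS; apply: pI; first exact: ih (ltnW lk).
  by apply: gen => //; rewrite ler_wpM2r ?(ltW h0) // ler_nat.
by apply: pI; [exact: gen|exact: pc].
Qed.

(** Indices above k fall back to 0 through [inord]; an adapted function does not see them. *)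
Definition ext k (f : {ffun 'I_k.+1 -> 'I_m}) (l : nat) : 'I_m := f (inord l).

(** The state space is finite, so a function of finitely many samples is a finite combination of
    indicators of cylinders. This reduces measurability and the Markov property to events. *)
Lemma hist_decomp k (F : (nat -> 'I_m) -> R) w : adapted k F ->
  F (hist w) = \sum_(f : {ffun 'I_k.+1 -> 'I_m}) F (ext f) * \1_(cyl k (ext f)) w.
Proof.
move=> aF; pose f0 : {ffun 'I_k.+1 -> 'I_m} := [ffun l : 'I_k.+1 => hist w l].
have e0 l : (l <= k)%N -> hist w l = ext f0 l.
  by move=> lk; rewrite /ext ffunE inordK.
rewrite (bigD1 f0) //= big1 ?addr0.
  rewrite indicE mem_set ?mulr1 //; exact: aF.
move=> f ff0; rewrite indicE memNset ?mulr0 // => hw; move/eqP: ff0; apply.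
apply/ffunP => l; have lk : (l <= k)%N by rewrite -ltnS.
by rewrite ffunE hw // /ext inord_val.
Qed.

Lemma nice_adapted k (F : (nat -> 'I_m) -> R) : adapted k F -> nice A (fun w => F (hist w)).
Proof.
move=> aF; rewrite (_ : (fun w => _) =
  fun w => \sum_(f : {ffun 'I_k.+1 -> 'I_m}) F (ext f) * \1_(cyl k (ext f)) w).
  apply: nice_sum => f; apply: niceZ; apply: nice_ind; exact: measurable_cyl.
by apply/funext => w; exact: hist_decomp.
Qed.

Lemma nice_state t j : 0 <= t -> nice A (fun w => (phi t w == j)%:R : R).
Proof.
move=> t0; rewrite (_ : (fun w => _) = \1_[set w | phi t w = j]).
  by apply: nice_ind; exact: phi_meas.
apply/funext => w; rewrite indicE; congr (_%:R); congr nat_of_bool.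
by apply/idP/idP; rewrite inE => /eqP.
Qed.

Lemma expect_markov k (F : (nat -> 'I_m) -> R) delta j : adapted k F -> 0 <= delta ->
  expect P A (fun w => F (hist w) * (phi (k%:R * h + delta) w == j)%:R) =
  expect P A (fun w => F (hist w) * p delta (hist w k) j).
Proof.
move=> aF d0.
have ind w : (phi (k%:R * h + delta) w == j)%:R = \1_[set w | phi (k%:R * h + delta) w = j] w :> R.
  by rewrite indicE; congr (_%:R); congr nat_of_bool; apply/idP/idP; rewrite inE => /eqP.
have mB : measurable [set w | phi (k%:R * h + delta) w = j] by apply: phi_meas; rewrite addr_ge0.
have mC f := measurable_cyl k (@ext k f).
have mI (f : {ffun 'I_k.+1 -> 'I_m}) :
    measurable (cyl k (ext f) `&` [set w | phi (k%:R * h + delta) w = j]) by exact: measurableI.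
have -> : expect P A (fun w => F (hist w) * (phi (k%:R * h + delta) w == j)%:R) =
    \sum_(f : {ffun 'I_k.+1 -> 'I_m}) F (ext f) *
    expect P A (\1_(cyl k (ext f) `&` [set w | phi (k%:R * h + delta) w = j])).
  rewrite (@eq_expect _ _ _ _ _ _ (fun w => \sum_(f : {ffun 'I_k.+1 -> 'I_m}) F (ext f) *
      \1_(cyl k (ext f) `&` [set w | phi (k%:R * h + delta) w = j]) w)); last first.
    move=> w _; rewrite (hist_decomp w aF) mulr_suml.
    by apply: eq_bigr => f _; rewrite indicI ind -mulrA.
  rewrite expect_sum //; last by move=> f; apply: niceZ; exact: nice_ind.
  by apply: eq_bigr => f _; rewrite expectZ //; exact: nice_ind.
have aG : adapted k (fun x => F x * p delta (x k) j).
  by move=> x y xy; rewrite (aF x y) // xy.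
rewrite (@eq_expect _ _ _ _ _ _ (fun w => \sum_(f : {ffun 'I_k.+1 -> 'I_m})
    (F (ext f) * p delta (ext f k) j) * \1_(cyl k (ext f)) w)); last first.
  by move=> w _; exact: (hist_decomp w aG).
rewrite expect_sum //; last by move=> f; apply: niceZ; apply: nice_ind.
apply: eq_bigr => f _; rewrite expectZ //; last exact: nice_ind.
rewrite -mulrA; congr (_ * _); rewrite (expect_ind P mA (mI f)) (expect_ind P mA (mC f)).
(* The cylinder already fixes the state at time k h, which puts the event in the form of
   [markov]. *)
have e1 : A `&` cyl k (ext f) = A `&` cyl k (ext f) `&` [set w | phi (k%:R * h) w = ext f k].
  apply/seteqP; split=> w /=; last by case.
  by move=> [aw hw]; split => //; exact: (hw k).
rewrite setIA {1}e1 markov // -?e1; last exact: past_cyl.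
have fineMr (x : \bar R) r : x \is a fin_num -> fine (x * r%:E)%E = r * fine x.
  by case: x => // x _; rewrite -EFinM mulrC.
apply: fineMr; apply: fin_num_measure; exact: measurableI.
Qed.

End Markov.

(** * A discrete Dynkin formula, for a real-linear functional q of norm at most 1 such as Re or
    Im *)

Section Dynkin.
Context {R : realType} {m : nat} {d : measure_display} {Omega : measurableType d}.
Local Notation C := R[i].
Variables (P : probability Omega R) (phi : R -> Omega -> 'I_m) (p : R -> 'M[R]_m).
Hypothesis phi_meas : forall t i, 0 <= t -> measurable [set w | phi t w = i].
Hypothesis markov : forall t h (A : set Omega) i j, 0 <= t -> 0 <= h -> past phi t A ->
  P (A `&` [set w | phi t w = i] `&` [set w | phi (t + h) w = j]) =
  (P (A `&` [set w | phi t w = i]) * (p h i j)%:E)%E.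
Hypothesis p_ge0 : forall t i j, 0 <= t -> 0 <= p t i j.
Hypothesis p_sum1 : forall t i, 0 <= t -> \sum_j p t i j = 1.
Variables (h b : R) (k0 : nat) (c : 'I_m -> R).
Hypotheses (h0 : 0 < h) (b0 : 0 < b).
Variable i0 : 'I_m.
Let A := [set w | phi 0 w = i0].
Let mA : measurable A. Proof. exact: phi_meas. Qed.

Variable q : C -> R.
Hypothesis qD : forall x y, q (x + y) = q x + q y.
Hypothesis qR : forall (r : R) x, q (r%:C * x) = r * q x.
Hypothesis qn : forall x, `|q x| <= normc x.

Let q0 : q 0 = 0.
Proof. by have := qR 0 0; rewrite mulr0 mul0r. Qed.

Let qN x : q (- x) = - q x.
Proof. by apply/eqP; rewrite -addr_eq0 -qD addNr q0. Qed.

Let q_sum (I : Type) (r : seq I) (Q : pred I) (F : I -> C) :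
  q (\sum_(i <- r | Q i) F i) = \sum_(i <- r | Q i) q (F i).
Proof. by elim/big_rec2: _ => [|i y x _ <-]; rewrite ?q0 ?qD. Qed.

Definition hlevel (x : nat -> 'I_m) (k : nat) : R := \sum_(l < k) h * c (x l.+1).
Definition halive x k := alive (hlevel x) b k0 k.
Definition hfresh x k := fresh (hlevel x) b k0 k.

Lemma hlevelS x k : hlevel x k.+1 = hlevel x k + h * c (x k.+1).
Proof. by rewrite /hlevel big_ord_recr. Qed.

Lemma hlevel_adapted k : adapted k (fun x : nat -> 'I_m => hlevel x k).
Proof. by move=> x y xy; apply: eq_bigr => l _; rewrite xy. Qed.

Lemma halive_adapted k : adapted k (fun x => halive x k).
Proof.
elim: k => [|k ih] x y xy; rewrite /halive /= (@hlevel_adapted _ x y) //.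
by congr (_ && _); apply: ih => l lk; apply: xy; exact: leqW.
Qed.

Lemma hfresh_adapted k : adapted k (fun x => hfresh x k).
Proof.
move=> x y xy; rewrite /hfresh /fresh -!/(halive _ _) (halive_adapted xy); congr (_ && _).
case: k xy => [//|k] xy; rewrite -!/(halive _ _).
by apply: halive_adapted => l lk; apply: xy; exact: leqW.
Qed.

Lemma freshS (V : comNzRingType) x k :
  (hfresh x k.+1)%:R + (halive x k.+1)%:R = (halive x k)%:R :> V.
Proof.
rewrite /hfresh /fresh -/(halive x k.+1) -/(halive x k).
case e: (halive x k.+1) => /=; last by rewrite addr0.
have -> : halive x k by exact: alive_le (leqnSn k) e.
by rewrite add0r.
Qed.

(** At most one index is fresh, so the sum is v at the fresh index if that is at most K, and 0
    otherwise. Then [stopped] is v at the smaller of the fresh index and K. *)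
Definition stopped_sum (v : nat -> C) (x : nat -> 'I_m) K : C :=
  \sum_(k < K.+1) (hfresh x k)%:R * v k.
Definition stopped (v : nat -> C) x K : C := stopped_sum v x K + (halive x K)%:R * v K.

Lemma stoppedS v x K : stopped v x K.+1 = stopped v x K + (halive x K)%:R * (v K.+1 - v K).
Proof.
rewrite /stopped /stopped_sum big_ord_recr /= -addrA -mulrDl freshS; ring.
Qed.

Lemma stopped0 v x : stopped v x 0 = v 0%N.
Proof.
rewrite /stopped /stopped_sum big_ord1 /= -mulrDl /hfresh /fresh -/(halive x 0) andbT.
by case: (halive x 0); rewrite /= ?add0r ?addr0 mul1r.
Qed.

Variables (f : R -> 'I_m -> C) (rho : C) (eta xmax B : R).
Hypothesis rho1 : normc rho < 1.
Hypothesis eta0 : 0 <= eta.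
Hypothesis xmax_ge : k0%:R * (h * speed c) <= xmax.
Hypothesis onestep : forall x i, x <= xmax ->
  normc (rho * \sum_j (p h i j)%:C * f (x + h * c j) j - f x i) <= h * eta.

Definition hvalue (x : nat -> 'I_m) k : C := rho ^+ k * f (hlevel x k) (x k).

Lemma hlevel_le x k : hlevel x k <= k%:R * (h * speed c).
Proof.
elim: k => [|k ih]; first by rewrite /hlevel big_ord0 mul0r.
rewrite hlevelS -natr1 mulrDl mul1r lerD // ler_wpM2l ?(ltW h0) //.
by apply: le_trans (ler_norm _) _; exact: le_speed.
Qed.

Let xmax0 : 0 <= xmax.
Proof. by apply: le_trans xmax_ge; rewrite !mulr_ge0 ?(ltW h0) ?(ltW (speed_gt0 c)). Qed.

Lemma halive_le x k : halive x k -> hlevel x k <= xmax.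
Proof.
move=> ha; case: (leqP k0 k) => kk.
  have /aliveP/(_ k) := ha; rewrite kk leqnn => /(_ isT) e.
  by apply: le_trans e _; apply: le_trans xmax0; rewrite oppr_le0 ltW.
apply: le_trans (hlevel_le x k) _; apply: le_trans xmax_ge.
rewrite ler_wpM2r // ?ler_nat ?(ltnW kk) //.
by rewrite mulr_ge0 ?(ltW h0) ?(ltW (speed_gt0 c)).
Qed.

Let H w := hist phi h w.

Let bR (a : bool) : (a%:R : C) = (a%:R : R)%:C. Proof. by case: a. Qed.

Lemma hvalue_adapted k : adapted k (fun x => hvalue x k).
Proof. by move=> x y xy; rewrite /hvalue (hlevel_adapted xy) xy. Qed.

Lemma stopped_adapted K : adapted K (fun x => stopped (hvalue x) x K).
Proof.
move=> x y xy; rewrite /stopped /stopped_sum (halive_adapted xy) (hvalue_adapted xy); congr (_ + _).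
apply: eq_bigr => k _; have xyk l : (l <= k)%N -> x l = y l.
  by move=> lk; apply: xy; apply: leq_trans lk _; rewrite -ltnS.
by rewrite (hfresh_adapted xyk) (hvalue_adapted xyk).
Qed.

Let nice_q k (F : (nat -> 'I_m) -> C) : adapted k F -> nice A (fun w => q (F (H w))).
Proof.
move=> aF; apply: (@nice_adapted _ _ _ _ _ phi_meas _ h0 i0 k (fun x => q (F x))).
by move=> x y xy; rewrite (aF x y).
Qed.

Local Notation EV K := (expect P A (fun w => q (stopped (hvalue (H w)) (H w) K))).

(** By [stoppedS] the increment is nonzero only while alive, and it depends on the first K samples
    and the next state. The Markov property averages out that state, leaving the one-step defect,
    which [onestep] bounds because alive levels are at most [xmax]. *)
Lemma dynkin_step K :
  `|EV K.+1 -
    EV K| <= normc rho ^+ K * (h * eta).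
Proof.
have n1 := nice_q (@stopped_adapted K.+1); have n0 := nice_q (@stopped_adapted K).
rewrite -expectB //.
pose F j (x : nat -> 'I_m) : R := q ((halive x K)%:R * (rho ^+ K.+1 * f (hlevel x K + h * c j) j)).
have aF j : adapted K (F j).
  by move=> x y xy; rewrite /F (halive_adapted xy) (hlevel_adapted xy).
pose G (x : nat -> 'I_m) : R := q ((halive x K)%:R * hvalue x K).
have aG : adapted K G.
  by move=> x y xy; rewrite /G (halive_adapted xy) (hvalue_adapted xy).
have time : K.+1%:R * h = K%:R * h + h by rewrite -natr1 mulrDl mul1r.
have Kh0 : 0 <= K%:R * h + h by rewrite -time mulr_ge0 // ltW.
have nF j := nice_adapted phi_meas h0 i0 (aF j).
have nG := nice_adapted phi_meas h0 i0 aG.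
have nFp j : nice A (fun w => F j (H w) * p h (H w K) j).
  apply: (@nice_adapted _ _ _ _ _ phi_meas _ h0 i0 K (fun x => F j x * p h (x K) j)).
  by move=> x y xy; rewrite (aF j x y) // xy.
have nFi j : nice A (fun w => F j (H w) * (phi (K%:R * h + h) w == j)%:R).
  by apply: niceM => //; exact: nice_state.
rewrite (@eq_expect _ _ _ _ _ _ (fun w => \sum_j F j (H w) * (phi (K%:R * h + h) w == j)%:R - G (H w))); last first.
  move=> w _; rewrite stoppedS qD addrAC subrr add0r mulrBr qD qN; congr (_ - _).
  rewrite (bigD1 (H w K.+1)) //= big1 ?addr0.
    by rewrite -time eqxx mulr1 /F /hvalue hlevelS.
  move=> j jH; rewrite -time (_ : _ == j = false) ?mulr0 //.
  by apply/negbTE; rewrite eq_sym; exact: jH.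
rewrite expectB //; last exact: nice_sum.
rewrite expect_sum //.
rewrite (eq_bigr (fun j => expect P A (fun w => F j (H w) * p h (H w K) j))); last first.
  move=> j _; exact: (@expect_markov _ _ _ _ _ _ _ phi_meas markov _ h0 i0 K (F j) h j (aF j) (ltW h0)).
rewrite -expect_sum // -expectB //; last exact: nice_sum.
apply: expect_bound => //.
- by apply: niceB => //; exact: nice_sum.
- by rewrite !mulr_ge0 ?exprn_ge0 ?normc_ge0 // ltW.
move=> w _; rewrite (_ : _ - _ = q ((halive (H w) K)%:R * (rho ^+ K * (rho *
    \sum_j (p h (H w K) j)%:C * f (hlevel (H w) K + h * c j) j - f (hlevel (H w) K) (H w K))))); last first.
  rewrite mulrBr mulrBr qD qN -/(hvalue _ _) -/(G _); congr (_ - _).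
  rewrite !mulr_sumr q_sum; apply: eq_bigr => j _.
  rewrite /F [RHS](_ : _ = q ((p h (H w K) j)%:C * ((halive (H w) K)%:R *
     (rho ^+ K.+1 * f (hlevel (H w) K + h * c j) j)))); first by rewrite qR mulrC.
  by congr q; rewrite exprS; ring.
apply: le_trans (qn _) _; rewrite normcM.
case ha: (halive (H w) K); last first.
  by rewrite normc0 mul0r !mulr_ge0 ?exprn_ge0 ?normc_ge0 // ltW.
rewrite normc1 mul1r normcM.
have -> : normc (rho ^+ K) = normc rho ^+ K.
  by elim: (K) => [|n ih]; rewrite ?expr0 ?normc1 // !exprS normcM ih.
by rewrite ler_wpM2l ?exprn_ge0 ?normc_ge0 // onestep // halive_le.
Qed.

Lemma dynkin K :
  `|EV K - q (f 0 i0) * fine (P A)| <=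
  h * eta / (1 - normc rho).
Proof.
have r0 : 0 < 1 - normc rho by rewrite subr_gt0.
have base : EV 0 = q (f 0 i0) * fine (P A).
  rewrite -expect_cst //; apply: eq_expect => w Aw.
  rewrite stopped0 /hvalue expr0 mul1r /hlevel big_ord0; congr (q (f 0 _)).
  by rewrite /H /hist mul0r.
have h1 : `|EV K - q (f 0 i0) * fine (P A)| <=
    h * eta * \sum_(k < K) normc rho ^+ k.
  elim: K => [|K ih]; first by rewrite base subrr normr0 big_ord0 mulr0.
  rewrite big_ord_recr /= mulrDr.
  rewrite -(subrK (EV K)
    (EV K.+1)) -addrA addrC.
  apply: le_trans (ler_normD _ _) _; apply: lerD => //.
  by rewrite [h * eta * _]mulrC; exact: dynkin_step.
apply: le_trans h1 _; rewrite ler_wpM2l ?mulr_ge0 ?(ltW h0) //.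
rewrite -[leRHS]mul1r ler_pdivlMr // mulrC.
have -> : (1 - normc rho) * (\sum_(k < K) normc rho ^+ k) = 1 - normc rho ^+ K.
  by rewrite -[1 - normc rho]opprB mulNr -subrX1 opprB.
by rewrite gerBl exprn_ge0 // normc_ge0.
Qed.

Lemma q_stopped_sum (a : nat -> bool) x K :
  q (stopped_sum (fun k => rho ^+ k * (a k)%:R) x K) =
  \sum_(k < K.+1) q ((hfresh x k)%:R * rho ^+ k) * (a k)%:R.
Proof.
rewrite /stopped_sum q_sum; apply: eq_bigr => k _.
by rewrite [(a k)%:R in LHS]bR mulrA [X in q X]mulrC qR mulrC.
Qed.

Let normc_rhoX n : normc (rho ^+ n) <= 1.
Proof.
elim: n => [|n ih]; first by rewrite expr0 normc1.
by rewrite exprS normcM mulr_ile1 ?normc_ge0 // ltW.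
Qed.

Lemma nice_stopped_sum K delta j : 0 <= delta ->
  nice A (fun w => q (stopped_sum (fun k => rho ^+ k * (phi (k%:R * h + delta) w == j)%:R) (H w) K)).
Proof.
move=> d0; under eq_fun do rewrite q_stopped_sum.
apply: nice_sum => k; apply: niceM.
  by apply: (@nice_q k (fun x => (hfresh x k)%:R * rho ^+ k)) => x y xy; rewrite (hfresh_adapted xy).
by apply: nice_state => //; rewrite addr_ge0 // mulr_ge0 // ltW.
Qed.

Lemma sum_fresh_le1 x K : \sum_(k < K.+1) (hfresh x k)%:R <= 1 :> R.
Proof.
have e : \sum_(k < K.+1) (hfresh x k)%:R + (halive x K)%:R = 1 :> R.
  elim: K => [|K ih].
    by rewrite big_ord1 /hfresh /fresh -/(halive x 0) andbT; case: (halive x 0); rewrite /= ?add0r ?addr0.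
  by rewrite big_ord_recr /= -addrA freshS.
by rewrite -[leRHS]e lerDl.
Qed.

(** The two sums differ only if the chain, a time [delta] after the fresh index, is in another
    state; given the history this has probability at most [kappa]. As at most one index is fresh,
    the bound does not involve h, b or K. *)
Lemma lag_bound K delta j kappa : 0 <= delta -> (forall i, 1 - p delta i i <= kappa) ->
  `|expect P A (fun w => q (stopped_sum (fun k => rho ^+ k * (phi (k%:R * h + delta) w == j)%:R) (H w) K)) -
    expect P A (fun w => q (stopped_sum (fun k => rho ^+ k * (H w k == j)%:R) (H w) K))| <= kappa.
Proof.
move=> d0 hk.
have kappa0 : 0 <= kappa.
  apply: le_trans (hk i0); rewrite subr_ge0 -(p_sum1 i0 d0) (bigD1 i0) //= lerDl.
  by apply: sumr_ge0 => k _; exact: p_ge0.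
have time0 k : 0 <= k%:R * h + delta by rewrite addr_ge0 // mulr_ge0 // ltW.
pose F k i (x : nat -> 'I_m) : R := (hfresh x k && (x k == i))%:R.
have aF k i : adapted k (F k i).
  by move=> x y xy; rewrite /F (hfresh_adapted xy) xy.
pose Y k i w : R := F k i (H w) * (1 - (phi (k%:R * h + delta) w == i)%:R).
have nF k i : nice A (fun w => F k i (H w)).
  exact: (nice_adapted phi_meas h0 i0 (aF k i)).
have nY k i : nice A (Y k i).
  by apply: niceM => //; apply: niceB; [exact: nice_cst|exact: nice_state].
have n1 := nice_stopped_sum K j d0.
have n2 : nice A (fun w => q (stopped_sum (fun k => rho ^+ k * (H w k == j)%:R) (H w) K)).
  apply: (@nice_q K (fun x => stopped_sum (fun k => rho ^+ k * (x k == j)%:R) x K)) => x y xy.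
  apply: eq_bigr => k _; have xyk l : (l <= k)%N -> x l = y l.
    by move=> lk; apply: xy; apply: leq_trans lk _; rewrite -ltnS.
  by rewrite (hfresh_adapted xyk) xyk.
rewrite -expectB //.
have nYs : nice A (fun w => \sum_(k < K.+1) \sum_i Y k i w).
  by apply: nice_sum => k; apply: nice_sum => i.
apply: (@le_trans _ _ (expect P A (fun w => \sum_(k < K.+1) \sum_i Y k i w))).
  apply: expect_norm => //; first exact: niceB.
  move=> w _; rewrite (q_stopped_sum (fun k => phi (k%:R * h + delta) w == j)).
  rewrite (q_stopped_sum (fun k => H w k == j)) -sumrB.
  apply: le_trans (ler_norm_sum _ _ _) _; apply: ler_sum => k _.
  rewrite (bigD1 (H w k)) //= big1 ?addr0; last first.
    by move=> i iH; rewrite /Y /F [_ == i]eq_sym (negPf iH) andbF mul0r.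
  rewrite -mulrBr normrM /Y /F eqxx andbT.
  case hf: (hfresh (H w) k); last by rewrite mul0r q0 normr0 mul0r mul0r.
  rewrite !mul1r; apply: (@le_trans _ _ (1 * `|(phi (k%:R * h + delta) w == j)%:R - (H w k == j)%:R|)).
    by rewrite ler_wpM2r // (le_trans (qn _)).
  rewrite mul1r; case: (eqVneq (phi (k%:R * h + delta) w) j) => [e1|e1]; case: (eqVneq (H w k) j) => [e2|e2].
  - by rewrite subrr normr0 e1 e2 eqxx subrr.
  - by rewrite e1 eq_sym (negPf e2) !subr0 normr1.
  - by rewrite e2 (negPf e1) sub0r normrN normr1 subr0.
  - by rewrite subrr normr0 subr_ge0; case: (_ == _).
rewrite expect_sum //; last by move=> k; exact: nice_sum.
apply: (@le_trans _ _ (\sum_(k < K.+1) \sum_i kappa * expect P A (fun w => F k i (H w)))).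
  apply: ler_sum => k _; rewrite expect_sum //; apply: ler_sum => i _.
  have aFc : adapted k (fun x => F k i x * p delta (x k) i).
    by move=> x y xy; rewrite (aF k i x y) // xy.
  have nFp := nice_adapted phi_meas h0 i0 aFc.
  have nFi : nice A (fun w => F k i (H w) * (phi (k%:R * h + delta) w == i)%:R).
    by apply: niceM => //; exact: nice_state.
  rewrite (@eq_expect _ _ _ _ _ _ (fun w => F k i (H w) - F k i (H w) * (phi (k%:R * h + delta) w == i)%:R)); last first.
    by move=> w _; rewrite /Y mulrBr mulr1.
  rewrite expectB // (@expect_markov _ _ _ _ _ _ _ phi_meas markov _ h0 i0 k (F k i) delta i (aF k i) d0).
  rewrite -expectB // -expectZ //; apply: expect_le => //; [exact: niceB|exact: niceZ|].
  move=> w _; rewrite /F /=.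
  case: (eqVneq (H w k) i) => [e|_]; last by rewrite andbF !mul0r subr0 mulr0.
  rewrite -/(H w) e.
  by rewrite andbT; case: (hfresh _ _); rewrite ?mul0r ?mul1r ?mulr0 ?mulr1 ?subr0.
rewrite (eq_bigr (fun k : 'I_K.+1 => kappa * expect P A (fun w => \sum_i F k i (H w)))); last first.
  by move=> k _; rewrite -mulr_sumr expect_sum.
rewrite -mulr_sumr -expect_sum; last by move=> k; exact: nice_sum.
rewrite -[leRHS]mulr1 ler_wpM2l //; apply: le_trans (ler_norm _) _.
apply: expect_bound => //; first by apply: nice_sum => k; exact: nice_sum.
move=> w _; rewrite ger0_norm; last by apply: sumr_ge0 => k _; apply: sumr_ge0 => i _; rewrite /F ler0n.
apply: le_trans (sum_fresh_le1 (H w) K); apply: ler_sum => k _.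
rewrite (bigD1 (H w k)) //= big1 ?addr0 /F ?eqxx ?andbT //.
by move=> i iH; rewrite [_ == i]eq_sym (negPf iH) andbF.
Unshelve. all: exact: mA.
Qed.

End Dynkin.

(** * The complex exponential and the one-step estimate *)

Section Exponential.
Context {R : realType}.
Local Notation C := R[i].

Lemma cexpD (x y : C) : cexp (x + y) = cexp x * cexp y.
Proof.
rewrite /cexp ReD ImD expRD cosD sinD.
by apply/eqP; rewrite eq_complex /=; apply/andP; split; apply/eqP; ring.
Qed.

Lemma cexp0 : cexp (0 : C) = 1.
Proof. by rewrite /cexp /= expR0 cos0 sin0 mul1r mulr0. Qed.

Lemma cexpMn (x : C) n : cexp (x * n%:R) = cexp x ^+ n.
Proof.
elim: n => [|n ih]; first by rewrite mulr0 cexp0.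
by rewrite exprS -ih -cexpD -natr1 mulrDr mulr1 addrC.
Qed.

Lemma normc_cexp (x : C) : normc (cexp x) = expR (Re x).
Proof.
rewrite /cexp /= !exprMn -mulrDr cos2Dsin2 mulr1 sqrtr_sqr ger0_norm //.
Qed.

Lemma cexp_derivative (z : C) (e : R) : 0 < e -> \forall h \near (0 : R)^'+,
  normc (cexp (z * h%:C) - 1 - z * h%:C) <= e * h.
Proof.
move=> e0.
pose a := Re z; pose b := Im z.
have dR : is_derive (0 : R) (1 : R) (fun h => expR (a * h) * cos (b * h)) a.
  apply: is_derive_eq; rewrite /GRing.scale /= !mulr0 expR0 cos0 sin0; ring.
have dI : is_derive (0 : R) (1 : R) (fun h => expR (a * h) * sin (b * h)) b.
  apply: is_derive_eq; rewrite /GRing.scale /= !mulr0 expR0 cos0 sin0; ring.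
have lim (f : R -> R) l : is_derive (0 : R) (1 : R) f l ->
    \forall h \near (0 : R)^'+, `|f h - f 0 - l * h| <= e / 2 * h.
  move=> df; have c : h^-1 * (f h - f 0) @[h --> (0 : R)^'] --> l.
    have := @ex_derive _ _ _ _ _ _ _ df; rewrite /derivable => /cvg_ex[l' hl'].
    have <- : l' = l.
      by have := @derive_val _ _ _ _ _ _ _ df; rewrite /derive => <-; apply/esym/cvg_lim.
    apply: cvg_trans hl'; apply: near_eq_cvg; apply: nearW => h /=.
    by rewrite addr0 [h%:A]mulr1.
  have {}c : h^-1 * (f h - f 0) @[h --> (0 : R)^'+] --> l.
    exact: cvg_dnbhs_at_right.
  have e2 : 0 < e / 2 by rewrite divr_gt0.
  have /cvgrPdist_le/(_ _ e2) := c.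
  apply: filter_app; near=> h => hc.
  have h0 : 0 < h by near: h; exact: nbhs_right_gt.
  rewrite -(ler_pM2l (_ : 0 < h^-1)) ?invr_gt0 // -[h^-1 in leLHS]gtr0_norm ?invr_gt0 //.
  rewrite -normrM mulrBr distrC mulrCA mulVf ?gt_eqF // mulr1.
  by apply: le_trans hc _; rewrite mulrCA mulVf ?gt_eqF // mulr1.
have hR := lim _ _ dR; have hI := lim _ _ dI.
near=> h.
have h1 : `|expR (a * h) * cos (b * h) - expR (a * 0) * cos (b * 0) - a * h| <= e / 2 * h by near: h.
have h2 : `|expR (a * h) * sin (b * h) - expR (a * 0) * sin (b * 0) - b * h| <= e / 2 * h by near: h.
apply: le_trans (normc_ReIm _) _.
rewrite !mulr0 expR0 cos0 sin0 mulr0 mulr1 subr0 in h1 h2.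
rewrite [e]splitr mulrDl; apply: lerD.
  apply: le_trans h1; apply/eq_lew; congr `|_|.
  by rewrite !ReD !ReN /cexp /= !ReM !ImM /= !(mulr0, oppr0, addr0, add0r).
apply: le_trans h2; apply/eq_lew; congr `|_|.
by rewrite !ImD !ImN /cexp /= !ReM !ImM /= !(mulr0, oppr0, addr0, add0r).
Unshelve. all: by end_near. Qed.

End Exponential.

Section OneStep.
Context {R : realType} {m : nat}.
Local Notation C := R[i].
Variables (T : 'M[R]_m) (p : R -> 'M[R]_m) (c : 'I_m -> R) (s : C).
Hypothesis tf : transition_function T p.
Variables (f f' : R -> 'I_m -> C) (B eps : R).
Hypothesis harm : level_harmonic T c s eps B f f'.

(** First-order terms in h cancel by harmonicity. The estimate is uniform in x since p h and e^{-sh}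
    do not depend on x and the bounds on f are uniform; x <= eps / 2 leaves room for the step h
    c_j. *)
Lemma one_step (eta : R) : 0 < eta -> \forall h \near (0 : R)^'+, forall x i, x <= eps / 2 ->
  normc (cexp (- s * h%:C) * (\sum_j (p h i j)%:C * f (x + h * c j) j) - f x i) <= h * eta.
Proof.
have [[B0 eps0] fB f'B taylor gen] := harm; move=> eta0.
pose Cb := speed c.
have leC i : `|c i| <= Cb by exact: le_speed.
have Cb0 : 0 < Cb by exact: speed_gt0.
pose tau := \sum_i \sum_j `|T i j|.
have tau0 : 0 <= tau by apply: sumr_ge0 => i _; exact: sumr_ge0.
have leT i j : `|T i j| <= tau.
  rewrite /tau (bigD1 i) //= (bigD1 j) //= -addrA lerDl addr_ge0 //; first exact: sumr_ge0.
  by apply: sumr_ge0 => k _; exact: sumr_ge0.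
pose n := normc s.
have n0 : 0 <= n by exact: normc_ge0.
have a1 : 0 <= B * Cb ^+ 2 by apply: mulr_ge0 => //; exact: sqr_ge0.
have a3 : 0 <= m%:R * B by exact: mulr_ge0.
have a2 : 0 <= m%:R * (tau + 1) * (Cb * B).
  by apply: mulr_ge0; apply: mulr_ge0 => //; [exact: addr_ge0|exact: ltW].
(* Collects the coefficients of h e in [b1], [b4] and [b5]; the summand 1 makes K positive, and e <=
   eta / (2 K) makes their total at most h eta. *)
pose K := 1 + B + n ^+ 2 * B + (1 + n) * (B * Cb ^+ 2 + m%:R * B + m%:R * (tau + 1) * (Cb * B)).
have K0 : 0 < K.
  have : 0 <= n ^+ 2 * B by rewrite mulr_ge0 ?sqr_ge0.
  have : 0 <= (1 + n) * (B * Cb ^+ 2 + m%:R * B + m%:R * (tau + 1) * (Cb * B)).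
    by apply: mulr_ge0; [exact: addr_ge0|apply: addr_ge0 => //; exact: addr_ge0].
  by rewrite /K; move: B0; lra.
pose e := Order.min 1 (eta / (2 * K)).
have e0 : 0 < e by rewrite lt_min ltr01 divr_gt0 // mulr_gt0.
have e1 : e <= 1 by rewrite ge_min lexx.
have hE := cexp_derivative (- s) e0.
have hT : \forall h \near (0 : R)^'+, forall i j, `|p h i j - (i == j)%:R - h * T i j| <= e * h.
  apply: filter_forall => i; apply: filter_forall => j.
  have /cvgrPdist_le/(_ _ e0) := @tf_generator _ _ _ _ tf i j.
  apply: filter_app; near=> h => hc.
  have h0 : 0 < h by near: h; exact: nbhs_right_gt.
  rewrite -(ler_pM2l (_ : 0 < h^-1)) ?invr_gt0 // -[h^-1 in leLHS]gtr0_norm ?invr_gt0 //.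
  have -> : h^-1 * (e * h) = e by field; rewrite gt_eqF.
  rewrite -normrM.
  have -> : h^-1 * (p h i j - (i == j)%:R - h * T i j) = h^-1 * (p h i j - (i == j)%:R) - T i j.
    by field; rewrite gt_eqF.
  by rewrite distrC.
near=> h => x i xe.
have h0 : 0 < h by near: h; exact: nbhs_right_gt.
have h1 : h <= 1 by near: h; apply: nbhs_right_le.
have he : h <= e by near: h; apply: nbhs_right_le.
have hC : h <= eps / 2 / Cb by near: h; apply: nbhs_right_le; rewrite !divr_gt0.
have {}hC : h * Cb <= eps / 2 by rewrite -ler_pdivlMr.
have hp : forall i j, `|p h i j - (i == j)%:R - h * T i j| <= e * h by near: h.
have hexp : normc (cexp (- s * h%:C) - 1 - - s * h%:C) <= e * h by near: h.
have hcj j : `|h * c j| <= h * Cb by rewrite normrM gtr0_norm // ler_wpM2l // ltW.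
have xle : x <= eps by have := eps0; move: xe; lra.
have xj j : x + h * c j <= eps.
  by have := le_trans (ler_norm _) (hcj j); move: xe hC; lra.
set Ah := \sum_j _.
have p0 j : 0 <= p h i j by apply: (tf_ge0 tf); exact: ltW.
have AhB : normc Ah <= B.
  apply: le_trans (normc_sum _ _ _) _.
  apply: (@le_trans _ _ (\sum_j p h i j * B)).
    by apply: ler_sum => j _; rewrite normcM normcR ger0_norm // ler_wpM2l // fB.
  by rewrite -mulr_suml (tf_sum1 tf) ?mul1r ?(ltW h0).
pose r1 := Ah - f x i - h%:C * (s * f x i).
(* Three remainders of second order: the Taylor error in the level, the error of p h against I + h
   T, and the interaction of a jump with the change of level. *)
have r1E : r1 = \sum_j (p h i j)%:C * (f (x + h * c j) j - f x j - (h * c j)%:C * f' x j) +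
   \sum_j (p h i j - (i == j)%:R - h * T i j)%:C * f x j +
   \sum_j (h * (p h i j - (i == j)%:R) * c j)%:C * f' x j.
  rewrite /r1 -gen // mulrDr mulr_sumr -!big_split /=.
  have d1 : f x i = \sum_j ((i == j)%:R : R)%:C * f x j.
    by rewrite (bigD1 i) //= eqxx mul1r big1 ?addr0 // => j ji; rewrite eq_sym (negPf ji) mul0r.
  have d2 : h%:C * ((c i)%:C * f' x i) = \sum_j (h * (i == j)%:R * c j)%:C * f' x j.
    rewrite (bigD1 i) //= eqxx mulr1 big1 ?addr0; first by rewrite rmorphM mulrA.
    by move=> j ji; rewrite eq_sym (negPf ji) mulr0 !mul0r.
  rewrite d1 d2 /Ah opprD addrA -!sumrB; apply: eq_bigr => j _.
  by rewrite !(rmorphM, rmorphB) /=; ring.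
have pj j : `|p h i j - (i == j)%:R| <= h * (tau + 1).
  rewrite -(subrK (h * T i j) (p h i j - _)); apply: le_trans (ler_normD _ _) _.
  rewrite mulrDr mulr1 addrC lerD //.
    by rewrite normrM gtr0_norm // ler_wpM2l // ltW.
  by apply: le_trans (hp i j) _; rewrite -[leRHS]mul1r ler_wpM2r // ltW.
have r1B : normc r1 <= h * (B * Cb ^+ 2 * h + e * (m%:R * B) + h * (m%:R * (tau + 1) * (Cb * B))).
  rewrite r1E; apply: le_trans (normcD _ _) _; rewrite [leRHS]mulrDr; apply: lerD.
    apply: le_trans (normcD _ _) _; rewrite [leRHS]mulrDr; apply: lerD.
      apply: le_trans (normc_sum _ _ _) _.
      apply: (@le_trans _ _ (\sum_j p h i j * (B * (h * Cb) ^+ 2))).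
        apply: ler_sum => j _; rewrite normcM normcR ger0_norm // ler_wpM2l //.
        apply: le_trans (taylor _ _ _ xle (xj j)) _; rewrite ler_wpM2l //.
        by rewrite -[leLHS]real_normK ?num_real // lerXn2r ?nnegrE // mulr_ge0 // ltW.
      by rewrite -mulr_suml (tf_sum1 tf) ?(ltW h0) //; apply/eq_lew; ring.
    apply: le_trans (normc_sum _ _ _) _.
    apply: (@le_trans _ _ (\sum_(j < m) (e * h * B))).
      by apply: ler_sum => j _; rewrite normcM normcR ler_pM ?normc_ge0 // fB.
    by rewrite sumr_const card_ord -mulr_natl; apply/eq_lew; ring.
  apply: le_trans (normc_sum _ _ _) _.
  apply: (@le_trans _ _ (\sum_(j < m) (h * (h * (tau + 1)) * Cb * B))).
    apply: ler_sum => j _; rewrite normcM normcR ler_pM ?normc_ge0 ?f'B //.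
    rewrite !normrM gtr0_norm //; apply: ler_pM => //.
      by apply: mulr_ge0 => //; exact: ltW.
    by rewrite (ler_wpM2l (ltW h0)).
  by rewrite sumr_const card_ord -mulr_natl; apply/eq_lew; ring.
(* Substituting Ah = f + s h f + r1 in (1 - s h) Ah cancels the first-order terms and leaves - s^2
   h^2 f. *)
have -> : cexp (- s * h%:C) * Ah - f x i = (cexp (- s * h%:C) - 1 - - s * h%:C) * Ah
    - s ^+ 2 * h%:C ^+ 2 * f x i + (1 - s * h%:C) * r1 by rewrite /r1; ring.
have nh : normc h%:C = h by rewrite normcR gtr0_norm.
set Rr := B * Cb ^+ 2 * h + e * (m%:R * B) + h * (m%:R * (tau + 1) * (Cb * B)) in r1B.
have b1 : normc ((cexp (- s * h%:C) - 1 - - s * h%:C) * Ah) <= e * h * B.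
  by rewrite normcM ler_pM ?normc_ge0.
have b2 : normc (s ^+ 2 * h%:C ^+ 2 * f x i) <= n ^+ 2 * h ^+ 2 * B.
  rewrite !expr2 !normcM nh -/n ler_wpM2l ?fB //.
  by rewrite -!expr2 mulr_ge0 // sqr_ge0.
have b3 : normc ((1 - s * h%:C) * r1) <= (1 + n) * (h * Rr).
  rewrite normcM ler_pM ?normc_ge0 //; apply: le_trans (normcD _ _) _.
  by rewrite normcN normc1 normcM nh lerD2l -[leRHS]mulr1 ler_wpM2l.
apply: le_trans (normcD _ _) _; apply: le_trans (lerD (normcD _ _) b3) _; rewrite normcN.
apply: le_trans (lerD (lerD b1 b2) (lexx _)) _.
have RrK : Rr <= e * (B * Cb ^+ 2 + m%:R * B + m%:R * (tau + 1) * (Cb * B)).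
  have := ler_wpM2l a1 he; have := ler_wpM2r a2 he.
  by rewrite /Rr; move: (B * Cb ^+ 2) (m%:R * (tau + 1) * (Cb * B)) (m%:R * B) => X Y Z; nra.
have eK : e * (2 * K) <= eta.
  by rewrite -ler_pdivlMr ?mulr_gt0 // ge_min lexx orbT.
have b4 : (1 + n) * (h * Rr) <= h * (e * ((1 + n) * (B * Cb ^+ 2 + m%:R * B + m%:R * (tau + 1) * (Cb * B)))).
  have n1 : 0 <= (1 + n) * h by rewrite mulr_ge0 ?addr_ge0 // ltW.
  have := ler_wpM2l n1 RrK.
  by move: (B * Cb ^+ 2 + m%:R * B + m%:R * (tau + 1) * (Cb * B)) => X; rewrite -!mulrA; nra.
have b5 : n ^+ 2 * h ^+ 2 * B <= h * (e * (n ^+ 2 * B)).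
  have n1 : 0 <= n ^+ 2 * B * h by rewrite !mulr_ge0 ?sqr_ge0 // ltW.
  by have := ler_wpM2l n1 he; move: (n ^+ 2) => X; nra.
have b6 : h * (e * K) <= h * eta.
  rewrite ler_wpM2l ?(ltW h0) //; apply: le_trans eK; rewrite ler_wpM2l ?(ltW e0) //.
  by move: K0; lra.
apply: le_trans b6; rewrite /K.
have heg : 0 <= h * e by rewrite mulr_ge0 // ltW.
move: b4 b5; set X := (1 + n) * (B * _ + _ + _); set Y := (1 + n) * (h * Rr).
set Z := n ^+ 2 * B; set W := n ^+ 2 * h ^+ 2 * B => b4 b5.
nra.
Unshelve. all: by end_near. Qed.

End OneStep.

(** * Passage to the limit *)

Section StoppedBound.
Context {R : realType} {m : nat}.
Local Notation C := R[i].
Variables (h b : R) (k0 : nat) (c : 'I_m -> R) (v : nat -> C) (x : nat -> 'I_m) (B : R).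
Local Notation fr k := (hfresh h b k0 c x k).
Local Notation al k := (halive h b k0 c x k).

Lemma stopped_bound K : (forall k, fr k || al k -> normc (v k) <= B) ->
  normc (stopped h b k0 c v x K) <= B.
Proof.
move=> hv; elim: K => [|K ih].
  rewrite stopped0; apply: hv; rewrite /hfresh /fresh -/(halive h b k0 c x 0) andbT.
  by case: (halive _ _ _ _ _ _).
case a: (al K); last by rewrite stoppedS a mul0r addr0.
rewrite /stopped /stopped_sum (_ : \sum_(k < K.+2) _ = (fr K.+1)%:R * v K.+1).
  rewrite -mulrDl freshS a mul1r; apply: hv.
  by have := freshS h b k0 c C x K; rewrite a; case: (fr _); case: (al _) => //= /eqP;
     rewrite addr0 eq_sym oner_eq0.
rewrite big_ord_recr /= big1 ?add0r // => k _.
rewrite (_ : fr k = false) ?mul0r //; apply/negbTE; rewrite negb_and; apply/orP; left.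
by rewrite negbK; apply: alive_le a; rewrite -ltnS.
Qed.

Lemma stopped_sum_bound K : 0 <= B -> (forall k, fr k || al k -> normc (v k) <= B) ->
  normc (stopped_sum h b k0 c v x K) <= B.
Proof.
move=> B0 hv; apply: le_trans (normc_sum _ _ _) _.
apply: (@le_trans _ _ (\sum_(k < K.+1) (fr k)%:R * B)).
  apply: ler_sum => k _; rewrite normcM.
  by case fk: (fr k); rewrite ?normc1 ?normc0 ?mul0r // !mul1r hv // fk.
by rewrite -mulr_suml -[leRHS]mul1r ler_wpM2r // sum_fresh_le1.
Qed.

Lemma fresh_level_le xmax k : 0 < h -> 0 < b -> k0%:R * (h * speed c) <= xmax ->
  fr k || al k -> hlevel h c x k <= xmax + h * speed c.
Proof.
move=> h0 b0 xm; have hs : 0 <= h * speed c by rewrite mulr_ge0 ?(ltW h0) ?(ltW (speed_gt0 c)).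
have xm0 : 0 <= xmax by apply: le_trans xm; rewrite mulr_ge0.
move=> /orP[|/(halive_le h0 b0 xm) e]; last by apply: le_trans e _; rewrite lerDl.
case: k => [_|k /andP[_ ak]]; first by rewrite /hlevel big_ord0 addr_ge0.
rewrite hlevelS; apply: lerD; first exact: (halive_le h0 b0 xm ak).
rewrite ler_wpM2l ?(ltW h0) //.
by apply: le_trans (ler_norm _) _; exact: le_speed.
Qed.

End StoppedBound.

(** * Limits of stopped values along a fixed path *)

Section StoppedLimit.
Context {R : realType} {m : nat}.
Local Notation C := R[i].
Variables (psi : R -> 'I_m) (c : 'I_m -> R).
Hypothesis right_cont : forall t, 0 <= t -> \forall u \near t^'+, psi u = psi t.
Hypothesis left_lim : forall t, 0 < t -> exists i, \forall u \near t^'-, psi u = i.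
(** J is the left limit of the path at z + delta; [psi 0] is a default for paths without passage at
    a positive finite time. *)
Lemma left_state (delta : R) : 0 <= delta -> exists J, forall z, hit psi c = z%:E -> 0 < z ->
  exists2 eta, 0 < eta & forall u, z + delta - eta < u < z + delta -> psi u = J.
Proof.
move=> d0; case hz: (hit psi c) => [z| |]; [|by exists (psi 0)|by exists (psi 0)].
have [z0|z0] := ltP 0 z; last first.
  by exists (psi 0) => _ [<-]; rewrite ltNge z0.
have zd : 0 < z + delta by rewrite ltr_wpDr.
by have [J hJ] := left_interval left_lim zd; exists J => _ [<-].
Qed.

(** By right continuity the path is constant just after z, so for a short lag the left limit at z +
    delta is the state at z itself, even if the path jumps at z. *)
Lemma left_state_right z : 0 < z -> exists2 e, 0 < e & forall delta J eta, 0 < delta -> delta < e ->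
  0 < eta -> (forall u, z + delta - eta < u < z + delta -> psi u = J) -> J = psi z.
Proof.
move=> z0; have [e e0 he] := right_interval right_cont (ltW z0).
exists e => // delta J eta d0 de eta0 hJ.
pose u := z + delta - Order.min eta delta / 2.
have m0 : 0 < Order.min eta delta by rewrite lt_min eta0.
have m1 : Order.min eta delta <= eta by rewrite ge_min lexx.
have m2 : Order.min eta delta <= delta by rewrite ge_min lexx orbT.
rewrite -(hJ u); last by apply/andP; split; rewrite /u; move: m0 m1 m2; lra.
by apply: he; apply/andP; split; rewrite /u; move: m0 m1 m2 de; lra.
Qed.

Variable i : 'I_m.
Hypotheses (psi0 : psi 0 = i) (ci : c i < 0).
Variables (s : C) (L : nat).
Hypotheses (s0 : 0 < Re s) (hL : 2 <= L%:R * `|c i|).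
Variables (b : nat -> R) (k0 K : nat -> nat).
Hypotheses (b_gt0 : forall n, 0 < b n) (b_cvg : b n @[n --> \oo] --> 0).
Hypothesis k0_def : forall n, (k0 n)%:R * b n ^+ 2 = L%:R * b n.
Hypothesis K_cvg : forall M : R, \forall n \near \oo, M <= (K n)%:R * b n ^+ 2.
Let h n := b n ^+ 2.
Let rho n := cexp (- s * (h n)%:C).
Let x n l := psi (l%:R * h n).
Let lev n k := hlevel (h n) c (x n) k.
Let fr n k := hfresh (h n) (b n) (k0 n) c (x n) k.
Let al n k := halive (h n) (b n) (k0 n) c (x n) k.

Definition hit_value (y0 : C) : C :=
  if hit psi c is z%:E then cexp (- s * z%:C) * y0 else 0.

Let h_gt0 n : 0 < h n. Proof. exact: exprn_gt0. Qed.

Lemma rhoX n k : rho n ^+ k = cexp (- s * (k%:R * h n)%:C).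
Proof.
rewrite /rho -cexpMn; congr cexp.
have -> : (k%:R : C) = (k%:R : R)%:C by rewrite raddfMn.
by move: (h n) => a; rewrite rmorphM; ring.
Qed.

Lemma normc_discount (t : R) : normc (cexp (- s * t%:C)) = expR (- (Re s * t)).
Proof. by rewrite normc_cexp ReM ReN /= mulr0 subr0 mulNr. Qed.

Lemma discount_le1 (t : R) : 0 <= t -> normc (cexp (- s * t%:C)) <= 1.
Proof.
move=> t0; rewrite normc_discount -expR0 ler_expR oppr_le0 mulr_ge0 //; exact: ltW.
Qed.

(** The choice M = 1 / (Re s * a) reduces the claim to e^x >= x at x = 1 / a. *)
Lemma discount_small (a : R) : 0 < a -> exists2 M, 0 < M & expR (- (Re s * M)) <= a.
Proof.
move=> a0; exists (Re s * a)^-1; first by rewrite invr_gt0 mulr_gt0.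
have -> : Re s * (Re s * a)^-1 = a^-1 by field; rewrite !gt_eqF.
rewrite expRN -[leRHS]invrK lef_pV2 ?posrE ?expR_gt0 ?invr_gt0 //.
by apply: le_trans (expR_ge1Dx _); rewrite lerDr.
Qed.

Lemma discount_cont (e : R) : 0 < e -> exists2 eta, 0 < eta &
  forall t z, 0 <= t -> z - eta < t -> t < z ->
    normc (cexp (- s * t%:C) - cexp (- s * z%:C)) <= e.
Proof.
move=> e0.
have := cexp_derivative s ltr01; rewrite near_withinE => /nbhs_ballP[a a0 ha].
have {}a0 : 0 < a by exact: a0.
exists (Order.min a (e / (1 + normc s))).
  by rewrite lt_min a0 divr_gt0 // ltr_wpDr ?normc_ge0.
move=> t z t0 zt tz.
have u0 : 0 < z - t by rewrite subr_gt0.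
have : z - t < Order.min a (e / (1 + normc s)) by rewrite ltrBlDl -ltrBlDr.
rewrite lt_min => /andP[ua]; rewrite ltr_pdivlMr ?ltr_wpDr ?normc_ge0 // => ue.
have /ha/(_ u0) hu : ball 0 a (z - t) by rewrite /ball /= sub0r normrN gtr0_norm.
have -> : cexp (- s * t%:C) - cexp (- s * z%:C) =
    cexp (- s * z%:C) * (cexp (s * (z - t)%:C) - 1).
  rewrite mulrBr mulr1 -cexpD; congr (cexp _ - _).
  by rewrite rmorphB /=; ring.
rewrite normcM -[leRHS]mul1r ler_pM ?normc_ge0 ?discount_le1 //.
  by apply: le_trans t0 (ltW tz).
rewrite -(subrK (s * (z - t)%:C) (cexp _ - 1)); apply: le_trans (normcD _ _) _.
apply: le_trans (lerD hu (lexx _)) _; rewrite normcM normcR gtr0_norm //.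
by move: ue; lra.
Qed.

Lemma normc_nat_bool (a : bool) : normc (a%:R : C) = a%:R.
Proof. by case: a; rewrite ?normc1 ?normc0. Qed.

(** * A common limit theorem for values of f and for lagged indicators *)

Section Array.
Variables (y : nat -> nat -> C) (y0 : C) (B : R).
Hypothesis y_bound : forall n k, fr n k || al n k -> normc (y n k) <= B.
Hypothesis y_cvg : forall z D e, hit psi c = z%:E -> 0 < z -> lvl psi c z = 0 ->
  (forall t, 0 < t < z -> lvl psi c t < 0) -> 0 <= D -> 0 < e ->
  exists2 eta, 0 < eta & \forall n \near \oo, forall r, z - eta < r%:R * h n ->
    r%:R * h n < z -> `|lev n r| <= (1 + D) * b n -> normc (y n r - y0) <= e.
Let v n k := rho n ^+ k * y n k.
Let SS n := stopped_sum (h n) (b n) (k0 n) c (v n) (x n) (K n).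
Let ST n := stopped (h n) (b n) (k0 n) c (v n) (x n) (K n).

Let near_b (a : R) : 0 < a -> \forall n \near \oo, b n < a.
Proof.
move=> a0; have /cvgrPdist_lt/(_ _ a0) := b_cvg.
by apply: filterS => n; rewrite sub0r normrN gtr0_norm.
Qed.

(** The sampled path is alive up to a time M beyond which the discount is at most e / 2 / (1 + |B|);
    every contribution, fresh or terminal, comes later. *)
Lemma stopped_infinite (e : R) : 0 < e -> (forall t, 0 < t -> lvl psi c t < 0) ->
  \forall n \near \oo, normc (SS n) <= e /\ normc (ST n) <= e.
Proof.
move=> e0 neg.
have B1 : 0 < 1 + `|B| by rewrite ltr_wpDr.
have [M M0 hM] := discount_small (divr_gt0 (divr_gt0 e0 (ltr0Sn R 1)) B1).
have [|beta beta0 hbeta] := alive_until right_cont left_lim psi0 ci hL M0.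
  by move=> t /andP[t0 _]; exact: neg.
near=> n.
have bn : b n < beta by near: n; exact: near_b.
have KM : M <= (K n)%:R * h n by near: n; exact: K_cvg.
have hal k : k%:R * h n <= M -> al n k by apply: hbeta; rewrite ?b_gt0.
have vB k : fr n k || al n k -> M <= k%:R * h n -> normc (v n k) <= e / 2.
  move=> fa kM; rewrite normcM rhoX normc_discount.
  have := ler_pM (expR_ge0 (- (Re s * (k%:R * h n)))) (normc_ge0 (y n k))
    (_ : _ <= e / 2 / (1 + `|B|)) (_ : _ <= 1 + `|B|).
  rewrite divfK ?gt_eqF //; apply.
    by apply: le_trans hM; rewrite ler_expR lerN2 ler_wpM2l // ltW.
  apply: le_trans (y_bound fa) _; apply: le_trans (ler_norm _) _.
  by rewrite lerDr.
have SSe : normc (SS n) <= e / 2.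
  apply: le_trans (normc_sum _ _ _) _.
  have := sum_fresh_le1 (h n) (b n) (k0 n) c (x n) (K n) => le1.
  apply: (@le_trans _ _ (\sum_(k < (K n).+1) (fr n k)%:R * (e / 2))).
    apply: ler_sum => k _; rewrite normcM normc_nat_bool -/(fr n k).
    case fk: (fr n k); last by rewrite !mul0r.
    rewrite !mul1r; apply: vB; first by rewrite fk.
    rewrite leNgt; apply/negP => /ltW/hal; apply/negP.
    by case/andP: fk.
  by rewrite -mulr_suml -[leRHS]mul1r ler_wpM2r // divr_ge0 // ltW.
split; first by apply: le_trans SSe _; rewrite ler_pdivrMr // ler_pMr // ler1n.
apply: le_trans (normcD _ _) _; rewrite [e]splitr; apply: lerD => //.
rewrite normcM normc_nat_bool -/(al n (K n)).
case aK: (al n (K n)); last by rewrite mul0r divr_ge0 // ltW.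
by rewrite mul1r vB // aK orbT.
Unshelve. all: by end_near. Qed.

(** For large n there is exactly one fresh index r up to [K n], with r h just before z, so both sums
    reduce to [v n r]. *)
Lemma stopped_finite z (e : R) : 0 < e -> hit psi c = z%:E -> 0 < z -> lvl psi c z = 0 ->
  (forall t, 0 < t < z -> lvl psi c t < 0) ->
  \forall n \near \oo, normc (SS n - cexp (- s * z%:C) * y0) <= e /\
    normc (ST n - cexp (- s * z%:C) * y0) <= e.
Proof.
move=> e0 hz z0 lz neg.
have e2 : 0 < e / 2 by rewrite divr_gt0.
have [D D0 hD] := fresh_before_hit right_cont left_lim psi0 ci hL z0 lz neg.
have [eta1 eta10 h1] := y_cvg hz z0 lz neg D0 e2.
have Y0 : 0 < 1 + normc y0 by rewrite ltr_wpDr ?normc_ge0.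
have [eta2 eta20 h2] := discount_cont (divr_gt0 e2 Y0).
have [|beta beta0 hbeta] := hD (Order.min eta1 eta2); first by rewrite lt_min eta10.
near=> n.
have bn : b n < beta by near: n; exact: near_b.
have Kz : z <= (K n)%:R * h n by near: n; exact: K_cvg.
have hy : forall r, z - eta1 < r%:R * h n -> r%:R * h n < z ->
    `|lev n r| <= (1 + D) * b n -> normc (y n r - y0) <= e / 2 by near: n; exact: h1.
have [|r [frr zr rz xr]] := hbeta (b n) (k0 n) _ (k0_def n); first by rewrite b_gt0.
have rK : (r < (K n).+1)%N.
  by rewrite ltnS -(ler_nat R) -(ler_pM2r (h_gt0 n)) (le_trans (ltW rz)).
have r0 : 0 <= r%:R * h n by rewrite mulr_ge0 // ltW.
have SSr : SS n = v n r.
  rewrite /SS /stopped_sum (bigD1 (Ordinal rK)) //= big1 ?addr0.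
    by rewrite (_ : hfresh _ _ _ _ _ _ = true) ?mul1r.
  move=> k kr; rewrite (_ : hfresh _ _ _ _ _ _ = false) ?mul0r //.
  by rewrite /hfresh (fresh_uniq _ frr); apply: contraNF kr => /eqP e3; apply/eqP/val_inj.
have STr : ST n = SS n.
  rewrite /ST /stopped (_ : halive _ _ _ _ _ _ = false) ?mul0r ?addr0 //.
  by apply/negP => aK; case/andP: frr => /negP + _; apply; apply: alive_le aK.
suff : normc (v n r - cexp (- s * z%:C) * y0) <= e by rewrite STr SSr.
have -> : v n r - cexp (- s * z%:C) * y0 = rho n ^+ r * (y n r - y0) +
   (cexp (- s * (r%:R * h n)%:C) - cexp (- s * z%:C)) * y0 by rewrite /v rhoX; ring.
apply: le_trans (normcD _ _) _; rewrite [e]splitr; apply: lerD.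
  rewrite normcM -[leRHS]mul1r ler_pM ?normc_ge0 // ?rhoX ?discount_le1 //.
  by apply: hy => //; apply: le_lt_trans zr; rewrite lerD2l lerN2 ge_min lexx.
rewrite normcM; apply: (@le_trans _ _ (e / 2 / (1 + normc y0) * normc y0)).
  rewrite ler_wpM2r ?normc_ge0 //; apply: h2 => //.
  by apply: le_lt_trans zr; rewrite lerD2l lerN2 ge_min lexx orbT.
rewrite mulrAC ler_pdivrMr // ler_wpM2l ?(ltW e2) //.
by rewrite lerDr.
Unshelve. all: by end_near. Qed.

Lemma stopped_limit (e : R) : 0 < e -> \forall n \near \oo,
  normc (SS n - hit_value y0) <= e /\ normc (ST n - hit_value y0) <= e.
Proof.
move=> e0.
have [[hz neg]|[z [z0 hz lz neg]]] := hit_cases right_cont left_lim psi0 ci.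
  have -> : hit_value y0 = 0 by rewrite /hit_value hz.
  by apply: filterS (stopped_infinite e0 neg) => n; rewrite !subr0.
have -> : hit_value y0 = cexp (- s * z%:C) * y0 by rewrite /hit_value hz.
exact: (stopped_finite e0 hz z0 lz neg).
Qed.

End Array.

Lemma lagged_limit delta J j (e : R) : 0 <= delta ->
  (forall z, hit psi c = z%:E -> 0 < z ->
     exists2 eta, 0 < eta & forall u, z + delta - eta < u < z + delta -> psi u = J) ->
  0 < e -> \forall n \near \oo,
  normc (stopped_sum (b n ^+ 2) (b n) (k0 n) c
    (fun k => rho n ^+ k * (psi (k%:R * b n ^+ 2 + delta) == j)%:R) (x n) (K n) -
    hit_value (J == j)%:R) <= e.
Proof.
move=> d0 hJ e0.
pose y n k : C := (psi (k%:R * b n ^+ 2 + delta) == j)%:R.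
have y1 n k : normc (y n k) <= 1.
  by rewrite normc_nat_bool lern1 leq_b1.
have lim := @stopped_limit y (J == j)%:R 1 (fun n k _ => y1 n k).
have {}lim := lim _ e e0.
refine (filterS _ (lim _)); first by move=> n [].
move=> z D e' hz z0 _ _ _ e'0; have [eta eta0 he] := hJ z hz z0.
exists eta => //; apply: nearW => n r r1 r2 _.
rewrite /y he ?subrr ?normc0 ?(ltW e'0) //.
by rewrite ltrD2r r2 andbT addrAC ltrD2r.
Qed.

Variables (f : R -> 'I_m -> C) (B eps : R) (J j : 'I_m).
Hypotheses (B0 : 0 <= B) (eps0 : 0 < eps).
Hypothesis fB : forall x i, x <= eps -> normc (f x i) <= B.
Hypothesis f_lip : forall x i, `|x| <= eps -> `|x| <= 1 -> normc (f x i - f 0 i) <= B * `|x|.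
Hypothesis f0 : forall i, 0 < c i -> f 0 i = (i == j)%:R.
Hypothesis small_step : forall n, (k0 n)%:R * (b n ^+ 2 * speed c) <= eps / 2.
Hypothesis small_step1 : forall n, b n ^+ 2 * speed c <= eps / 2.

Lemma value_bound n (z : nat -> 'I_m) k :
  hfresh (b n ^+ 2) (b n) (k0 n) c z k || halive (b n ^+ 2) (b n) (k0 n) c z k ->
  normc (f (hlevel (b n ^+ 2) c z k) (z k)) <= B.
Proof.
move=> fa; apply: fB; have h0 : 0 < b n ^+ 2 by rewrite exprn_gt0.
apply: le_trans (fresh_level_le h0 (b_gt0 n) (small_step n) fa) _.
by rewrite [leRHS]splitr lerD2l; exact: small_step1.
Qed.

Lemma value_limit (e : R) :
  (forall z, hit psi c = z%:E -> 0 < z ->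
     exists2 eta, 0 < eta & forall u, z + 0 - eta < u < z + 0 -> psi u = J) ->
  0 < e -> \forall n \near \oo,
  normc (stopped (b n ^+ 2) (b n) (k0 n) c
    (hvalue (b n ^+ 2) c f (rho n) (x n)) (x n) (K n) -
    hit_value (J == j)%:R) <= e.
Proof.
move=> hJ e0.
pose y n k : C := f (hlevel (b n ^+ 2) c (x n) k) (x n k).
have lim := @stopped_limit y (J == j)%:R B (fun n k => @value_bound n (x n) k).
have {}lim := lim _ e e0.
refine (filterS _ (lim _)); first by move=> n [].
move=> z D e' hz z0 lz neg D0 e'0; have [eta eta0 he] := hJ z hz z0.
rewrite addr0 in he.
(* The left limit at the passage has positive rate, so that [f0] identifies f 0 J with the indicator
   of j. *)
have cJ : 0 < c J by exact: (up_before_hit right_cont left_lim z0 lz neg eta0 he).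
have D1 : 0 < 1 + D by rewrite ltr_wpDr.
have B1 : 0 < (B + 1) * (1 + D) by apply: mulr_gt0 => //; rewrite ltr_wpDl.
exists eta => //.
pose a := Order.min (Order.min eps 1 / (1 + D)) (e' / ((B + 1) * (1 + D))).
have a0 : 0 < a.
  by rewrite lt_min !divr_gt0 // lt_min eps0 ltr01.
have /cvgrPdist_lt/(_ _ a0) := b_cvg.
apply: filterS => n; rewrite sub0r normrN gtr0_norm // lt_min => /andP[b1 b2] r r1 r2 lr.
have {}b1 : (1 + D) * b n < Order.min eps 1 by rewrite mulrC -ltr_pdivlMr.
rewrite lt_min in b1; case/andP: b1 => b1 b3.
have xr : x n r = J by apply: he; rewrite r1.
rewrite /y xr -f0 //; apply: le_trans (f_lip _ _ _) _.
- by apply: le_trans lr (ltW b1).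
- by apply: le_trans lr (ltW b3).
apply: le_trans (ler_wpM2l B0 lr) _.
apply: (@le_trans _ _ ((B + 1) * (1 + D) * b n)).
  by rewrite -mulrA ler_wpM2r ?mulr_ge0 ?(ltW D1) ?(ltW (b_gt0 n)) // lerDl.
by rewrite mulrC -ler_pdivlMr // ltW.
Qed.

End StoppedLimit.

(** With b = 1 / nu, k0 = L nu and K = nu^3 one has k0 b^2 = L b exactly, while K b^2 = nu grows
    without bound. *)
Lemma step_sequences {R : realType} (L : nat) (a : R) : 0 < a ->
  exists b k0 K, [/\ forall n, 0 < b n :> R, b n @[n --> \oo] --> 0,
    forall n, (k0 n)%:R * b n ^+ 2 = L%:R * b n,
    forall M : R, \forall n \near \oo, M <= (K n)%:R * b n ^+ 2 &
    forall n, b n <= 1 /\ b n <= a].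
Proof.
move=> a0.
pose N0 := (Num.truncn a^-1).+1.
pose nu n := (N0 + n).+1.
have nu0 n : (nu n)%:R != 0 :> R by rewrite pnatr_eq0.
exists (fun n => (nu n)%:R^-1), (fun n => (L * nu n)%N), (fun n => (nu n ^ 3)%N).
split.
- by move=> n; rewrite invr_gt0 ltr0n.
- have h := @cvg_harmonic R; rewrite -(cvg_shiftn N0) in h.
  apply: cvg_trans h; apply: near_eq_cvg; apply: nearW => n.
  by rewrite /harmonic /= /nu addnC.
- by move=> n; rewrite natrM; field; exact: nu0.
- move=> M; near=> n.
  have -> : (nu n ^ 3)%:R * (nu n)%:R^-1 ^+ 2 = (nu n)%:R :> R.
    by rewrite natrX; field; exact: nu0.
  have : (Num.truncn M <= n)%N by near: n; exists (Num.truncn M).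
  move=> Mn; apply: le_trans (ltW (truncnS_gt _)) _.
  by rewrite ler_nat /nu ltnS (leq_trans Mn) // leq_addl.
- move=> n; split; first by rewrite invf_le1 ?ler1n // ltr0n.
  rewrite -[a]invrK lef_pV2 ?posrE ?invr_gt0 ?ltr0n //.
  apply: le_trans (ltW (truncnS_gt _)) _.
  by rewrite ler_nat /nu /N0 -addSn ltnW // leq_addr.
Unshelve. all: by end_near. Qed.

Section TestFunctionOfRiccati.
Context {R : realType} {m : nat}.
Local Notation C := R[i].
Variables (T : 'M[R]_m) (c : 'I_m -> R) (Sp Sm S0 : {set 'I_m}) (s : C).
Hypotheses (gT : conservative_generator T) (s0 : 0 < Re s).
Hypotheses (hp : forall i, (i \in Sp) = (0 < c i)) (hm : forall i, (i \in Sm) = (c i < 0))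
  (h0 : forall i, (i \in S0) = (c i == 0)).
Variable K : 'M[C]_(#|Sm|, #|Sp|).
Hypotheses (K1 : rbound K 1) (ricK : riccati (Qpp T c Sp S0 s) (Qpm T c Sp Sm S0 s)
  (Qmm T c Sm S0 s) (Qmp T c Sp Sm S0 s) K = 0).

(** The eps of the uniformization also scales the Poisson average: W = I + eps U has row norm at
    most 1 by [rbound_W], which keeps Phi W^n bounded. *)
Lemma riccati_test_function (j : 'I_#|Sp|) :
  exists f f' : R -> 'I_m -> C, exists eps B : R, [/\ level_harmonic T c s eps B f f',
    forall i, 0 < c i -> f 0 i = (i == enum_val j)%:R &
    forall k : 'I_#|Sm|, f 0 (enum_val k) = K k j].
Proof.
have [eps [delta [eps0 d0 d1 up um]]] := fluid_uniformization gT s0 hp hm h0.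
have [Phi [P1 P2 P3]] := harmonic_extension gT s0 hp hm h0 ricK.
move: P3; move: (Qpp T c Sp S0 s) (Qpm T c Sp Sm S0 s) up => q1 q2 up P3.
pose U := q1 + q2 *m K.
pose W : 'M[C]_(#|Sp|) := 1%:M + eps%:C *: U.
have W1 : rbound W 1.
  have := rbound_W up K1.
  rewrite (_ : _ + _ = W); last by rewrite /W /U scalerDr addrA -scalemxAl.
  move=> h i; apply: le_trans (h i) _; by rewrite gerBl ltW.
have harm i k : eps%:C * (\sum_l (T i l)%:C * Phi l k - s * Phi i k) =
    (c i)%:C * ((Phi *m W) i k - Phi i k).
  rewrite P3 -/U [Phi *m W]mulmxDr mulmx1 -scalemxAr [in RHS]mxE [X in _ + X - _]mxE.
  by ring.
have [B hB] := testf_harmonic eps0 W1 harm j.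
exists (testf eps Phi W j), (testf' eps Phi W j), eps, B; split=> //.
  move=> i ci; rewrite testf0; have iSp : i \in Sp by rewrite hp.
  have -> : i = enum_val (enum_rank_in iSp i) by rewrite enum_rankK_in.
  by rewrite P1 (inj_eq enum_val_inj).
by move=> k; rewrite testf0 P2.
Qed.

End TestFunctionOfRiccati.

(** * The expectation of the passage weight *)

Section PassageExpectation.
Context {R : realType} {m : nat} {d : measure_display} {Omega : measurableType d}.
Local Notation C := R[i].
Variables (P : probability Omega R) (T : 'M[R]_m) (phi : R -> Omega -> 'I_m) (c : 'I_m -> R)
  (p : R -> 'M[R]_m) (s : C).
Hypothesis phi_meas : forall t i, 0 <= t -> measurable [set w | phi t w = i].
Hypothesis right_cont : forall w t, 0 <= t -> \forall u \near t^'+, phi u w = phi t w.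
Hypothesis left_lim : forall w t, 0 < t -> exists i, \forall u \near t^'-, phi u w = i.
Hypothesis tf : transition_function T p.
Hypothesis markov : forall t h (A : set Omega) i j, 0 <= t -> 0 <= h -> past phi t A ->
  P (A `&` [set w | phi t w = i] `&` [set w | phi (t + h) w = j]) =
  (P (A `&` [set w | phi t w = i]) * (p h i j)%:E)%E.
Hypothesis s0 : 0 < Re s.
Variables (i0 j : 'I_m).
Hypothesis ci0 : c i0 < 0.
Let A := [set w | phi 0 w = i0].
Let mA : measurable A. Proof. exact: phi_meas. Qed.

Variable q : C -> R.
Hypothesis qD : forall x y, q (x + y) = q x + q y.
Hypothesis qR : forall (r : R) x, q (r%:C * x) = r * q x.
Hypothesis qn : forall x, `|q x| <= normc x.

Let qB x y : q (x - y) = q x - q y.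
Proof.
have := qR (-1) y; rewrite rmorphN1 mulN1r => e.
by rewrite qD e mulN1r.
Qed.

Local Notation EQ Z := (expect P A (fun w => q (Z w))).

Lemma expect_limit (Zn : nat -> Omega -> C) (Z : Omega -> C) (M : R) :
  (forall n, nice A (fun w => q (Zn n w))) -> (forall n w, A w -> normc (Zn n w) <= M) ->
  (forall w, A w -> forall e, 0 < e -> \forall n \near \oo, normc (Zn n w - Z w) <= e) ->
  nice A (fun w => q (Z w)) /\
  EQ (Zn n) @[n --> \oo] --> EQ Z.
Proof.
move=> nZ bZ cZ; apply: (@bounded_convergence _ _ _ P A mA (fun n w => q (Zn n w)) _ M).
- by move=> n; case: (nZ n).
- by move=> n w Aw; apply: le_trans (qn _) (bZ n w Aw).
move=> w Aw; apply/cvgrPdist_le => e e0; apply: filterS (cZ w Aw e e0) => n hn.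
by rewrite distrC -qB; exact: le_trans (qn _) hn.
Qed.

Lemma passage_time_hit w : passage_time c phi 0 0 w = hit (phi^~ w) c.
Proof.
rewrite /passage_time /hit; congr ereal_inf; apply/seteqP; split=> _ [t [t0 lt] <-];
  by exists t => //; split => //; move: lt; rewrite /level add0r.
Qed.

Lemma normc_hit_value w (y : C) : A w -> normc y <= 1 -> normc (hit_value (phi^~ w) c s y) <= 1.
Proof.
move=> Aw y1.
have [[hz _]|[z [z0 hz _ _]]] := hit_cases (right_cont w) (left_lim w) Aw ci0.
  by rewrite /hit_value hz normc0.
rewrite /hit_value hz normcM -[leRHS]mul1r ler_pM ?normc_ge0 //.
by apply: discount_le1 => //; exact: ltW.
Qed.

Variables (f f' : R -> 'I_m -> C) (B eps : R).
Hypothesis harm : level_harmonic T c s eps B f f'.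
Hypothesis f_up : forall i, 0 < c i -> f 0 i = (i == j)%:R.

Let f_lip x i : `|x| <= eps -> `|x| <= 1 -> normc (f x i - f 0 i) <= (B + B) * `|x|.
Proof.
have [[B0 eps0] _ f'B taylor _] := harm; move=> xe x1; have := taylor _ _ i (ltW eps0) (_ : 0 + x <= eps); rewrite add0r.
move=> /(_ (le_trans (ler_norm _) xe)) t.
rewrite -(subrK (x%:C * f' 0 i) (f x i - f 0 i)); apply: le_trans (normcD _ _) _.
rewrite mulrDl; apply: lerD.
  apply: le_trans t _; rewrite -[x ^+ 2]real_normK ?num_real // expr2 ler_wpM2l //.
  by rewrite -[leRHS]mul1r ler_wpM2r.
by rewrite normcM normcR mulrC ler_wpM2r // f'B // ltW.
Qed.

Let L := (Num.truncn (2 / `|c i0|)).+1.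
Let hL : 2 <= L%:R * `|c i0|.
Proof.
by rewrite -ler_pdivrMr ?normr_gt0 ?lt_eqF // ltW // truncnS_gt.
Qed.

Variables (b : nat -> R) (k0 K : nat -> nat).
Hypotheses (b_gt0 : forall n, 0 < b n) (b_cvg : b n @[n --> \oo] --> 0).
Hypothesis k0_def : forall n, (k0 n)%:R * b n ^+ 2 = L%:R * b n.
Hypothesis K_cvg : forall M : R, \forall n \near \oo, M <= (K n)%:R * b n ^+ 2.
Hypothesis b_le1 : forall n, b n <= 1.
Hypothesis b_small : forall n, L%:R * b n * speed c <= eps / 2.

Let h n := b n ^+ 2.
Let h0 n : 0 < h n. Proof. exact: exprn_gt0. Qed.
Let rho n := cexp (- s * (h n)%:C).
Let H n w := hist phi (h n) w.

Let rho1 n : normc (rho n) < 1.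
Proof. by rewrite normc_discount -expR0 ltr_expR oppr_lt0 mulr_gt0. Qed.

(** The error in [dynkin] is eta times this ratio. It stays bounded as h tends to 0 because e^{-u}
    <= 1 / (1 + u) at u = h Re s. *)
Let rho_gap n : h n / (1 - normc (rho n)) <= (1 + Re s) / Re s.
Proof.
have g : 0 < 1 - normc (rho n) by rewrite subr_gt0.
have sh : 0 < Re s * h n by rewrite mulr_gt0.
have h1 : h n <= 1 by rewrite exprn_ile1 // ltW.
have r : normc (rho n) <= (1 + Re s * h n)^-1.
  rewrite normc_discount expRN lef_pV2 ?posrE ?expR_gt0 ?expR_ge1Dx //.
  by rewrite ltr_pwDl // ltW.
rewrite ler_pdivrMr //.
have g2 : Re s * h n / (1 + Re s * h n) <= 1 - normc (rho n).
  apply: le_trans (lerB (lexx 1) r); apply/eq_lew.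
  by field; rewrite gt_eqF // ltr_pwDl // ltW.
apply: (@le_trans _ _ ((1 + Re s) / Re s *
   (Re s * h n / (1 + Re s * h n)))); last first.
  by rewrite ler_wpM2l // divr_ge0 ?addr_ge0 // ltW.
rewrite (_ : _ * _ = (1 + Re s) / (1 + Re s * h n) * h n); last first.
  by field; rewrite !gt_eqF // ltr_pwDl // ltW.
rewrite -[leLHS]mul1r ler_wpM2r ?(ltW (h0 n)) // ler_pdivlMr ?ltr_pwDl ?(ltW sh) //.
by rewrite mul1r lerD2l -[leRHS]mulr1 ler_wpM2l // ltW.
Qed.

Let small_step n : (k0 n)%:R * (h n * speed c) <= eps / 2.
Proof. by rewrite mulrA k0_def. Qed.

Let small_step1 n : h n * speed c <= eps / 2.
Proof.
apply: le_trans (b_small n); rewrite ler_wpM2r ?(ltW (speed_gt0 c)) // /h expr2.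
by rewrite ler_wpM2r ?(ltW (b_gt0 n)) // (le_trans (b_le1 n)) // ler1n.
Qed.

Variable J : R -> Omega -> 'I_m.
Hypothesis hJ : forall delta w, 0 <= delta -> forall z, hit (phi^~ w) c = z%:E -> 0 < z ->
  exists2 eta, 0 < eta & forall u, z + delta - eta < u < z + delta -> phi u w = J delta w.
Let G delta w : C := hit_value (phi^~ w) c s (J delta w == j)%:R.
Let lagged delta n w : C := stopped_sum (h n) (b n) (k0 n) c
  (fun k => rho n ^+ k * (phi (k%:R * h n + delta) w == j)%:R) (H n w) (K n).

(** Two limits of the same expectations: [value_limit] identifies the limit path by path, and
    [dynkin] with [one_step] shows that the expectations tend to the initial value. *)
Lemma value_expectation : EQ (G 0) = q (f 0 i0) * fine (P A).
Proof.
have [[B0 eps0] fB f'B taylor gen] := harm.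
pose ST n w := stopped (h n) (b n) (k0 n) c (hvalue (h n) c f (rho n) (H n w)) (H n w) (K n).
have [_ lim] : nice A (fun w => q (G 0 w)) /\
    EQ (ST n) @[n --> \oo] --> EQ (G 0).
  apply: (@expect_limit ST (G 0) B).
  - move=> n; apply: (@nice_adapted _ _ _ _ _ phi_meas _ (h0 n) i0 (K n)
      (fun x => q (stopped (h n) (b n) (k0 n) c (hvalue (h n) c f (rho n) x) x (K n)))).
    by move=> x y xy; rewrite (stopped_adapted _ _ _ _ _ _ xy).
  - move=> n w _; apply: stopped_bound => k fa.
    rewrite /hvalue normcM -[leRHS]mul1r ler_pM ?normc_ge0 //.
      rewrite /rho rhoX; exact: (discount_le1 s0 (mulr_ge0 (ler0n _ _) (ltW (h0 n)))).
    exact: (value_bound b_gt0 fB small_step small_step1 fa).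
  move=> w Aw e e0.
  apply: (@value_limit R m (phi^~ w) c (right_cont w) (left_lim w) i0 Aw ci0 s L s0 hL b k0 K
    b_gt0 b_cvg k0_def K_cvg f (B + B) eps (J 0 w) j _ eps0 _ f_lip f_up small_step small_step1 e) => //.
  - by rewrite addr_ge0.
  - by move=> x i /(fB _ i) fb; apply: le_trans fb _; rewrite lerDl.
  exact: hJ.
suff lim2 : EQ (ST n) @[n --> \oo] --> q (f 0 i0) * fine (P A).
  exact: (cvg_unique _ lim lim2).
apply/cvgrPdist_le => e e0.
pose D := (1 + Re s) / Re s.
have D0 : 0 < D by rewrite divr_gt0 // addr_gt0.
have eta0 : 0 < e / D by rewrite divr_gt0.
have := one_step tf harm eta0.
rewrite near_withinE => /nbhs_ballP[a a0 ha]; have {}a0 : 0 < a by exact: a0.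
have /cvgrPdist_lt/(_ _ a0) := b_cvg.
apply: filterS => n; rewrite sub0r normrN gtr0_norm // => ba.
have ha' : ball 0 a (h n).
  rewrite /ball /= sub0r normrN gtr0_norm //; apply: le_lt_trans ba.
  by rewrite /h expr2 -[leRHS]mul1r ler_wpM2r // ltW.
have os := ha _ ha' (h0 n).
rewrite distrC.
have := dynkin phi_meas markov (h0 n) (b_gt0 n) i0 qD qR qn (rho1 n) (ltW eta0) (small_step n) os (K n).
move=> dk; apply: le_trans dk _.
rewrite mulrAC; apply: le_trans (ler_wpM2r (ltW eta0) (rho_gap n)) _.
by rewrite -/D mulrC divfK ?gt_eqF.
Qed.

Lemma lagged_expectation delta : 0 <= delta -> nice A (fun w => q (G delta w)) /\
  EQ (lagged delta n) @[n --> \oo] --> EQ (G delta).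
Proof.
move=> d0; apply: (@expect_limit (lagged delta) (G delta) 1).
- by move=> n; exact: (nice_stopped_sum phi_meas (b n) (k0 n) c (h0 n) i0 qD qR (rho n) (K n) j d0).
- move=> n w _; apply: stopped_sum_bound => // k _.
  rewrite normcM mulr_ile1 ?normc_ge0 //; last by rewrite normc_nat_bool lern1 leq_b1.
  by rewrite /rho rhoX; exact: (discount_le1 s0 (mulr_ge0 (ler0n _ _) (ltW (h0 n)))).
move=> w Aw e e0.
apply: (@lagged_limit R m (phi^~ w) c (right_cont w) (left_lim w) i0 Aw ci0 s L s0 hL b k0 K
    b_gt0 b_cvg k0_def K_cvg delta (J delta w) j e d0 _ e0).
exact: hJ.
Qed.

Let kappa delta : R := \sum_i `|p delta i i - 1|.

(** [lag_bound] is uniform along the discretization, so it survives the limit in n. The lagged sums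
    with lag 0 have the limit already computed in [value_expectation]. *)
Lemma lag_expectation delta : 0 <= delta ->
  `|EQ (G delta) - q (f 0 i0) * fine (P A)| <= kappa delta.
Proof.
move=> d0; rewrite -value_expectation.
have [_ l1] := lagged_expectation d0; have [_ l2] := lagged_expectation (lexx 0).
have l3 : `|EQ (lagged delta n) - EQ (lagged 0 n)|
    @[n --> \oo] --> `|EQ (G delta) - EQ (G 0)|.
  by apply: cvg_norm; exact: cvgB.
rewrite -(cvg_lim _ l3) //; apply: limr_le; first by apply/cvg_ex; eexists; exact: l3.
apply: nearW => n.
have -> : lagged 0 n = fun w => stopped_sum (h n) (b n) (k0 n) c
    (fun k => rho n ^+ k * (H n w k == j)%:R) (H n w) (K n).
  by apply/funext => w; rewrite /lagged; congr stopped_sum; apply/funext => k; rewrite addr0.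
apply: (lag_bound phi_meas markov (@tf_ge0 _ _ _ _ tf) (@tf_sum1 _ _ _ _ tf) (b n) (k0 n) c (h0 n) i0 qD qR qn
  (rho1 n) (K n) j d0) => i.
rewrite /kappa (bigD1 i) //=; apply: (@le_trans _ _ `|p delta i i - 1|).
  by rewrite distrC; exact: ler_norm.
by rewrite lerDl sumr_ge0.
Qed.

Lemma kappa_cvg : kappa l.+1%:R^-1 @[l --> \oo] --> 0.
Proof.
rewrite (_ : 0 = \sum_(i < m) 0); last by rewrite big1.
apply: (@cvg_sumr _ _ _ _ _ _ _ (fun i l => `|p l.+1%:R^-1 i i - 1|) (fun=> 0)) => i _.
have lim : p t i i - 1 @[t --> 0^'+] --> 0.
  have t0 : t @[t --> (0 : R)^'+] --> (0 : R) by apply: cvg_at_right_filter; exact: cvg_id.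
  have lim : t * (t^-1 * (p t i i - (i == i)%:R)) @[t --> (0 : R)^'+] --> 0 * T i i.
    by apply: cvgM => //; exact: (@tf_generator _ _ _ _ tf i i).
  rewrite mul0r in lim; apply: cvg_trans lim; apply: near_eq_cvg; near=> t.
  have tt : t != 0 by rewrite gt_eqF //; near: t; exact: nbhs_right_gt.
  by rewrite /= eqxx mulrA mulfV // mul1r.
have {}lim := (cvg_at_rightP _ _ _).1 lim (fun l => l.+1%:R^-1).
suff : `|p l.+1%:R^-1 i i - 1| @[l --> \oo] --> `|0 : R| by rewrite normr0.
apply: cvg_norm; apply: lim; split=> [l|]; first by rewrite invr_gt0 ltr0n.
exact: cvg_harmonic.
Unshelve. all: by end_near. Qed.

(** Only now does the lag tend to 0: path by path [G] converges to the passage weight by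
    [left_state_right], while [kappa] controls the expectations. *)
Lemma passage_expectation_of_steps :
  EQ (passage_weight c phi s 0 0 j) = q (f 0 i0) * fine (P A).
Proof.
pose dl l : R := l.+1%:R^-1.
have dl0 l : 0 < dl l by rewrite invr_gt0 ltr0n.
have [_ l1] : nice A (fun w => q (passage_weight c phi s 0 0 j w)) /\
    EQ (G (dl l)) @[l --> \oo] -->
    EQ (passage_weight c phi s 0 0 j).
  apply: (@expect_limit (fun l => G (dl l)) _ 1).
  - by move=> l; case: (lagged_expectation (ltW (dl0 l))).
  - by move=> l w Aw; apply: normc_hit_value => //; rewrite normc_nat_bool lern1 leq_b1.
  move=> w Aw e e0.
  rewrite /passage_weight passage_time_hit /G /hit_value.
  have [[hz _]|[z [z0 hz _ _]]] := hit_cases (right_cont w) (left_lim w) Aw ci0.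
    by apply: nearW => l; rewrite hz subrr normc0 ltW.
  have [a a0 ha] := left_state_right (right_cont w) z0.
  have /cvgrPdist_lt/(_ _ a0) := @cvg_harmonic R.
  apply: filterS => l; rewrite sub0r normrN gtr0_norm ?invr_gt0 ?ltr0n // => la.
  have [eta eta0 heta] := hJ (ltW (dl0 l)) hz z0.
  by rewrite hz (ha _ _ _ (dl0 l) la eta0 heta) subrr normc0 ltW.
suff l2 : EQ (G (dl l)) @[l --> \oo] --> q (f 0 i0) * fine (P A).
  exact: (cvg_unique _ l1 l2).
apply/cvgrPdist_le => e e0.
have /cvgrPdist_le/(_ _ e0) := kappa_cvg.
apply: filterS => l kl; rewrite distrC; apply: le_trans (lag_expectation (ltW (dl0 l))) _.
by apply: le_trans kl; rewrite sub0r normrN; exact: ler_norm.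
Qed.

End PassageExpectation.

Lemma passage_expectation (R : realType) (m : nat) (d : measure_display) (Omega : measurableType d)
  (P : probability Omega R) (T : 'M[R]_m) (phi : R -> Omega -> 'I_m) (c : 'I_m -> R) (s : R[i])
  (chain : continuous_time_Markov_chain P T phi) (s0 : 0 < Re s)
  (i0 j : 'I_m) (ci0 : c i0 < 0) (f f' : R -> 'I_m -> R[i]) (B eps : R)
  (harm : level_harmonic T c s eps B f f')
  (f_up : forall i, 0 < c i -> f 0 i = (i == j)%:R)
  (q : R[i] -> R) (qD : forall x y, q (x + y) = q x + q y)
  (qR : forall (r : R) x, q (r%:C * x) = r * q x) (qn : forall x, `|q x| <= normc x) :
  expect P [set w | phi 0 w = i0] (fun w => q (passage_weight c phi s 0 0 j w)) =
  q (f 0 i0) * fine (P [set w | phi 0 w = i0]).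
Proof.
have [[B0 eps0] _ _ _ _] := harm.
have [phi_meas right_cont left_lim [p tf markov]] := chain.
(* The choice is made separately for each lag and path, without regard to measurability, which is
   recovered from bounded convergence. *)
have /choice[J hJ] : forall dw : R * Omega, exists J, 0 <= dw.1 ->
    forall z, hit (phi^~ dw.2) c = z%:E -> 0 < z ->
    exists2 eta, 0 < eta & forall u, z + dw.1 - eta < u < z + dw.1 -> phi u dw.2 = J.
  move=> [delta w] /=; have [d0|d0] := leP 0 delta; last by exists i0.
  by have [J hJ] := left_state c (left_lim w) d0; exists J.
pose L := (Num.truncn (2 / `|c i0|)).+1.
have Ls : 0 < L%:R * speed c by rewrite mulr_gt0 ?ltr0n // speed_gt0.
have a0 : 0 < eps / 2 / (L%:R * speed c) by rewrite !divr_gt0.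
have [b [k0 [K [b0 bc k0E Kc bs]]]] := step_sequences L a0.
apply: (@passage_expectation_of_steps R m d Omega P T phi c p s phi_meas right_cont left_lim tf markov
  s0 i0 j ci0 q qD qR qn f f' B eps harm f_up b k0 K b0 bc k0E Kc _ _
  (fun delta w => J (delta, w))) => [n|n|delta w d0].
- by case: (bs n).
- by rewrite mulrAC mulrC -ler_pdivlMr //; case: (bs n).
- exact: (hJ (delta, w) d0).
Qed.

(** [Xi] is shown to equal the solution built by iteration, so both the bound and the equation are
    inherited. [start] makes the conditioning event non-null, so that its probability cancels. *)
Lemma Xi_riccati (R : realType) (m : nat) (T : 'M[R]_m) (c : 'I_m -> R) (Sp Sm S0 : {set 'I_m})
  (Sp_def : forall i, (i \in Sp) = (0 < c i)) (Sm_def : forall i, (i \in Sm) = (c i < 0))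
  (S0_def : forall i, (i \in S0) = (c i == 0))
  (genT : conservative_generator T)
  (d : measure_display) (Omega : measurableType d) (P : probability Omega R)
  (phi : R -> Omega -> 'I_m) (chain : continuous_time_Markov_chain P T phi)
  (start : forall i, i \in Sm -> (0 < P [set w | phi 0%R w = i])%E)
  (s : R[i]) (s_gt0 : 0 < Re s) :
  rbound (Xi c phi P Sm Sp s) 1 /\
  riccati (Qpp T c Sp S0 s) (Qpm T c Sp Sm S0 s) (Qmm T c Sm S0 s) (Qmp T c Sp Sm S0 s)
    (Xi c phi P Sm Sp s) = 0.
Proof.
have [K K1 ricK] := riccati_solution (fluid_uniformization genT s_gt0 Sp_def Sm_def S0_def).
suff -> : Xi c phi P Sm Sp s = K by [].
apply/matrixP => k j; rewrite mxE.
have [f [f' [eps [B [harm f_up f_down]]]]] :=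
  riccati_test_function genT s_gt0 Sp_def Sm_def S0_def K1 ricK j.
have ck : c (enum_val k) < 0 by rewrite -Sm_def enum_valP.
have E := passage_expectation chain s_gt0 ck harm f_up.
have ReR (r : R) (x : R[i]) : Re (r%:C * x) = r * Re x.
  by rewrite ReM /= mul0r subr0.
have ImR (r : R) (x : R[i]) : Im (r%:C * x) = r * Im x.
  by rewrite ImM /= mul0r addr0.
have ER := E _ (@ReD R) ReR (@normc_Re R); have EI := E _ (@ImD R) ImR (@normc_Im R).
rewrite /cond_expectation -/(expect _ _ _) ER -/(expect _ _ _) EI f_down.
set A := [set w | _].
have mA : measurable A by apply: (ctmc_measurable chain).
have PA : 0 < fine (P A).
  rewrite fine_gt0 // start ?enum_valP //=.
  by apply: le_lt_trans (probability_le1 P mA) _; rewrite ltry.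
rewrite (_ : _ +i* _ = (fine (P A))%:C * K k j); last first.
  by apply/eqP; rewrite eq_complex ReR ImR /= ![_ * fine _]mulrC !eqxx.
by rewrite mulrC mulKf // eq_complex /= eqxx andbT gt_eqF.
Qed.

(** * Derivatives of the fluid generator *)

Section FluidDerivative.
Context {R : realType} {m r : nat}.
Local Notation C := R[i].
Variables (Theta : set 'rV[R]_r) (T : 'rV[R]_r -> 'M[R]_m) (c : 'rV[R]_r -> 'I_m -> R).
Variables (Sp Sm S0 : {set 'I_m}) (s : C).
Hypothesis Theta_open : open Theta.
Hypotheses
  (Sp_def : forall theta i, Theta theta -> (i \in Sp) = (0 < c theta i))
  (Sm_def : forall theta i, Theta theta -> (i \in Sm) = (c theta i < 0))
  (S0_def : forall theta i, Theta theta -> (i \in S0) = (c theta i == 0))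
  (T_generator : forall theta, Theta theta -> conservative_generator (T theta))
  (T_diff : forall theta i j, Theta theta ->
    differentiable (fun t => T t i j : R^o) theta)
  (c_diff : forall theta i, Theta theta ->
    differentiable (fun t => c t i : R^o) theta).
Hypothesis s_gt0 : 0 < Re s.
Variables (theta : 'rV[R]_r) (l : 'I_r).
Hypothesis theta_in : Theta theta.
Let p h := along theta l h.

Let near_Theta : \forall h \near (0 : R), Theta (p h).
Proof. exact: along_near. Qed.

Lemma mcdiff_block A B : mcdiff (fun h => block (T (p h)) A B).
Proof.
move=> i j; under eq_fun do rewrite mxE.
by apply: (@cdiff_real _ _ (fun t => T t (enum_val i) (enum_val j))); exact: T_diff.
Qed.

Lemma mcdiff_inv00 : mcdiff (fun h => invmx (block (T (p h)) S0 S0 - s%:M)).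
Proof.
apply: mcdiff_inv.
  apply: filterS near_Theta => h hT; apply: (@T00_unit _ _ _ Sp Sm) => //; first exact: T_generator.
  by apply: (@tripartition_sign _ _ (c (p h))) => i; [exact: Sp_def|exact: Sm_def|exact: S0_def].
by apply: mcdiffD; [exact: mcdiff_block|exact: mcdiff_cst].
Qed.

Lemma mcdiff_inv_rate (e : 'rV[R]_r -> 'I_m -> R) (A : {set 'I_m}) :
  (forall i, differentiable (fun t => e t i : R^o) theta) ->
  (forall i t, Theta t -> i \in A -> e t i != 0) ->
  mcdiff (fun h => invmx (rate_mx (e (p h)) A)).
Proof.
move=> de e0; apply: mcdiff_inv.
  apply: filterS near_Theta => h hT.
  rewrite unitmxE det_diag unitfE; apply/prodf_neq0 => k _; rewrite mxE.
  by rewrite eq_complex /= eqxx andbT e0 // enum_valP.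
move=> i j; under eq_fun do rewrite mxE mxE.
case: (i == j); last by under eq_fun do rewrite mulr0n; exact: cdiff_cst.
under eq_fun do rewrite mulr1n.
exact: (@cdiff_real _ _ (fun t => e t (enum_val i))).
Qed.

(** On S_- the rates are negative throughout [Theta], so |c| coincides with the differentiable
    function - c near theta. *)
Lemma mcdiff_inv_abs_rate : mcdiff (fun h => invmx (abs_rate_mx (c (p h)) Sm)).
Proof.
apply: (@mcdiff_near _ _ _ (fun h => invmx (rate_mx (fun i => - c (p h) i) Sm))).
  apply: filterS near_Theta => h hT; congr invmx; congr diag_mx; apply/rowP => i; rewrite !mxE.
  by rewrite ltr0_norm // -Sm_def // enum_valP.
apply: (@mcdiff_inv_rate (fun t i => - c t i)).
  by move=> i; apply: differentiableN; exact: c_diff.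
by move=> i t tT; rewrite (Sm_def _ tT) oppr_eq0 => /lt_eqF ->.
Qed.

Lemma mcdiff_inv_rate_pos : mcdiff (fun h => invmx (rate_mx (c (p h)) Sp)).
Proof.
apply: mcdiff_inv_rate; first by move=> i; exact: c_diff.
by move=> i t tT; rewrite (Sp_def _ tT) => /gt_eqF ->.
Qed.

Let mcdiff_via0 A B :
  mcdiff (fun h => - (block (T (p h)) A S0 *m invmx (block (T (p h)) S0 S0 - s%:M) *m block (T (p h)) S0 B)).
Proof.
apply: mcdiffN; apply: mcdiffM; last exact: mcdiff_block.
by apply: mcdiffM; [exact: mcdiff_block|exact: mcdiff_inv00].
Qed.

Lemma mcdiff_Qpp : mcdiff (fun h => Qpp (T (p h)) (c (p h)) Sp S0 s).
Proof.
apply: mcdiffM; first exact: mcdiff_inv_rate_pos.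
apply: mcdiffD; last exact: mcdiff_via0.
by apply: mcdiffD; [exact: mcdiff_block|exact: mcdiff_cst].
Qed.

Lemma mcdiff_Qpm : mcdiff (fun h => Qpm (T (p h)) (c (p h)) Sp Sm S0 s).
Proof.
apply: mcdiffM; first exact: mcdiff_inv_rate_pos.
by apply: mcdiffD; [exact: mcdiff_block|exact: mcdiff_via0].
Qed.

Lemma mcdiff_Qmm : mcdiff (fun h => Qmm (T (p h)) (c (p h)) Sm S0 s).
Proof.
apply: mcdiffM; first exact: mcdiff_inv_abs_rate.
apply: mcdiffD; last exact: mcdiff_via0.
by apply: mcdiffD; [exact: mcdiff_block|exact: mcdiff_cst].
Qed.

Lemma mcdiff_Qmp : mcdiff (fun h => Qmp (T (p h)) (c (p h)) Sp Sm S0 s).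
Proof.
apply: mcdiffM; first exact: mcdiff_inv_abs_rate.
by apply: mcdiffD; [exact: mcdiff_block|exact: mcdiff_via0].
Qed.

End FluidDerivative.

Lemma dmx_cvg (R : realType) r a b (M : 'rV[R]_r -> 'M[R[i]]_(a, b)) theta l :
  mcdiff (fun h => M (along theta l h)) ->
  mccvg (0 : R)^' (fun h => (h^-1)%:C *: (M (along theta l h) - M (along theta l 0)))
    (block_col (dmx M theta) l).
Proof.
move=> dM i j; rewrite mxE mxE mxtens_indexK /=.
rewrite (_ : (fun h => _) = cquot ((fun t => M t i j) \o along theta l)).
  by apply: cdiff_cquot; exact: (dM i j).
by apply/funext => h; rewrite !mxE /cquot.
Qed.

Theorem theorem2 (R : realType) (m r : nat)
  (Theta : set 'rV[R]_r) (Theta_open : open Theta)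
  (T : 'rV[R]_r -> 'M[R]_m) (c : 'rV[R]_r -> 'I_m -> R)
  (Sp Sm S0 : {set 'I_m})
  (Sp_def : forall theta i, Theta theta -> (i \in Sp) = (0 < c theta i))
  (Sm_def : forall theta i, Theta theta -> (i \in Sm) = (c theta i < 0))
  (S0_def : forall theta i, Theta theta -> (i \in S0) = (c theta i == 0))
  (Sp_neq0 : Sp != finset.set0) (Sm_neq0 : Sm != finset.set0)
  (T_generator : forall theta, Theta theta -> conservative_generator (T theta))
  (T_diff : forall theta i j, Theta theta ->
    differentiable (fun t => T t i j : R^o) theta)
  (c_diff : forall theta i, Theta theta ->
    differentiable (fun t => c t i : R^o) theta)
  (d : measure_display) (Omega : measurableType d)
  (P : 'rV[R]_r -> probability Omega R)
  (phi : 'rV[R]_r -> R -> Omega -> 'I_m)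
  (phi_chain : forall theta, Theta theta ->
    continuous_time_Markov_chain (P theta) (T theta) (phi theta))
  (phi_start : forall theta i, Theta theta -> i \in Sm ->
    (0 < P theta [set w | phi theta 0%R w = i])%E)
  (theta : 'rV[R]_r) (theta_in : Theta theta)
  (s : R[i]) (s_gt0 : 0 < complex.Re s) :
  let Xi_ t := Xi (c t) (phi t) (P t) Sm Sp s in
  let Qpp_ t := Qpp (T t) (c t) Sp S0 s in
  let Qpm_ t := Qpm (T t) (c t) Sp Sm S0 s in
  let Qmm_ t := Qmm (T t) (c t) Sm S0 s in
  let Qmp_ t := Qmp (T t) (c t) Sp Sm S0 s in
  let I : 'M[R[i]]_r := 1%:M in
  let J := Qmm_ theta + Xi_ theta *m Qpm_ theta in
  let U := Qpp_ theta + Qpm_ theta *m Xi_ theta in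
  let A := J in
  let B := tensmx I U in
  let D := dmx Qmp_ theta + dmx Qmm_ theta *m tensmx I (Xi_ theta)
    + Xi_ theta *m dmx Qpp_ theta
    + Xi_ theta *m (dmx Qpm_ theta *m tensmx I (Xi_ theta)) in
  dmx_exists Xi_ theta /\
  forall X : 'M[R[i]]_(#|Sm|, r * #|Sp|),
    A *m X + X *m B = - D <-> X = dmx Xi_ theta.
Proof.
move=> Xi_ Qpp_ Qpm_ Qmm_ Qmp_ I J U A B D.
have ric t : Theta t -> rbound (Xi_ t) 1 /\ riccati (Qpp_ t) (Qpm_ t) (Qmm_ t) (Qmp_ t) (Xi_ t) = 0.
  move=> tT; apply: Xi_riccati => //; [by move=> i; exact: Sp_def|by move=> i; exact: Sm_def|
    by move=> i; exact: S0_def|exact: T_generator|exact: phi_chain|by move=> i; exact: phi_start].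
have unif t : Theta t -> uniformizable (Qpp_ t) (Qpm_ t) (Qmm_ t) (Qmp_ t).
  move=> tT; apply: fluid_uniformization => //; [exact: T_generator|
    by move=> i; exact: Sp_def|by move=> i; exact: Sm_def|by move=> i; exact: S0_def].
have [bXi rXi] := ric _ theta_in.
have [kappa kappa0 stable] := riccati_stable (unif _ theta_in).
(* The stability bound with G = 0 and g = 0. *)
have inj X : J *m X + X *m U = 0 -> X = 0.
  move=> h; have b0 : rbound X (kappa * 0).
    apply: (stable (Xi_ theta) (Xi_ theta) _ 0) => //; last by rewrite oppr0.
    by move=> i; rewrite rsum0.
  apply/matrixP => i j; rewrite mxE; apply: eq0_normc; apply/eqP.
  rewrite eq_le normc_ge0 andbT; apply: le_trans (normc_le_rsum X i j) _.
  by have := b0 i; rewrite mulr0.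
(* The equation decouples into r Sylvester equations, one for each parameter, all with the same [J]
   and [U]. *)
have eqn (X : 'M[R[i]]_(#|Sm|, r * #|Sp|)) l :
  block_col (A *m X + X *m B) l = J *m block_col X l + block_col X l *m U.
  by rewrite block_colD block_col_mull block_col_mulr.
have DE l : block_col (- D) l = - (block_col (dmx Qmp_ theta) l
   + block_col (dmx Qmm_ theta) l *m Xi_ theta + Xi_ theta *m block_col (dmx Qpp_ theta) l
   + Xi_ theta *m (block_col (dmx Qpm_ theta) l *m Xi_ theta)).
  by rewrite /D /I block_colN !block_colD block_col_mulr !(block_col_mull (Xi_ theta)) block_col_mulr.
(* Any solution of the l-th equation is the limit of the difference quotients of [Xi_]; existence of
   the derivative is a conclusion here. *)
have der l X : J *m X + X *m U = block_col (- D) l ->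
  mccvg (0 : R)^' (fun h => (h^-1)%:C *: (Xi_ (along theta l h) - Xi_ (along theta l 0))) X.
  move=> hX.
  apply: (@riccati_derivative _ _ _ (fun h => Qpp_ (along theta l h)) (fun h => Qpm_ (along theta l h))
    (fun h => Qmm_ (along theta l h)) (fun h => Qmp_ (along theta l h)) (fun h => Xi_ (along theta l h))
    (block_col (dmx Qpp_ theta) l) (block_col (dmx Qpm_ theta) l) (block_col (dmx Qmm_ theta) l)
    (block_col (dmx Qmp_ theta) l)).
  - by apply: dmx_cvg; apply: (@mcdiff_Qpp _ _ _ Theta) => //; eassumption.
  - by apply: dmx_cvg; apply: (@mcdiff_Qpm _ _ _ Theta) => //; eassumption.
  - by apply: dmx_cvg; apply: (@mcdiff_Qmm _ _ _ Theta) => //; eassumption.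
  - by apply: dmx_cvg; apply: (@mcdiff_Qmp _ _ _ Theta) => //; eassumption.
  - by rewrite along0; exact: unif.
  - by apply: filterS (along_near l Theta_open theta_in) => h hT; exact: ric.
  - by rewrite !along0 -DE.
(* Injectivity yields a solution, and [der] turns it into a derivative. *)
have dXi l : mcdiff (fun h => Xi_ (along theta l h)).
  have [X hX] := sylvester_solvable inj (block_col (- D) l).
  move=> i j; exists (X i j).
  rewrite (_ : cquot _ = fun h =>
    ((h^-1)%:C *: (Xi_ (along theta l h) - Xi_ (along theta l 0))) i j); first exact: der.
  by apply/funext => h; rewrite /cquot [RHS]mxE [X in _ = _ * X]mxE [X in _ = _ * (_ + X)]mxE.
have sol : A *m dmx Xi_ theta + dmx Xi_ theta *m B = - D.
  apply: block_col_inj => l; rewrite eqn.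
  have [X hX] := sylvester_solvable inj (block_col (- D) l).
  suff -> : block_col (dmx Xi_ theta) l = X by [].
  apply/matrixP => i j; apply: ccvg_unique (der l X hX i j).
  exact: (dmx_cvg (dXi l)).
split.
  move=> i j l; have [L hL] := dXi l i j.
  by have [] := @cpartialP _ _ (fun t => Xi_ t i j) l theta L hL.
move=> X; split => [hX|->] //.
apply: block_col_inj => l; apply/eqP; rewrite -subr_eq0; apply/eqP; apply: inj.
have e : block_col (A *m X + X *m B) l = block_col (A *m dmx Xi_ theta + dmx Xi_ theta *m B) l.
  by rewrite hX sol.
rewrite !eqn in e.
by rewrite mulmxBr mulmxBl addrACA e -opprD subrr.
Qed.
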